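(* For each $\beta\in\{1,2,4\}$, as $n\to\infty$, $$f_{\beta,n}'(0)\sim-\frac{2\sqrt2}{\pi}\,n^{1/2},$$ where $f_{\beta,n}(\varepsilon)$ is the probability that a random matrix from the Gaussian ensemble $G_{\beta,n}$ has no eigenvalues in $(-\varepsilon,\varepsilon)$ and $f'_{\beta,n}(0)=\lim_{\varepsilon\to0^+}f'_{\beta,n}(\varepsilon)$.
   Context: For $\beta=1,2,4$ the ensembles $G_{\beta,n}$ are the GOE, GUE and GSE of size $n$, with joint eigenvalue density on $\mathbb{R}^n$ $$F_{\beta,n}(\lambda)=C_\beta(n)\exp\Big(-\frac{\beta}{2}\sum_{j=1}^n\lambda_j^2\Big)\prod_{1\le j<k\le n}|\lambda_k-\lambda_j|^{\beta},$$ $$C_\beta(n)=(2\pi)^{-n/2}\beta^{\,n(n-1)\beta/4+n/2}\prod_{j=1}^n\frac{\Gamma(1+\beta/2)}{\Gamma(1+j\beta/2)}.$$ Thus, for $\varepsilon>0$, $f_{\beta,n}(\varepsilon)=\int_{((-\infty,-\varepsilon)\cup(\varepsilon,+\infty))^n}F_{\beta,n}(\lambda)\,d\lambda$. The notation $a_n\sim b_n$ means $a_n/b_n\to1$. *)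

(* Defs.v *)
(* Libraries: MathComp and MathComp-Analysis. *)
From HB Require Import structures.
From mathcomp Require Import all_boot all_order all_algebra.
From mathcomp Require Import all_classical all_reals all_analysis.

Set Implicit Arguments.
Unset Strict Implicit.
Unset Printing Implicit Defensive.

Import Order.TTheory GRing.Theory Num.Theory.
Import numFieldNormedType.Exports.

Local Open Scope classical_set_scope.
Local Open Scope ring_scope.

Section lebesgue_cons.
Context (R : realType) (n : nat)
  (mu : {sigma_finite_measure set (n.-tuple (measurableTypeR R)) -> \bar R}).
Local Notation T := (measurableTypeR R).

Definition tuple_cons (p : T * n.-tuple T) : n.+1.-tuple T :=
  [tuple of p.1 :: p.2].

Definition tuple_uncons (t : n.+1.-tuple T) : T * n.-tuple T :=
  (thead t, [tuple of behead t]).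

Lemma tuple_consK : cancel tuple_cons tuple_uncons.
Proof. by case=> x t; apply: injective_projections; [|apply/val_inj]. Qed.

Lemma measurable_tuple_cons : measurable_fun [set: _] tuple_cons.
Proof. by apply: measurable_cons. Qed.

Lemma measurable_tuple_uncons : measurable_fun [set: _] tuple_uncons.
Proof.
apply: measurable_fun_pair; last exact: measurable_behead.
exact: measurable_tnth.
Qed.

Definition lebesgue_cons : set (n.+1.-tuple T) -> \bar R :=
  pushforward (@lebesgue_measure R \x mu)%E tuple_cons.

Let nu : {measure set (n.+1.-tuple T) -> \bar R} :=
  measure_function_pushforward__canonical__measure_function_Measure
    (@lebesgue_measure R \x mu)%E measurable_tuple_cons.

HB.instance Definition _ := isMeasure.Build _ _ _ lebesgue_cons
  (@measure0 _ _ _ nu) (@measure_ge0 _ _ _ nu)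
  (@measure_semi_sigma_additive _ _ _ nu).

Let lebesgue_cons_sigma_finite : sigma_finite setT lebesgue_cons.
Proof.
have /sigma_finiteP[F [TF ndF Foo]] := sigma_finiteT (@lebesgue_measure R).
have /sigma_finiteP[G [TG ndG Goo]] := sigma_finiteT mu.
exists (fun k => tuple_uncons @^-1` (F k `*` G k)).
  apply/seteqP; split=> // t _.
  have [k _ Fk] : (\bigcup_k F k) (tuple_uncons t).1 by rewrite -TF.
  have [l _ Gl] : (\bigcup_k G k) (tuple_uncons t).2 by rewrite -TG.
  exists (maxn k l) => //; split.
  - by move: Fk; exact/subsetPset/ndF/leq_maxl.
  - by move: Gl; exact/subsetPset/ndG/leq_maxr.
move=> k; have [mF Fk] := Foo k; have [mG Gk] := Goo k; split.
  rewrite -[X in measurable X]setTI.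
  by apply: measurable_tuple_uncons => //; exact: measurableX.
rewrite /lebesgue_cons /pushforward -comp_preimage.
rewrite (_ : _ \o _ = id); last by apply/funext => p /=; rewrite tuple_consK.
rewrite preimage_id product_measure1E//.
by rewrite lte_mul_pinfty// ge0_fin_numE.
Qed.

HB.instance Definition _ := Measure_isSigmaFinite.Build _ _ _ lebesgue_cons
  lebesgue_cons_sigma_finite.
End lebesgue_cons.

(* Lebesgue measure on R^n, points of R^n being n-tuples: the point mass for
   n = 0, and the product of the one-dimensional Lebesgue measure with
   lebesgue_tuple R n, transported along (x, t) |-> x :: t, for n.+1. *)
Fixpoint lebesgue_tuple (R : realType) (n : nat) :
    {sigma_finite_measure set (n.-tuple (measurableTypeR R)) -> \bar R} :=
  match n with
  | 0 => (@dirac _ (0.-tuple (measurableTypeR R)) [tuple] R)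
  | m.+1 => lebesgue_cons (lebesgue_tuple R m)
  end.

Lemma lebesgue_tuple_box (R : realType) (n : nat)
    (A : 'I_n -> set (measurableTypeR R)) :
  (forall i, measurable (A i)) ->
  lebesgue_tuple R n [set t | forall i, A i (tnth t i)] =
    (\prod_(i < n) lebesgue_measure (A i))%E.
Proof.
elim: n A => [|n IH] A mA.
  rewrite big_ord0 /= /dirac indicE mem_set//= => -[].
  by case.
rewrite big_ord_recl /= /lebesgue_cons /pushforward -IH//.
rewrite -product_measure1E//; last first.
  rewrite (_ : mkset _ = \bigcap_(i in [set: 'I_n])
      ((fun t : n.-tuple (measurableTypeR R) => tnth t i)
        @^-1` A (lift ord0 i))); last first.
    by apply/seteqP; split=> [t h i _|t h i]; exact: h.
  apply: fin_bigcap_measurable; first exact: finite_finset.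
  move=> i _; rewrite -[X in measurable X]setTI.
  by apply: measurable_tnth.
congr (_ \x _)%E; apply/seteqP; split=> [[x t] h|[x t] [h0 h] i] /=.
  split=> [|i]; first exact: (h ord0).
  by have := h (lift ord0 i); rewrite /= tnthS.
by case: (unliftP ord0 i) => [j ->|->]; rewrite ?tnthS//; exact: h.
Qed.

Definition Gamma (R : realType) (x : R) : R :=
  \int[@lebesgue_measure R]_(t in `]0, +oo[) (t `^ (x - 1) * expR (- t)).

Definition gaussian_constant (R : realType) (beta n : nat) : R :=
  let b : R := beta%:R in let N : R := n%:R in
  (2 * pi) `^ (- (N / 2)) * b `^ (N * (N - 1) * b / 4 + N / 2) *
  \prod_(1 <= j < n.+1) (Gamma (1 + b / 2) / Gamma (1 + j%:R * b / 2)).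

(* The joint eigenvalue density of the n x n GOE, GUE and GSE for beta = 1, 2
   and 4 respectively. *)
Definition gaussian_density (R : realType) (beta n : nat)
    (l : n.-tuple (measurableTypeR R)) : R :=
  gaussian_constant R beta n *
  expR (- (beta%:R / 2) * \sum_(j < n) tnth l j ^+ 2) *
  \prod_(k < n) \prod_(j < n | (j < k)%N) `|tnth l k - tnth l j| ^+ beta.

(* The probability of having no eigenvalue in (-eps, eps). *)
Definition gap_probability (R : realType) (beta n : nat) (eps : R) : R :=
  \int[lebesgue_tuple R n]_(l in
      [set l | forall i, (`]-oo, - eps[ `|` `]eps, +oo[) (tnth l i)])
    gaussian_density beta l.

(* The limit is a junk value unless it exists; existence has to be asserted
   separately. *)
Definition gap_probability_slope (R : realType) (beta n : nat) : R :=
  lim (derive1 (gap_probability beta n) eps @[eps --> (0 : R)^'+]).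

(* Main.v *)
(* The gap probability is a determinant: for eps >= 0 it equals
   kappa * det M(eps), where the entries of M are tail integrals
   \int_(]eps, +oo[) x ^ k e^(- c x ^ 2) dx.  For beta = 2 this is Andreief's
   identity for the square of the Vandermonde determinant, sorted by parity of
   the exponents; for beta = 4 its fourth power is a confluent Vandermonde
   determinant and de Bruijn's pairing reduces the Pfaffian to a determinant by
   parity.  For beta = 1 one splits off the coordinate y of least absolute
   value: sgn (x_j - y) = sgn x_j for the other ones, so that the sign of the
   Vandermonde determinant factors, and the resulting recursion in n is solved
   by determinants of iterated tails.

   At eps = 0 only the row 0 of M' is nonzero, so that if r *m M(0) is that row,
   then the slope is r_0 * kappa * det M(0) = r_0.  M(0) is a Hankel matrix of
   Gaussian moments (1/2)_(i + j), which is inverted with the finite difference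
   identity behind the Laguerre polynomials; its determinant matches the
   normalization of the density up to sign, and the sign is that of a
   probability.  The slopes so obtained are multiples of
   sum_(k < N) (1/2)_k / k! = 2 N (1/2)_N / N!, up to a bounded alternating
   sum, and log-convexity of the Gaussian moments gives Wallis' bounds for it. *)
Require Import Defs.
From mathcomp Require Import all_boot all_order fingroup perm all_algebra.
From mathcomp Require Import all_classical all_reals all_analysis.
From mathcomp Require Import measurable_realfun.
From mathcomp Require Import ring lra zify.

Set Implicit Arguments.
Unset Strict Implicit.
Unset Printing Implicit Defensive.

Import Order.TTheory GRing.Theory Num.Theory.
Import numFieldNormedType.Exports.

Local Open Scope classical_set_scope.
Local Open Scope ring_scope.

(** * Integration over tuples: peeling off one coordinate, and products of functions of one
    coordinate *)

Section tuple_integral.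
Context (R : realType).
Local Notation T := (measurableTypeR R).
Local Notation mu := (@lebesgue_measure R).
Local Notation Lam := (@lebesgue_tuple R).

(** For beta = 1 the obstacle is the sign of the Vandermonde determinant. Once the coordinate [y] of
    least absolute value is pulled out, the factor sgn x_j left on every other coordinate turns even
    functions into odd ones and conversely: two families of functions alternate in the recursion,
    and the terms where [y] sits in an odd function integrate to zero. Identities between iterated
    tails are obtained by comparing derivatives and limits at +oo.

    No sign of a row permutation is computed: it suffices that the determinant formula has absolute
    value 1 at eps = 0, which is checked against the Gamma quotients by induction on the size. Only
    row 0 of M' survives at 0 because the tail of x^k e^(-c x^2) has derivative - x^k e^(-c x^2),
    which vanishes at 0 unless k = 0.

    The common constant: the sum of the first N numbers (1/2)_k / k! is about 2 sqrt(N / pi). Here N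
    is about n / 2 with prefactor 2 / sqrt pi for beta = 1, 2, and N = n with prefactor 1 / sqrt(pi
    / 2) for beta = 4; both give (2 sqrt 2 / pi) sqrt n. *)

Lemma ge0_integral_lebesgue_tupleS n (h : n.+1.-tuple T -> \bar R) :
  measurable_fun setT h -> (forall t, 0 <= h t)%E ->
  (\int[Lam n.+1]_t h t = \int[mu]_x \int[Lam n]_t h (tuple_cons (x, t)))%E.
Proof.
move=> mh h0.
rewrite [LHS](ge0_integral_pushforward (@measurable_tuple_cons R n))//.
rewrite fubini_tonelli1//; last by move=> x; exact: h0.
by apply: measurableT_comp => //; exact: measurable_tuple_cons.
Qed.

Lemma integrable_lebesgue_tupleS n (h : n.+1.-tuple T -> \bar R) :
  measurable_fun setT h ->
  (Lam n.+1).-integrable setT h <->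
  (mu \x Lam n)%E.-integrable setT (h \o @tuple_cons R n).
Proof.
move=> mh.
have mhc : measurable_fun setT (h \o @tuple_cons R n).
  by apply: measurableT_comp => //; exact: measurable_tuple_cons.
split=> /integrableP[_ H]; apply/integrableP; split => //.
  rewrite fubini_tonelli1//; last exact: measurableT_comp.
  rewrite ge0_integral_lebesgue_tupleS// in H; exact: measurableT_comp.
rewrite fubini_tonelli1// in H; last exact: measurableT_comp.
rewrite ge0_integral_lebesgue_tupleS//; exact: measurableT_comp.
Qed.

Lemma integral_lebesgue_tupleS n (h : n.+1.-tuple T -> \bar R) :
  (Lam n.+1).-integrable setT h ->
  (\int[Lam n.+1]_t h t = \int[mu]_x \int[Lam n]_t h (tuple_cons (x, t)))%E.
Proof.
move=> ih.
have mh : measurable_fun setT h by case/integrableP: ih.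
have ihc : (mu \x Lam n)%E.-integrable setT (h \o @tuple_cons R n).
  exact/integrable_lebesgue_tupleS.
rewrite [LHS](integral_pushforward (@measurable_tuple_cons R n) (mu:=(mu \x Lam n)%E))//.
by rewrite preimage_setT -(integral12_prod_meas1 ihc).
Qed.

Lemma measurable_bigR (d : measure_display) (X : measurableType d) (I : Type)
    (op : R -> R -> R) (x0 : R) (r : seq I) (P : pred I) (f : I -> X -> R) :
  (forall g h : X -> R, measurable_fun setT g -> measurable_fun setT h ->
    measurable_fun setT (fun x => op (g x) (h x))) ->
  (forall i, measurable_fun setT (f i)) ->
  measurable_fun setT (fun x => \big[op/x0]_(i <- r | P i) f i x).
Proof.
move=> mop mf; elim: r => [|i r IH].
  by under eq_fun do rewrite big_nil; exact: measurable_cst.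
under eq_fun do rewrite big_cons; case: (P i) => //; exact: mop.
Qed.

Lemma measurable_sumR (d : measure_display) (X : measurableType d) (I : Type)
    (r : seq I) (P : pred I) (f : I -> X -> R) :
  (forall i, measurable_fun setT (f i)) ->
  measurable_fun setT (fun x => \sum_(i <- r | P i) f i x).
Proof. by apply: measurable_bigR => g h; exact: measurable_funD. Qed.

Lemma measurable_prodR (d : measure_display) (X : measurableType d) (I : Type)
    (r : seq I) (P : pred I) (f : I -> X -> R) :
  (forall i, measurable_fun setT (f i)) ->
  measurable_fun setT (fun x => \prod_(i <- r | P i) f i x).
Proof. by apply: measurable_bigR => g h; exact: measurable_funM. Qed.

Lemma measurable_detR (d : measure_display) (X : measurableType d) n
    (f : 'I_n -> 'I_n -> X -> R) :
  (forall i j, measurable_fun setT (f i j)) ->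
  measurable_fun setT (fun x => \det (\matrix_(i, j) f i j x)).
Proof.
move=> mf; apply: measurable_sumR => s; apply: measurable_funM => //.
apply: measurable_prodR => i; under eq_fun do rewrite mxE; exact: mf.
Qed.

Lemma lebesgue_tuple0E (h : 0.-tuple T -> \bar R) :
  (\int[Lam 0]_t h t = h [tuple])%E.
Proof.
rewrite (_ : (fun t => h t) = cst (h [tuple])); last first.
  by apply/funext => t; rewrite [t]tuple0.
rewrite /= integral_cst//= ?diracT ?mule1//.
Qed.

Section product.
Variables (n : nat) (psi : 'I_n -> T -> R).
Hypothesis ipsi : forall i, mu.-integrable setT (EFin \o psi i).

Lemma measurable_prod_tnth :
  measurable_fun setT (fun t : n.-tuple T => \prod_i psi i (tnth t i)).
Proof.
apply: measurable_prodR => i.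
have /integrableP[/measurable_EFinP mi _] := ipsi i.
by apply: measurableT_comp => //; exact: measurable_tnth.
Qed.
End product.

Lemma prod_tnth_cons n (psi : 'I_n.+1 -> T -> R) x t :
  \prod_i psi i (tnth (tuple_cons (x, t)) i) =
  psi ord0 x * \prod_i psi (lift ord0 i) (tnth t i).
Proof.
rewrite big_ord_recl; congr (_ * _).
by apply: eq_bigr => i _; rewrite /tuple_cons tnthS.
Qed.

Lemma integrable_prod_tnth n (psi : 'I_n -> T -> R) :
  (forall i, mu.-integrable setT (EFin \o psi i)) ->
  (Lam n).-integrable setT
    (EFin \o (fun t => \prod_i psi i (tnth t i))).
Proof.
elim: n psi => [|n IH] psi ipsi.
  apply/integrableP; split; first by apply/measurable_EFinP; exact: measurable_prod_tnth.
  by rewrite lebesgue_tuple0E ltry.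
have mh := measurable_prod_tnth ipsi.
apply/integrable_lebesgue_tupleS; first exact/measurable_EFinP.
apply/integrable12ltyP.
  apply: measurableT_comp; first exact/measurable_EFinP.
  exact: measurable_tuple_cons.
have IHi := IH (fun i => psi (lift ord0 i)) (fun i => ipsi _).
set K := (\int[Lam n]_t `|(\prod_i psi (lift ord0 i) (tnth t i))%:E|)%E.
have Kfin : K \is a fin_num.
  rewrite ge0_fin_numE; last exact: integral_ge0.
  by case/integrableP: IHi.
under eq_integral => x _.
  under eq_integral => t _ do rewrite /= prod_tnth_cons normrM EFinM.
  rewrite ge0_integralZl//; last first.
    apply/measurable_EFinP; apply: measurableT_comp => //.
    exact: (measurable_prod_tnth (fun i => ipsi (lift ord0 i))).
  rewrite -/K.
  over.
rewrite /= -(fineK Kfin) ge0_integralZr//; last 2 first.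
- by apply/measurable_EFinP; apply: measurableT_comp => //;
    case/integrableP: (ipsi ord0) => /measurable_EFinP.
- by rewrite lee_fin fine_ge0// integral_ge0.
have /integrableP[_ lt0] := ipsi ord0.
have i0 : (0 <= \int[mu]_x `|psi ord0 x|%:E)%E by exact: integral_ge0.
by rewrite lte_mul_pinfty ?ltry// ge0_fin_numE.
Qed.

Lemma Rintegral_prod_tnth n (psi : 'I_n -> T -> R) :
  (forall i, mu.-integrable setT (EFin \o psi i)) ->
  \int[Lam n]_t (\prod_i psi i (tnth t i)) = \prod_i \int[mu]_x psi i x.
Proof.
elim: n psi => [|n IH] psi ipsi.
  by rewrite /Rintegral lebesgue_tuple0E/= !big_ord0.
have ip := integrable_prod_tnth ipsi.
rewrite /Rintegral integral_lebesgue_tupleS//.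
have IHi := IH (fun i => psi (lift ord0 i)) (fun i => ipsi _).
have ipi := integrable_prod_tnth (fun i => ipsi (lift ord0 i)).
under eq_integral => x _.
  under eq_integral => t _ do rewrite prod_tnth_cons EFinM.
  rewrite integralZl// -[X in (_ * X)%E]fineK; last exact: integrable_fin_num.
  rewrite -[fine _]/(Rintegral _ _ _) IHi.
  over.
rewrite /= integralZr//; last exact: (ipsi ord0).
rewrite fineM// ?big_ord_recl//.
exact: integrable_fin_num (ipsi ord0).
Qed.
End tuple_integral.

Lemma Rintegral_sum (d : measure_display) (X : measurableType d) (R : realType)
    (m : {measure set X -> \bar R}) (I : Type) (r : seq I) (f : I -> X -> R) :
  (forall i, m.-integrable setT (EFin \o f i)) ->
  m.-integrable setT (EFin \o (fun x => \sum_(i <- r) f i x)) /\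
  \int[m]_x (\sum_(i <- r) f i x) = \sum_(i <- r) \int[m]_x f i x.
Proof.
move=> fi; elim: r => [|i r [IHi IH]].
  rewrite big_nil; under eq_fun do rewrite big_nil.
  split; first exact: integrable0.
  by rewrite Rintegral_cst// mul0r.
under eq_fun do rewrite big_cons.
split; first exact: (integrableD measurableT (fi i) IHi).
by rewrite big_cons RintegralD// IH.
Qed.

(** * Splitting R^n according to the coordinate of least absolute value *)

Section layer.
Context (R : realType).
Local Notation T := (measurableTypeR R).
Local Notation mu := (@lebesgue_measure R).
Local Notation Lam := (@lebesgue_tuple R).

Definition tuple_insert n (k : 'I_n.+1) (p : T * n.-tuple T) : n.+1.-tuple T :=
  [tuple if unlift k i is Some j then tnth p.2 j else p.1 | i < n.+1].

Lemma tnth_insert_self n (k : 'I_n.+1) y x : tnth (tuple_insert k (y, x)) k = y.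
Proof. by rewrite tnth_mktuple unlift_none. Qed.

Lemma tnth_insert_lift n (k : 'I_n.+1) y x (j : 'I_n) :
  tnth (tuple_insert k (y, x)) (lift k j) = tnth x j.
Proof. by rewrite tnth_mktuple liftK. Qed.

Lemma tnth_consS n y x (j : 'I_n) :
  tnth (@tuple_cons R n (y, x)) (lift ord0 j) = tnth x j.
Proof. exact: tnthS. Qed.

Lemma tuple_insert0 n y x : tuple_insert ord0 (y, x) = @tuple_cons R n (y, x).
Proof.
apply: eq_from_tnth => i; case: (unliftP ord0 i) => [j ->|->].
  by rewrite tnth_insert_lift tnth_consS.
by rewrite tnth_insert_self.
Qed.

Lemma tuple_insert_lift n (k : 'I_n.+1) y z x :
  tuple_insert (lift ord0 k) (y, tuple_cons (z, x)) =
  tuple_cons (z, tuple_insert k (y, x)).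
Proof.
have lift0 : ord0 = lift (lift ord0 k) ord0 by apply/val_inj.
have liftS (j : 'I_n) :
    lift ord0 (lift k j) = lift (lift ord0 k) (lift ord0 j).
  by apply/val_inj; rewrite /= /bump !leq0n /= ltnS; case: (k <= j)%N.
apply: eq_from_tnth => i; case: (unliftP ord0 i) => [i' ->|->]; last first.
  by rewrite [X in tnth _ X = _]lift0 tnth_insert_lift.
rewrite tnth_consS.
case: (unliftP k i') => [j ->|->]; last by rewrite !tnth_insert_self.
by rewrite liftS !tnth_insert_lift tnth_consS.
Qed.

Lemma measurable_insert n (k : 'I_n.+1) :
  measurable_fun [set: _] (@tuple_insert n k).
Proof.
apply/measurable_fun_tnthP => i; case: (unliftP k i) => [j ->|->].
  rewrite (_ : _ \o _ = fun p => tnth p.2 j); last first.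
    by apply/funext => -[y x]; exact: tnth_insert_lift.
  exact: (measurableT_comp (@measurable_tnth _ T n j) measurable_snd).
rewrite (_ : _ \o _ = fst)//.
by apply/funext => -[y x]; exact: tnth_insert_self.
Qed.

(** [lebesgue_tuple] is built by consing at the front only, so singling out another coordinate takes
    an induction: apply the hypothesis below the head [z], exchange [z] and [y] by Tonelli, and put
    [z] back. *)
Lemma ge0_integral_insert n (k : 'I_n.+1) (h : n.+1.-tuple T -> \bar R) :
  measurable_fun setT h -> (forall t, 0 <= h t)%E ->
  (\int[Lam n.+1]_t h t =
   \int[mu]_y \int[Lam n]_x h (tuple_insert k (y, x)))%E.
Proof.
move=> mh h0; elim: n k h mh h0 => [|n IH] k h mh h0.
  rewrite (ge0_integral_lebesgue_tupleS mh h0) (ord1 k).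
  by under [RHS]eq_integral do under eq_integral do rewrite tuple_insert0.
case: (unliftP ord0 k) => [k' ->|->]; last first.
  rewrite (ge0_integral_lebesgue_tupleS mh h0).
  by under [RHS]eq_integral do under eq_integral do rewrite tuple_insert0.
rewrite (ge0_integral_lebesgue_tupleS mh h0).
transitivity (\int[mu]_z \int[mu]_y \int[Lam n]_x
    h (tuple_cons (z, tuple_insert k' (y, x))))%E.
  apply: eq_integral => z _; apply: (IH k' (fun t => h (tuple_cons (z, t)))) => //.
  apply: measurableT_comp => //.
  by apply: measurableT_comp; [exact: measurable_tuple_cons|exact: measurable_pair1].
rewrite (fubini_tonelli (fun p : T * T => \int[Lam n]_x
    h (tuple_cons (p.1, tuple_insert k' (p.2, x))))%E)/=; last 2 first.
- apply: (measurable_fun_fubini_tonelli_F (fun q : (T * T) * n.-tuple T =>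
    h (tuple_cons (q.1.1, tuple_insert k' (q.1.2, q.2))))) => //.
  apply: measurableT_comp => //.
  apply: (measurableT_comp (@measurable_tuple_cons R n.+1)).
  apply: measurable_fun_pair => /=.
    by apply: measurableT_comp => //; exact: measurable_fst.
  apply: (measurableT_comp (@measurable_insert n k')).
  apply: measurable_fun_pair => //=.
  by apply: measurableT_comp => //; exact: measurable_fst.
- by move=> p; exact: integral_ge0.
apply: eq_integral => y _.
rewrite [RHS]ge0_integral_lebesgue_tupleS//; last first.
  apply: measurableT_comp => //.
  by apply: measurableT_comp; [exact: measurable_insert|exact: measurable_pair1].
apply: eq_integral => z _; apply: eq_integral => x _.
by rewrite tuple_insert_lift.
Qed.

Definition tuple_rot n (k : 'I_n.+1) (t : n.+1.-tuple T) : n.+1.-tuple T :=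
  tuple_insert k (tuple_uncons t).

Lemma measurable_tuple_rot n (k : 'I_n.+1) : measurable_fun [set: _] (tuple_rot k).
Proof.
by apply: measurableT_comp; [exact: measurable_insert|exact: measurable_tuple_uncons].
Qed.

Lemma integral_rot n (k : 'I_n.+1) (h : n.+1.-tuple T -> \bar R) :
  measurable_fun setT h ->
  (\int[Lam n.+1]_t h (tuple_rot k t) = \int[Lam n.+1]_t h t)%E.
Proof.
have ge0 (g : n.+1.-tuple T -> \bar R) :
    measurable_fun setT g -> (forall t, 0 <= g t)%E ->
    (\int[Lam n.+1]_t g (tuple_rot k t) = \int[Lam n.+1]_t g t)%E.
  move=> mg g0; rewrite (ge0_integral_insert k mg g0).
  rewrite [LHS]ge0_integral_lebesgue_tupleS//; last first.
    by apply: measurableT_comp => //; exact: measurable_tuple_rot.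
  by under eq_integral do under eq_integral do rewrite /tuple_rot tuple_consK.
move=> mh; rewrite integralE [RHS]integralE; congr (_ - _)%E.
- transitivity (\int[Lam n.+1]_t (h^\+)%E (tuple_rot k t))%E.
    by apply: eq_integral => t _; rewrite funepos_comp.
  by apply: ge0 => //; exact: measurable_funepos.
- transitivity (\int[Lam n.+1]_t (h^\-)%E (tuple_rot k t))%E.
    by apply: eq_integral => t _; rewrite funeneg_comp.
  by apply: ge0 => //; exact: measurable_funeneg.
Qed.

(** The exceptional points lie on finitely many boxes with one side [[set y; - y]], each of measure
    zero by the box formula. *)
Lemma ae_norm_neq n (y : R) :
  {ae Lam n, forall x : n.-tuple T, forall j, `|tnth x j| != `|y|}.
Proof.
(* Countable intersections of full sets are indexed by [nat]; for [m] at least [n] the condition is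
   vacuous. *)
suff : {ae Lam n, forall x (m : nat) (j : 'I_n), nat_of_ord j = m -> `|tnth x j| != `|y|}.
  apply: filterS; first exact: (ae_filter_ringOfSetsType (Lam n)).
  by move=> x H j; exact: (H j).
apply: (@ae_foralln _ (n.-tuple T) R (Lam n)
  (fun m x => forall j : 'I_n, nat_of_ord j = m -> `|tnth x j| != `|y|)) => m.
have [mn|nm] := ltnP m n; last first.
  apply: aeW => x j jm; move: (ltn_ord j).
  by rewrite jm ltnNge nm.
pose j0 := Ordinal mn.
pose A (i : 'I_n) : set T := if i == j0 then [set y; - y] else setT.
have mA i : measurable (A i).
  by rewrite /A; case: eqP => // _; apply: measurableU; exact: measurable_set1.
exists [set t | forall i, A i (tnth t i)]; split.
- rewrite (_ : mkset _ = \bigcap_(i in [set: 'I_n])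
      ((fun t : n.-tuple T => tnth t i) @^-1` A i)); last first.
    by apply/seteqP; split=> [t h i _|t h i]; exact: h.
  apply: fin_bigcap_measurable; first exact: finite_finset.
  move=> i _; rewrite -[X in measurable X]setTI.
  by apply: measurable_tnth.
- rewrite [LHS](lebesgue_tuple_box mA) (bigD1 j0)//= {1}/A eqxx.
  rewrite (_ : lebesgue_measure _ = 0%E) ?mul0e//.
  by apply/countable_lebesgue_measure0/finite_set_countable; rewrite finite_setU.
- move=> x /= /existsNP[j] /not_implyP[jm] /negP; rewrite negbK => /eqP xy i.
  rewrite /A; case: eqP => // ->.
  have -> : j0 = j by apply/val_inj.
  move: xy => /eqP; rewrite eqr_norm2 => /orP[/eqP->|/eqP->]; [by left|by right].
Qed.

(** Ties go to the smallest index, so that exactly one position qualifies at every point and the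
    indicators sum to 1 everywhere, not just almost everywhere. *)
Definition first_argmin n (k : 'I_n.+1) (t : n.+1.-tuple T) : bool :=
  [forall j : 'I_n.+1, if (j < k)%N then `|tnth t k| < `|tnth t j|
                       else `|tnth t k| <= `|tnth t j|].

Lemma sum_first_argmin n (t : n.+1.-tuple T) :
  \sum_(k < n.+1) (first_argmin k t)%:R = 1 :> R.
Proof.
have [i0 _ i0min] := Order.TotalTheory.arg_minP (fun i => `|tnth t i|)
  (isT : (xpredT : pred 'I_n.+1) ord0).
have [k /eqP ki0 kmin] := @arg_minnP _ i0 (fun i => `|tnth t i| == `|tnth t i0|)
  (@nat_of_ord n.+1) (eqxx _).
have fk : first_argmin k t.
  apply/forallP => j; rewrite ki0; case: ltnP => jk; last exact: i0min.
  rewrite lt_neqAle i0min// andbT; apply/negP; rewrite eq_sym => /kmin.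
  by rewrite leqNgt jk.
rewrite (bigD1 k)//= fk big1 ?addr0// => k' k'k.
case: (boolP (first_argmin k' t)) => // /forallP fk'.
have [kk'|kk'|kk'] := ltngtP k k'.
- have := fk' k; rewrite kk' ki0 => /lt_le_trans/(_ (i0min k' isT)).
  by rewrite ltxx.
- have := forallP fk k'; rewrite kk'.
  have := fk' k; rewrite ltnNge (ltnW kk')/= => /le_lt_trans/[apply].
  by rewrite ltxx.
- by move: k'k; rewrite (val_inj kk') eqxx.
Qed.

Lemma measurable_first_argmin n (k : 'I_n.+1) :
  measurable_fun setT (fun t => (first_argmin k t)%:R : R).
Proof.
pose F (t : n.+1.-tuple T) (j : 'I_n.+1) : R := if (j < k)%N then
  (`|tnth t k| < `|tnth t j|)%R%:R else (`|tnth t k| <= `|tnth t j|)%R%:R.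
rewrite (_ : (fun t => _) = fun t => \prod_j F t j); last first.
  apply/funext => t; case: (boolP (first_argmin k t)) => [/forallP H|].
    rewrite big1// => j _; have := H j.
    by rewrite /F; case: ifP => _ ->.
  move=> /forallPn[j jk]; rewrite (bigD1 j)//= {1}/F.
  by move: jk; case: ifP => _ /negbTE ->; rewrite mul0r.
have mnorm (j : 'I_n.+1) :
    measurable_fun setT (fun t : n.+1.-tuple T => `|tnth t j|).
  by apply: measurableT_comp => //; exact: measurable_tnth.
apply: measurable_prodR => j; rewrite /F; case: (j < k)%N.
- rewrite (_ : (fun t => _) = fun t : n.+1.-tuple T =>
    if `|tnth t k| < `|tnth t j| then 1 else 0); last first.
    by apply/funext => t; case: (_ < _).
  by apply: measurable_fun_ifT => //; exact: measurable_fun_ltr.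
- rewrite (_ : (fun t => _) = fun t : n.+1.-tuple T =>
    if `|tnth t k| <= `|tnth t j| then 1 else 0); last first.
    by apply/funext => t; case: (_ <= _).
  by apply: measurable_fun_ifT => //; exact: measurable_fun_ler.
Qed.

(** A product of 0-1 factors, one for each coordinate, so that it can later be distributed over the
    columns of a determinant. *)
Definition outside n (y : R) (x : n.-tuple T) : R :=
  \prod_j (`|y| < `|tnth x j|)%R%:R.

Lemma measurable_outside n :
  measurable_fun setT (fun p : T * n.-tuple T => outside p.1 p.2).
Proof.
apply: measurable_prodR => j.
rewrite (_ : (fun t => _) = fun p : T * n.-tuple T =>
    if `|p.1| < `|tnth p.2 j| then 1 else 0); last first.
  by apply/funext => p; case: (_ < _).
apply: measurable_fun_ifT => //; apply: measurable_fun_ltr.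
  by apply: measurableT_comp => //; exact: measurable_fst.
apply: measurableT_comp => //.
exact: (measurableT_comp (@measurable_tnth _ T n j) measurable_snd).
Qed.

(** Away from ties, strict and weak inequalities agree, and the tie-breaking by [k] disappears. *)
Lemma first_argmin_insert n (k : 'I_n.+1) y x :
  (forall j, `|tnth x j| != `|y|) ->
  (first_argmin k (tuple_insert k (y, x)))%:R = outside y x.
Proof.
move=> xy; case: (boolP (first_argmin _ _)) => [/forallP H|].
  rewrite /outside big1// => j _; have := H (lift k j).
  rewrite tnth_insert_self tnth_insert_lift.
  have -> : (`|y| < `|tnth x j|) = (`|y| <= `|tnth x j|).
    by rewrite lt_neqAle eq_sym xy.
  by case: ifP => _ ->.
move=> /forallPn[i]; case: (unliftP k i) => [j ->|->]; last first.
  by rewrite ltnn lexx.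
rewrite tnth_insert_self tnth_insert_lift => H.
rewrite /outside (bigD1 j)//= (_ : (`|y| < `|tnth x j|) = false) ?mul0r//.
by apply/negbTE; move: H; case: ifP => // _; apply: contra => /ltW.
Qed.

Lemma integrable_rot n (k : 'I_n.+1) (h : n.+1.-tuple T -> \bar R) :
  (Lam n.+1).-integrable setT h ->
  (Lam n.+1).-integrable setT (fun t => h (tuple_rot k t)).
Proof.
move=> /integrableP[mh hoo]; apply/integrableP; split.
  by apply: measurableT_comp => //; exact: measurable_tuple_rot.
have := integral_rot k (h := fun t => `|h t|%E).
by move=> ->//; exact: measurableT_comp.
Qed.

(** [tuple_rot k] preserves the measure and carries the head to position [k]; by the symmetry of [h]
    the result is the same for all [k], which later gives the factor [n.+1]. *)
Lemma Rintegral_first_argmin n (k : 'I_n.+1) (h : n.+1.-tuple T -> R) :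
  (Lam n.+1).-integrable setT (EFin \o h) ->
  (forall y x, h (tuple_insert k (y, x)) = h (tuple_cons (y, x))) ->
  (forall y, (Lam n).-integrable setT
    (EFin \o (fun x => h (tuple_cons (y, x))))) ->
  [/\ (Lam n.+1).-integrable setT
        (EFin \o (fun t => h t * (first_argmin k t)%:R)),
      mu.-integrable setT (EFin \o (fun y =>
        \int[Lam n]_x (h (tuple_cons (y, x)) * outside y x))) &
      \int[Lam n.+1]_t (h t * (first_argmin k t)%:R) =
      \int[mu]_y \int[Lam n]_x (h (tuple_cons (y, x)) * outside y x)].
Proof.
move=> ih hsym hsec.
have mh : measurable_fun setT h by case/integrableP: ih => /measurable_EFinP.
set g := fun t => h t * (first_argmin k t)%:R.
have mg : measurable_fun setT (EFin \o g).
  by apply/measurable_EFinP/measurable_funM => //; exact: measurable_first_argmin.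
have ig : (Lam n.+1).-integrable setT (EFin \o g).
  apply: le_integrable ih => // t _; rewrite lee_fin normrM ler_piMr//.
  by case: first_argmin; rewrite ?normr1// normr0.
have igr := integrable_rot k ig.
have mgr : measurable_fun setT (fun t => (EFin \o g) (tuple_rot k t)).
  by case/integrableP: igr.
have secE y : (\int[Lam n]_x (EFin \o g) (tuple_rot k (tuple_cons (y, x))) =
    (\int[Lam n]_x (h (tuple_cons (y, x)) * outside y x))%:E)%E; last first.
  split=> //.
    have := integrable_fubini_F ((integrable_lebesgue_tupleS mgr).1 igr).
    by apply: eq_integrable => // y _; exact: secE.
  rewrite {1}/Rintegral -(integral_rot k mg) (integral_lebesgue_tupleS igr).
  by under eq_integral do rewrite secE.
have mo : measurable_fun setT (fun x : n.-tuple T => outside y x).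
  exact: (measurableT_comp (@measurable_outside n) (measurable_pair1 y)).
have mc : measurable_fun setT (fun x => h (tuple_cons (y, x))).
  by case/integrableP: (hsec y) => /measurable_EFinP.
rewrite /Rintegral fineK; last first.
  apply: integrable_fin_num => //; apply: le_integrable (hsec y) => //.
    by apply/measurable_EFinP/measurable_funM.
  move=> x _; rewrite lee_fin normrM ler_piMr// /outside ger0_norm.
    by apply: prodr_ile1 => j _; case: (_ < _); rewrite /= ?lexx ler01.
  by apply: prodr_ge0 => j _; rewrite ler0n.
apply: ae_eq_integral => //.
- apply: (measurableT_comp mg).
  apply: measurableT_comp; first exact: measurable_tuple_rot.
  by apply: measurableT_comp; [exact: measurable_tuple_cons|exact: measurable_pair1].
- by apply/measurable_EFinP/measurable_funM.
- apply: (@filterS _ _ (ae_filter_ringOfSetsType (Lam n)) _ _ _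
    (ae_norm_neq n y)).
  move=> x xy _; rewrite /= /g /tuple_rot tuple_consK hsym.
  by rewrite first_argmin_insert.
Qed.

(* An integrand invariant under moving the first coordinate to any position may
   be integrated over the points whose first coordinate has the least absolute
   value. *)
Lemma Rintegral_min_first n (h : n.+1.-tuple T -> R) :
  (Lam n.+1).-integrable setT (EFin \o h) ->
  (forall k y x, h (tuple_insert k (y, x)) = h (tuple_cons (y, x))) ->
  (forall y, (Lam n).-integrable setT
    (EFin \o (fun x => h (tuple_cons (y, x))))) ->
  mu.-integrable setT (EFin \o (fun y =>
    \int[Lam n]_x (h (tuple_cons (y, x)) * outside y x))) /\
  \int[Lam n.+1]_t h t = n.+1%:R *
    \int[mu]_y \int[Lam n]_x (h (tuple_cons (y, x)) * outside y x).
Proof.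
move=> ih hsym hsec.
have H k := Rintegral_first_argmin ih (hsym k) hsec.
split; first by case: (H ord0).
transitivity (\int[Lam n.+1]_t \sum_(k < n.+1) (h t * (first_argmin k t)%:R)).
  by apply: eq_Rintegral => t _; rewrite -mulr_sumr sum_first_argmin mulr1.
rewrite (Rintegral_sum _ _).2; last by move=> k; case: (H k).
have H3 k : \int[Lam n.+1]_t (h t * (first_argmin k t)%:R) =
    \int[mu]_y \int[Lam n]_x (h (tuple_cons (y, x)) * outside y x).
  by case: (H k).
under eq_bigr do rewrite H3.
by rewrite sumr_const card_ord mulr_natl.
Qed.
End layer.

(** * Tail integrals, and functions determined by their derivative and their limit at infinity *)

Section tail.
Context (R : realType).
Local Notation T := (measurableTypeR R).
Local Notation mu := (@lebesgue_measure R).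

Lemma integral_comp_opp (f : R -> \bar R) : measurable_fun [set: R] f ->
  (\int[mu]_x f (- x)%R = \int[mu]_x f x)%E.
Proof.
have ge0 (g : R -> \bar R) : measurable_fun [set: R] g -> (forall x, 0 <= g x)%E ->
    (\int[mu]_x g (- x)%R = \int[mu]_x g x)%E.
  move=> mg g0; rewrite [RHS](eq_measure_integral
      (pushforward mu (-%R : _ -> measurableTypeR R))); last first.
    by move=> A mA _; apply/esym; exact: lebesgue_measureN.
  by rewrite ge0_integral_pushforward.
move=> mf; rewrite integralE [RHS]integralE; congr (_ - _)%E.
- transitivity (\int[mu]_x (f^\+)%E (- x)%R)%E.
    by apply: eq_integral => t _; rewrite funepos_comp.
  by apply: ge0 => //; exact: measurable_funepos.
- transitivity (\int[mu]_x (f^\-)%E (- x)%R)%E.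
    by apply: eq_integral => t _; rewrite funeneg_comp.
  by apply: ge0 => //; exact: measurable_funeneg.
Qed.

(** The integrands whose tail has derivative minus the integrand and tends to 0. The class is stable
    under multiplication by [cont_bounded] functions, to which all tails belong, so tails can be
    iterated. *)
Definition cont_integrable (a : R -> R) :=
  continuous a /\ mu.-integrable setT (EFin \o a).

Definition tail (a : R -> R) (t : R) : R := \int[mu]_(x in `]t, +oo[) a x.

Lemma is_derive_tail a t : cont_integrable a ->
  is_derive t (1 : R) (tail a) (- a t).
Proof.
move=> [ca ia].
pose F x := \int[mu]_(t in `]-oo, x]) a t.
have tailE : tail a = cst (\int[mu]_x a x) - F.
  apply/funext => x; rewrite /tail -set_itvNyy.
  by rewrite -(@Rintegral_itvB _ a -oo%O +oo%O x)// set_itvNyy.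
have iat : mu.-integrable `]-oo, t + 1] (EFin \o a).
  by apply: integrableS ia.
have tt1 : t < t + 1 by rewrite ltrDl.
have [dF F'] := continuous_FTC1 tt1 iat (ltNyr _) (ca t).
have dF1 : is_derive t (1 : R) F (a t) by apply: DeriveDef; rewrite -?derive1E.
rewrite tailE; apply: (is_derive_eq (is_deriveB (is_derive_cst _ _ _) dF1)).
by rewrite sub0r.
Qed.

Lemma continuous_tail a : cont_integrable a -> continuous (tail a).
Proof.
move=> ca t; apply: differentiable_continuous; apply/derivable1_diffP.
exact: (@ex_derive _ _ _ _ _ _ _ (is_derive_tail t ca)).
Qed.

Lemma tail_mkcond a t : tail a t = \int[mu]_x (a x * (t < x)%R%:R).
Proof.
rewrite /tail Rintegral_mkcond; apply: eq_Rintegral => x _.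
rewrite patchE mem_setE in_itv/= andbT.
by case: (t < x); rewrite ?mulr1 ?mulr0.
Qed.

Lemma cvg_tail a : cont_integrable a -> tail a x @[x --> +oo] --> (0 : R).
Proof.
(* Testing the limit along sequences makes dominated convergence available, with |a| as the
   bound. *)
move=> [ca ia]; apply/cvg_pinftyP => u uoo.
have ma : measurable_fun setT a by exact: continuous_measurable_fun.
have mk n : measurable_fun setT (EFin \o (fun x => a x * (u n < x)%R%:R)).
  apply/measurable_EFinP/measurable_funM => //.
  rewrite (_ : (fun x => _) = fun x : R => if u n < x then 1 else 0); last first.
    by apply/funext => x; case: (_ < _).
  by apply: measurable_fun_ifT => //; exact: measurable_fun_ltr.
have [||||i0 _ H] := @dominated_convergence _ _ R mu setT measurableT
  (fun n => EFin \o (fun x => a x * (u n < x)%R%:R)) (cst 0%E)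
  (fun x => `|a x|%:E) mk.
- exact: measurable_cst.
- apply: aeW => x _; apply: cvg_near_cst.
  move/cvgryPge : uoo => /(_ x); apply: filterS => n xun /=.
  by rewrite ltNge xun mulr0.
- exact: integrable_norm ia.
- apply: aeW => x n _; rewrite /= lee_fin normrM ler_piMr//.
  by case: (_ < _); rewrite ?normr1// normr0.
move: H; rewrite integral0 => /fine_cvgP[_].
by under [X in _ -> X @ _ --> _]eq_fun do rewrite tail_mkcond.
Qed.

Lemma tail_bounded a t : cont_integrable a ->
  `|tail a t| <= \int[mu]_x `|a x|.
Proof.
move=> [ca ia].
have ma : measurable_fun setT a by exact: continuous_measurable_fun.
have it : mu.-integrable setT (EFin \o (fun x => a x * (t < x)%R%:R)).
  apply: le_integrable ia => //.
    apply/measurable_EFinP/measurable_funM => //.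
    rewrite (_ : (fun x => _) = fun x : R => if t < x then 1 else 0); last first.
      by apply/funext => x; case: (_ < _).
    by apply: measurable_fun_ifT => //; exact: measurable_fun_ltr.
  move=> x _; rewrite lee_fin normrM ler_piMr//.
  by case: (_ < _); rewrite ?normr1// normr0.
rewrite tail_mkcond (le_trans (le_normr_Rintegral _ it))//.
apply: le_Rintegral => //; [exact: integrable_norm it|exact: integrable_norm ia|].
move=> x _; rewrite normrM ler_piMr//.
by case: (_ < _); rewrite ?normr1// normr0.
Qed.

Definition cont_bounded (f : R -> R) :=
  continuous f /\ exists M, forall x, `|f x| <= M.

Lemma cont_bounded_tail a : cont_integrable a -> cont_bounded (tail a).
Proof.
move=> ca; split; first exact: continuous_tail.
by eexists => x; exact: tail_bounded.
Qed.

Lemma cont_bounded_cst c : cont_bounded (cst c).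
Proof. by split; [exact: cst_continuous|exists `|c|]. Qed.

Lemma cont_boundedD f g : cont_bounded f -> cont_bounded g ->
  cont_bounded (fun x => f x + g x).
Proof.
move=> [cf [M fM]] [cg [N gN]]; split.
  by move=> x; apply: cvgD; [exact: cf|exact: cg].
by exists (M + N) => x; rewrite (le_trans (ler_normD _ _))// lerD.
Qed.

Lemma cont_boundedM f g : cont_bounded f -> cont_bounded g ->
  cont_bounded (fun x => f x * g x).
Proof.
move=> [cf [M fM]] [cg [N gN]]; split.
  by move=> x; apply: cvgM; [exact: cf|exact: cg].
by exists (M * N) => x; rewrite normrM ler_pM.
Qed.

Lemma cont_bounded_big (I : Type) (op : R -> R -> R) x0 (r : seq I)
    (P : pred I) (f : I -> R -> R) :
  (forall g h, cont_bounded g -> cont_bounded h ->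
    cont_bounded (fun x => op (g x) (h x))) ->
  (forall i, cont_bounded (f i)) ->
  cont_bounded (fun x => \big[op/x0]_(i <- r | P i) f i x).
Proof.
move=> op_cb fi; elim: r => [|i r IH].
  by under eq_fun do rewrite big_nil; exact: cont_bounded_cst.
under eq_fun do rewrite big_cons.
by case: (P i) => //; exact: op_cb.
Qed.

Lemma cont_bounded_det n (f : 'I_n -> 'I_n -> R -> R) :
  (forall i j, cont_bounded (f i j)) ->
  cont_bounded (fun x => \det (\matrix_(i, j) f i j x)).
Proof.
move=> fij; apply: cont_bounded_big; first exact: cont_boundedD.
move=> s; apply: cont_boundedM; first exact: cont_bounded_cst.
apply: cont_bounded_big; first exact: cont_boundedM.
by move=> i; under eq_fun do rewrite mxE; exact: fij.
Qed.

Lemma cont_integrableMr a f : cont_integrable a -> cont_bounded f ->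
  cont_integrable (fun x => a x * f x).
Proof.
move=> [ca ia] [cf [M fM]]; split.
  by move=> x; apply: cvgM; [exact: ca|exact: cf].
have iaM : mu.-integrable setT (EFin \o (fun x => M * a x)).
  exact: (integrableZl measurableT M ia).
apply: le_integrable iaM => //.
  by apply/measurable_EFinP/measurable_funM; exact: continuous_measurable_fun.
move=> x _; rewrite lee_fin !normrM mulrC ler_wpM2r//.
by rewrite (le_trans (fM x))// ler_norm.
Qed.

(** The uniqueness principle behind the tail identities: the difference of [F] and [G] is constant,
    and its limit at +oo is 0. *)
Lemma eq_derive_cvg0 (F G f : R -> R) :
  (forall t, is_derive t (1 : R) F (f t)) ->
  (forall t, is_derive t (1 : R) G (f t)) ->
  F x @[x --> +oo] --> (0 : R) -> G x @[x --> +oo] --> (0 : R) -> F =1 G.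
Proof.
move=> dF dG F0 G0 t; apply/eqP; rewrite -subr_eq0; apply/eqP.
have H0 : (F - G) x @[x --> +oo] --> (0 : R).
  by rewrite -[0 in X in _ --> X]subr0; exact: cvgB.
have Hc x : (F - G) x = (F - G) t.
  apply: is_derive_0_is_cst => {}x.
  by apply: (is_derive_eq (is_deriveB (dF x) (dG x))); rewrite subrr.
have : (F - G) x @[x --> +oo] --> (F - G) t.
  by apply: cvg_near_cst; near=> x; exact: Hc.
by move/(cvg_unique (@Rhausdorff R)) => /(_ _ H0).
Unshelve. all: by end_near. Qed.

Lemma tail_by_parts a b : cont_integrable a -> cont_integrable b ->
  forall t, tail (fun x => a x * tail b x) t + tail (fun x => b x * tail a x) t =
  tail a t * tail b t.
Proof.
move=> ca cb.
have cab := cont_integrableMr ca (cont_bounded_tail cb).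
have cba := cont_integrableMr cb (cont_bounded_tail ca).
apply: (eq_derive_cvg0 (f := fun t => - (a t * tail b t + b t * tail a t))).
- move=> t; apply: is_derive_eq.
    exact: (is_deriveD (is_derive_tail t cab) (is_derive_tail t cba)).
  by rewrite opprD.
- move=> t; apply: is_derive_eq.
    exact: (is_deriveM (is_derive_tail t ca) (is_derive_tail t cb)).
  by rewrite /GRing.scale/=; ring.
- by rewrite -[0 in X in _ --> X]addr0; apply: cvgD; exact: cvg_tail.
- by rewrite -[X in _ --> X](mulr0 (0 : R)); apply: cvgM; exact: cvg_tail.
Qed.
End tail.

(** * Derivatives, limits and elementary operations for determinants *)

Section det_calculus.
Context (R : realType).

Lemma is_derive_sumR (I : Type) (r : seq I) (f : I -> R -> R) (df : I -> R) (t : R) :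
  (forall i, is_derive t (1 : R) (f i) (df i)) ->
  is_derive t (1 : R) (fun x => \sum_(i <- r) f i x) (\sum_(i <- r) df i).
Proof.
move=> fi; elim: r => [|i r IH].
  under eq_fun do rewrite big_nil.
  by rewrite big_nil; exact: is_derive_cst.
under eq_fun do rewrite big_cons.
by rewrite big_cons; exact: (is_deriveD (fi i) IH).
Qed.

Lemma is_derive_prodR n (f : 'I_n -> R -> R) (df : 'I_n -> R) (t : R) :
  (forall i, is_derive t (1 : R) (f i) (df i)) ->
  is_derive t (1 : R) (fun x => \prod_i f i x)
    (\sum_i \prod_j (if j == i then df j else f j t)).
Proof.
elim: n f df => [|n IH] f df fi.
  under eq_fun do rewrite big_ord0.
  by rewrite big_ord0; exact: is_derive_cst.
under eq_fun do rewrite big_ord_recl.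
apply: (is_derive_eq
  (is_deriveM (fi ord0) (IH _ _ (fun i => fi (lift ord0 i))))).
rewrite [RHS]big_ord_recl [in RHS]big_ord_recl eqxx /GRing.scale/= addrC.
congr (_ + _); first by rewrite mulrC.
rewrite mulr_sumr; apply: eq_bigr => i _.
by rewrite big_ord_recl.
Qed.

Lemma is_derive_det n (f : 'I_n -> 'I_n -> R -> R) (df : 'I_n -> 'I_n -> R)
    (t : R) :
  (forall i j, is_derive t (1 : R) (f i j) (df i j)) ->
  is_derive t (1 : R) (fun x => \det (\matrix_(i, j) f i j x))
    (\sum_k \det (\matrix_(i, j) if i == k then df i j else f i j t)).
Proof.
move=> dfij.
have D (s : 'S_n) : is_derive t (1 : R)
    (fun x => (-1) ^+ s * \prod_i (\matrix_(i, j) f i j x) i (s i))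
    ((-1) ^+ s * \sum_k \prod_i (if i == k then df i (s i) else f i (s i) t)).
  under eq_fun do under eq_bigr do rewrite mxE.
  apply: (is_derive_eq (is_deriveM (is_derive_cst _ _ _)
    (is_derive_prodR (fun i => dfij i (s i))))).
  by rewrite scaler0 addr0.
apply: (is_derive_eq (is_derive_sumR _ D)).
rewrite /determinant exchange_big/=; apply: eq_bigr => s _.
by rewrite mulr_sumr; apply: eq_bigr => k _; under [in RHS]eq_bigr do rewrite mxE.
Qed.

Lemma cvg_det (U : Type) (F : set_system U) {FF : Filter F} n
    (f : 'I_n -> 'I_n -> U -> R) (l : 'I_n -> 'I_n -> R) :
  (forall i j, f i j x @[x --> F] --> l i j) ->
  \det (\matrix_(i, j) f i j x) @[x --> F] --> \det (\matrix_(i, j) l i j).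
Proof.
move=> fl.
have H (I : Type) (op : R -> R -> R) x0 (r : seq I) (g : I -> U -> R) (m : I -> R) :
    (forall (h k : U -> R) (a b : R), h @ F --> a -> k @ F --> b ->
      (fun x => op (h x) (k x)) @ F --> op a b) ->
    (forall i, g i @ F --> m i) ->
    (fun x => \big[op/x0]_(i <- r) g i x) @ F --> \big[op/x0]_(i <- r) m i.
  move=> opc gm; elim: r => [|i r IH].
    under eq_fun do rewrite big_nil.
    by rewrite big_nil; exact: cvg_cst.
  under eq_fun do rewrite big_cons.
  by rewrite big_cons; exact: opc.
apply: (H); first by move=> h k a b; exact: cvgD.
move=> s; apply: cvgM; first exact: cvg_cst.
apply: (H); first by move=> h k a b; exact: cvgM.
by move=> i; under eq_fun do rewrite mxE; rewrite mxE; exact: fl.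
Qed.
End det_calculus.

Section det_lemmas.
Context (R : comRingType).

Lemma det_add_last_col m (F : 'I_m.+1 -> 'I_m.+1 -> R) (c : 'I_m.+1 -> R) :
  \det (\matrix_(i, j) if (j < m)%N then F i j + c j * F i ord_max
                       else F i j) =
  \det (\matrix_(i, j) F i j).
Proof.
(* The column operation as right multiplication by a unit lower triangular matrix. *)
pose U : 'M[R]_m.+1 := \matrix_(k, l)
  ((k == l)%:R + ((k == ord_max) && (l < m)%N)%:R * c l).
have -> : (\matrix_(i, j) if (j < m)%N then F i j + c j * F i ord_max
                          else F i j) = (\matrix_(i, j) F i j) *m U.
  apply/matrixP => i j; rewrite !mxE.
  under eq_bigr do rewrite !mxE mulrDr.
  rewrite big_split/= (bigD1 j)//= eqxx mulr1 big1 ?addr0; last first.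
    by move=> k /negbTE kj; rewrite kj mulr0.
  rewrite (bigD1 ord_max)//= eqxx big1 ?addr0; last first.
    by move=> k /negbTE km; rewrite km mul0r mulr0.
  by case: ifP => _ /=; rewrite ?mul0r ?mulr0 ?addr0// mul1r mulrC.
rewrite det_mulmx (_ : \det U = 1) ?mulr1//.
rewrite det_trig.
  rewrite big1// => k _; rewrite mxE eqxx; case: eqP => [->|_] /=.
    by rewrite ltnn mul0r addr0.
  by rewrite mul0r addr0.
apply/is_trig_mxP => k l kl; rewrite mxE.
rewrite (_ : (k == l) = false); last by apply/negbTE; rewrite neq_ltn kl.
rewrite (_ : (k == ord_max) = false) ?mul0r ?addr0//.
apply/negbTE; rewrite neq_ltn /= (leq_trans kl)//.
by rewrite -ltnS.
Qed.

Lemma det_row_parallel m (A : 'M[R]_m) (k l : 'I_m) (c : R) :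
  k != l -> (forall j, A k j = c * A l j) -> \det A = 0.
Proof.
move=> kl Akl.
pose B : 'M[R]_m := \matrix_(i, j) if i == k then A l j else A i j.
rewrite (@determinant_multilinear _ _ A B B k c 0).
- rewrite mul0r addr0 (@determinant_alternate _ _ B k l) ?mulr0// => j.
  by rewrite !mxE eqxx eq_sym (negbTE kl).
- by apply/rowP => j; rewrite !mxE eqxx Akl mul0r addr0.
- by apply/matrixP => i j; rewrite !mxE eq_sym (negbTE (neq_lift k i)).
- by apply/matrixP => i j; rewrite !mxE eq_sym (negbTE (neq_lift k i)).
Qed.
End det_lemmas.

(** * Determinants of iterated tails and their recursion *)

Section even_odd_det.
Context (R : realType).
Implicit Types a b : nat -> R -> R.

(** [det_even] and [det_odd] are the answers for ensembles of even size [m + m] and odd size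
    [m.+1 + m]. In the odd case there is one more [a] than [b], and the bordering column of single
    tails takes the place of the missing partner. *)
Definition det_even m a b (t : R) : R :=
  \det (\matrix_(i < m, j < m) tail (fun x => a i x * tail (b j) x) t).

Definition det_odd m a b (t : R) : R :=
  \det (\matrix_(i < m.+1, j < m.+1)
    if (j < m)%N then tail (fun x => a i x * tail (b j) x) t else tail (a i) t).

Definition skip (i : nat) a : nat -> R -> R := fun j => a (bump i j).

(** Integration by parts exchanges the order of iteration at the cost of a product tail(a_i)
    tail(b_l), which is a multiple of the border and is removed by a column operation. In the new
    form every row but the last has a derivative parallel to the last row. *)
Lemma det_odd_by_parts a b m t :
  (forall i, cont_integrable (a i)) -> (forall i, cont_integrable (b i)) ->
  det_odd m a b t =
  \det (\matrix_(l < m.+1, i < m.+1)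
    if (l < m)%N then - tail (fun x => b l x * tail (a i) x) t
    else tail (a i) t).
Proof.
move=> ca cb; rewrite -det_tr /det_odd.
rewrite (_ : trmx _ = \matrix_(i, j) if (j < m)%N then
  - tail (fun x => b j x * tail (a i) x) t else tail (a i) t); last first.
  by apply/matrixP => i j; rewrite !mxE.
rewrite -[RHS](det_add_last_col _ (fun j => tail (b j) t)).
congr (\det _); apply/matrixP => i j; rewrite !mxE ltnn.
case: ifP => // jm; rewrite mulrC -tail_by_parts//.
by rewrite addrCA addNr addr0.
Qed.

Section fixed.
Variables a b : nat -> R -> R.
Hypothesis ca : forall i, cont_integrable (a i).
Hypothesis cb : forall i, cont_integrable (b i).

Let cab i j : cont_integrable (fun x => a i x * tail (b j) x).
Proof. exact: cont_integrableMr (cont_bounded_tail _). Qed.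

Let cba i j : cont_integrable (fun x => b i x * tail (a j) x).
Proof. exact: cont_integrableMr (cont_bounded_tail _). Qed.

Lemma cont_bounded_det_even m : cont_bounded (det_even m a b).
Proof. by apply: cont_bounded_det => i j; exact: cont_bounded_tail. Qed.

Lemma cont_bounded_det_odd m : cont_bounded (det_odd m a b).
Proof.
by apply: cont_bounded_det => i j; case: (j < m)%N; exact: cont_bounded_tail.
Qed.

Lemma cvg_det_even m : det_even m.+1 a b x @[x --> +oo] --> (0 : R).
Proof.
rewrite (_ : 0 = \det (\matrix_(i < m.+1, j < m.+1) (0 : R))); last first.
  rewrite (expand_det_row _ ord0) big1// => j _; by rewrite mxE mul0r.
by apply: cvg_det => i j; exact: cvg_tail.
Qed.

Lemma cvg_det_odd m : det_odd m a b x @[x --> +oo] --> (0 : R).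
Proof.
rewrite (_ : 0 = \det (\matrix_(i < m.+1, j < m.+1) (0 : R))); last first.
  rewrite (expand_det_row _ ord0) big1// => j _; by rewrite mxE mul0r.
by apply: cvg_det => i j; case: (j < m)%N; exact: cvg_tail.
Qed.

Lemma is_derive_det_odd m t : is_derive t (1 : R) (det_odd m a b)
  (- \sum_(i < m.+1) (-1) ^+ i * (a i t * det_even m b (skip i a) t)).
Proof.
rewrite (_ : det_odd m a b = fun t => \det (\matrix_(l < m.+1, i < m.+1)
    if (l < m)%N then - tail (fun x => b l x * tail (a i) x) t
    else tail (a i) t)); last by apply/funext => x; exact: det_odd_by_parts.
have D (l i : 'I_m.+1) : is_derive t (1 : R)
    (fun t => if (l < m)%N then - tail (fun x => b l x * tail (a i) x) t
              else tail (a i) t)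
    (if (l < m)%N then b l t * tail (a i) t else - a i t).
  case: (l < m)%N; last exact: is_derive_tail.
  apply: (is_derive_eq (is_deriveN (is_derive_tail _ (cba _ _)))).
  by rewrite opprK.
apply: (is_derive_eq (is_derive_det D)).
(* Differentiating a row [k] other than the last produces [b k t] times the last row, hence
   determinant 0; only the derivative of the last row, with entries - a_i, contributes. *)
rewrite (bigD1 ord_max)//= [X in _ + X]big1 ?addr0; last first.
  move=> k km; apply: (@det_row_parallel _ _ _ k ord_max (b k t)) => //.
  have {}km' : (k < m)%N.
    by rewrite ltn_neqAle -ltnS ltn_ord andbT; apply: contra km => /eqP km;
      apply/eqP/val_inj.
  by move=> j; rewrite !mxE eqxx km' eq_sym (negbTE km) ltnn.
rewrite (expand_det_row _ ord_max) -sumrN; apply: eq_bigr => i _.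
rewrite mxE eqxx ltnn /cofactor mulNr; congr (- _).
set X : 'M[R]_m := row' ord_max _.
have -> : X = (-1) *: (\matrix_(l < m, j < m)
    tail (fun x => b l x * tail (skip i a j) x) t).
  apply/matrixP => l j; rewrite !mxE eq_sym (negbTE (neq_lift _ _)).
  by rewrite lift_max ltn_ord mulN1r.
rewrite detZ exprD -[RHS](signrMK m) -/(det_even m b (skip i a) t) /=.
by ring.
Qed.

(** The derivative of row [i] is - a_i(t) times the row of the tail(b_k). This row is the border of
    [det_odd m b (skip i a)] after integration by parts, so expanding along it gives the same minors
    up to sign. *)
Lemma is_derive_det_even m t : is_derive t (1 : R) (det_even m.+1 a b)
  (- \sum_(i < m.+1) (-1) ^+ i * (a i t * det_odd m b (skip i a) t)).
Proof.
have D (i j : 'I_m.+1) := is_derive_tail t (cab i j).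
apply: (is_derive_eq (is_derive_det D)).
rewrite -sumrN; apply: eq_bigr => i _.
rewrite det_odd_by_parts//; last by move=> j; exact: ca.
rewrite (expand_det_row _ i) [X in _ * (_ * X)](expand_det_row _ ord_max).
rewrite !mulr_sumr -sumrN; apply: eq_bigr => k _.
rewrite !mxE eqxx ltnn /cofactor.
set X : 'M[R]_m := row' ord_max _; set Y : 'M[R]_m := row' i _.
have -> : X = (-1) *: Y.
  by apply/matrixP => l j; rewrite !mxE lift_max ltn_ord eq_sym
    (negbTE (neq_lift _ _)) mulN1r.
rewrite detZ !exprD -[LHS](signrMK m) /=.
by ring.
Qed.

End fixed.

Section recursion.
Variables a b : nat -> R -> R.
Hypothesis ca : forall i, cont_integrable (a i).
Hypothesis cb : forall i, cont_integrable (b i).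

Let is_derive_sum_tail m (D : nat -> R -> R) (t : R) :
  (forall i, cont_integrable (fun x => a i x * D i x)) ->
  is_derive t (1 : R)
    (fun t => \sum_(i < m.+1) (-1) ^+ i * tail (fun x => a i x * D i x) t)
    (- \sum_(i < m.+1) (-1) ^+ i * (a i t * D i t)).
Proof.
move=> caD; rewrite -sumrN; apply: is_derive_sumR => i.
apply: (is_derive_eq (is_deriveM (is_derive_cst _ _ _) (is_derive_tail t (caD i)))).
by rewrite scaler0 addr0 /GRing.scale/= mulrN.
Qed.

Let cvg_sum_tail m (D : nat -> R -> R) :
  (forall i, cont_integrable (fun x => a i x * D i x)) ->
  (fun t => \sum_(i < m.+1) (-1) ^+ i * tail (fun x => a i x * D i x) t)
    x @[x --> +oo] --> (0 : R).
Proof.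
move=> caD; elim: m.+1 => [|k IH].
  by under eq_fun do rewrite big_ord0; exact: cvg_cst.
rewrite (_ : (fun t => _) = fun t =>
    \sum_(i < k) (-1) ^+ i * tail (fun x => a i x * D i x) t +
    (-1) ^+ k * tail (fun x => a k x * D k x) t); last first.
  by apply/funext => t; rewrite big_ord_recr.
rewrite -[X in _ --> X](addr0 (0 : R)); apply: cvgD => //=.
rewrite -[X in _ --> X](mulr0 ((-1) ^+ k : R)).
by apply: cvgM; [exact: cvg_cst|exact: cvg_tail].
Qed.

(** The step of the recursion in the size: the function integrated last is taken out of [a], and the
    remaining determinant has [a] and [b] exchanged. Both sides have the same derivative and tend to
    0 at +oo. *)
Lemma sum_tail_det_even m t :
  \sum_(i < m.+1) (-1) ^+ i * tail (fun x => a i x * det_even m b (skip i a) x) t =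
  det_odd m a b t.
Proof.
have caD i : cont_integrable (fun x => a i x * det_even m b (skip i a) x).
  apply: cont_integrableMr => //; apply: cont_bounded_det_even => // j.
  exact: ca.
move: t; apply: (eq_derive_cvg0 (f := fun t =>
    (- \sum_(i < m.+1) (-1) ^+ i * (a i t * det_even m b (skip i a) t)))).
- by move=> t; exact: (is_derive_sum_tail m (D := fun i => det_even m b (skip i a))).
- by move=> t; exact: is_derive_det_odd.
- exact: (cvg_sum_tail m (D := fun i => det_even m b (skip i a))).
- exact: cvg_det_odd.
Qed.

Lemma sum_tail_det_odd m t :
  \sum_(i < m.+1) (-1) ^+ i * tail (fun x => a i x * det_odd m b (skip i a) x) t =
  det_even m.+1 a b t.
Proof.
have caD i : cont_integrable (fun x => a i x * det_odd m b (skip i a) x).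
  apply: cont_integrableMr => //; apply: cont_bounded_det_odd => // j.
  exact: ca.
move: t; apply: (eq_derive_cvg0 (f := fun t =>
    (- \sum_(i < m.+1) (-1) ^+ i * (a i t * det_odd m b (skip i a) t)))).
- by move=> t; exact: (is_derive_sum_tail m (D := fun i => det_odd m b (skip i a))).
- by move=> t; exact: is_derive_det_even.
- exact: (cvg_sum_tail m (D := fun i => det_odd m b (skip i a))).
- exact: cvg_det_even.
Qed.
End recursion.
End even_odd_det.

Section det_columns.
Context (R : comRingType).

Lemma det_scale_cols n (F : 'I_n -> 'I_n -> R) (c : 'I_n -> R) :
  \det (\matrix_(i, j) (F i j * c j)) =
  (\prod_j c j) * \det (\matrix_(i, j) F i j).
Proof.
rewrite /determinant mulr_sumr; apply: eq_bigr => s _.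
rewrite mulrCA; congr (_ * _).
under eq_bigr do rewrite mxE.
rewrite big_split mulrC /=; congr (_ * _).
  by apply: eq_bigr => i _; rewrite mxE.
by rewrite [RHS](reindex_inj (@perm_inj _ s)).
Qed.

Lemma det_inj_rows n (f : 'I_n -> 'I_n) : injective f ->
  exists e : bool, forall F : 'I_n -> 'I_n -> R,
  \det (\matrix_(i, j) F (f i) j) = (-1) ^+ e * \det (\matrix_(i, j) F i j).
Proof.
move=> f_inj; exists (perm f_inj : bool) => F.
rewrite -det_perm -det_mulmx -row_permE; congr (\det _).
by apply/matrixP => i j; rewrite !mxE permE.
Qed.
End det_columns.

(** * Recursion for the integral of a determinant times the sign of the Vandermonde determinant *)

Section sign_integral.
Context (R : realType).
Local Notation T := (measurableTypeR R).
Local Notation mu := (@lebesgue_measure R).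
Local Notation Lam := (@lebesgue_tuple R).

Definition vdm n (x : n.-tuple T) : R := \det (\matrix_(i, j) tnth x j ^+ i).

Lemma vdmE n (x : n.-tuple T) :
  vdm x = \prod_(i < n) \prod_(j < n | (i < j)%N) (tnth x j - tnth x i).
Proof.
have := @det_Vandermonde R n (\row_j tnth x j).
under [in RHS]eq_bigr do under eq_bigr do rewrite !mxE.
move=> <-; congr (\det _); by apply/matrixP => i j; rewrite !mxE.
Qed.

Lemma vdm_cons n y (x : n.-tuple T) :
  vdm (tuple_cons (y, x)) = (\prod_j (tnth x j - y)) * vdm x.
Proof.
rewrite !vdmE big_ord_recl; congr (_ * _).
  rewrite big_mkcond big_ord_recl /= mul1r.
  by apply: eq_bigr => j _; rewrite tnth_consS.
apply: eq_bigr => i _; rewrite big_mkcond big_ord_recl /= mul1r -big_mkcond /=.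
by apply: eq_big => [j|j _]; rewrite ?tnth_consS.
Qed.

Lemma measurable_vdm n : measurable_fun setT (@vdm n).
Proof.
apply: measurable_detR => i j.
exact: (measurableT_comp (exprn_measurable _) (@measurable_tnth _ T n j)).
Qed.

Lemma measurable_sgr : measurable_fun setT (Num.sg : R -> R).
Proof.
rewrite (_ : Num.sg = fun x : R => if 0 < x then 1 else if x < 0 then -1 else 0).
  by do 2 (apply: measurable_fun_ifT => //; first exact: measurable_fun_ltr).
by apply/funext => x; case: sgrP.
Qed.

Lemma integrable_det_tnth n (psi : 'I_n -> T -> R) :
  (forall i, mu.-integrable setT (EFin \o psi i)) ->
  (Lam n).-integrable setT
    (EFin \o (fun x => \det (\matrix_(i, j) psi i (tnth x j)))).
Proof.
move=> ipsi; apply: (Rintegral_sum _ _).1 => s.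
have H : (Lam n).-integrable setT (EFin \o (fun x : n.-tuple T =>
    \prod_i (\matrix_(i, j) psi i (tnth x j)) i (s i))).
  rewrite (_ : (fun x : n.-tuple T => _) =
      fun x : n.-tuple T => \prod_i psi ((s^-1)%g i) (tnth x i)).
    exact: (integrable_prod_tnth (fun j => ipsi _)).
  apply/funext => x; rewrite [RHS](reindex_inj (@perm_inj _ s)).
  by apply: eq_bigr => i _; rewrite mxE permK.
exact: (integrableZl measurableT ((-1) ^+ s) H).
Qed.

(** With weighted powers for [phi] this is, up to a sign, the unnormalized density for beta = 1.
    Allowing arbitrary [phi] makes the recursion close up, since it changes the functions. *)
Definition sign_det n (phi : nat -> R -> R) (x : n.-tuple T) : R :=
  Num.sg (vdm x) * \det (\matrix_(i < n, j < n) phi i (tnth x j)).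

Definition cutoff (t : R) (f : R -> R) : R -> R :=
  fun x => f x * (t < `|x|)%R%:R.

Lemma measurable_cutoff_indic t : measurable_fun setT
  (fun x : R => (t < `|x|)%R%:R : R).
Proof.
rewrite (_ : (fun x => _) = fun x : R => if t < `|x| then 1 else 0); last first.
  by apply/funext => x; case: (_ < _).
apply: measurable_fun_ifT => //; apply: measurable_fun_ltr => //.
Qed.

Lemma integrable_cutoff t f : mu.-integrable setT (EFin \o f) ->
  mu.-integrable setT (EFin \o cutoff t f).
Proof.
move=> fi; apply: le_integrable (fi) => //.
  apply/measurable_EFinP/measurable_funM; last exact: measurable_cutoff_indic.
  by case/integrableP: fi => /measurable_EFinP.
move=> x _; rewrite lee_fin normrM ler_piMr//.
by case: (_ < _); rewrite ?normr1// normr0.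
Qed.

Lemma integrable_mulsg f : mu.-integrable setT (EFin \o f) ->
  mu.-integrable setT (EFin \o (fun x => Num.sg x * f x)).
Proof.
move=> fi; apply: le_integrable (fi) => //.
  apply/measurable_EFinP/measurable_funM; first exact: measurable_sgr.
  by case/integrableP: fi => /measurable_EFinP.
move=> x _; rewrite lee_fin normrM ler_piMl//.
by rewrite normr_sg; case: (_ != _).
Qed.

Lemma integrable_sign_det n phi :
  (forall i, mu.-integrable setT (EFin \o phi i)) ->
  (Lam n).-integrable setT (EFin \o sign_det phi).
Proof.
move=> iphi; have idet := integrable_det_tnth (fun i : 'I_n => iphi i).
apply: le_integrable (idet) => //.
  apply/measurable_EFinP/measurable_funM.
    exact: (measurableT_comp measurable_sgr (@measurable_vdm n)).
  by case/integrableP: idet => /measurable_EFinP.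
move=> x _; rewrite lee_fin normrM ler_piMl//.
by rewrite normr_sg; case: (_ != _).
Qed.

Definition sign_int n phi (t : R) : R :=
  \int[Lam n]_x sign_det (fun i => cutoff t (phi i)) x.

(** Both factors alternate under a permutation of the coordinates, so the two signs cancel. *)
Lemma sign_det_insert n phi (k : 'I_n.+1) y x :
  sign_det phi (tuple_insert k (y, x)) = sign_det phi (tuple_cons (y, x)).
Proof.
pose s : 'S_n.+1 := lift_perm k ord0 1.
have tE j : tnth (tuple_insert k (y, x)) j = tnth (tuple_cons (y, x)) (s j).
  case: (unliftP k j) => [j' ->|->].
    by rewrite tnth_insert_lift lift_perm_lift perm1 tnth_consS.
  by rewrite tnth_insert_self lift_perm_id.
have dE (F : 'I_n.+1 -> R -> R) :
    \det (\matrix_(i, j) F i (tnth (tuple_insert k (y, x)) j)) =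
    (-1) ^+ s * \det (\matrix_(i, j) F i (tnth (tuple_cons (y, x)) j)).
  rewrite mulrC -odd_permV -det_perm -det_mulmx -col_permE; congr (\det _).
  by apply/matrixP => i j; rewrite !mxE tE.
rewrite /sign_det /vdm (dE (fun i z => z ^+ i)) (dE (fun i => phi i)).
by case: (odd_perm s); rewrite ?expr0 ?expr1 ?mul1r ?mulN1r ?sgrN ?mulrNN.
Qed.

Lemma outside_bool n y (x : n.-tuple T) :
  (outside y x = 0 /\ exists j, (`|y| < `|tnth x j|) = false) \/
  (outside y x = 1 /\ forall j, `|y| < `|tnth x j|).
Proof.
have [/forallP H|/forallPn[j /negbTE H]] :=
    boolP [forall j : 'I_n, `|y| < `|tnth x j| :> R].
  by right; split=> //; rewrite /outside big1// => j _; rewrite H.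
by left; split; [rewrite /outside (bigD1 j)//= H mul0r|exists j].
Qed.

Lemma sgr_subr_lt (x y : R) : `|y| < `|x| -> Num.sg (x - y) = Num.sg x.
Proof.
have [x0|x0|->] := ltrgtP x 0; last by rewrite normr0 ltNge normr_ge0.
  rewrite (ltr0_norm x0) ltr_norml opprK => /andP[xy yx].
  by rewrite !ltr0_sg// subr_lt0.
rewrite (gtr0_norm x0) ltr_norml => /andP[xy yx].
by rewrite !gtr0_sg// subr_gt0.
Qed.

Definition flip (phi : nat -> R -> R) : nat -> R -> R :=
  fun i x => Num.sg x * phi i x.

(** Where [y] is the smallest in absolute value, sgn(x_j - y) = sgn x_j, so the sign of the
    Vandermonde determinant is that of [x] times the product of the sgn x_j, which [flip] absorbs
    into the functions. The determinant itself is expanded along the column of [y]. *)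
Lemma sign_det_outside n phi t y (x : n.-tuple T) :
  sign_det (fun i => cutoff t (phi i)) (tuple_cons (y, x)) * outside y x =
  \sum_(i < n.+1) (-1) ^+ i * cutoff t (phi i) y *
    sign_det (fun j => cutoff `|y| (flip (fun j => phi (bump i j)) j)) x.
Proof.
have H0 (i : nat) :
    sign_det (fun j => cutoff `|y| (flip (fun j => phi (bump i j)) j)) x =
    Num.sg (vdm x) * ((\prod_j Num.sg (tnth x j)) * outside y x *
      \det (\matrix_(k < n, j < n) phi (bump i k) (tnth x j))).
  congr (_ * _); rewrite /outside -big_split -det_scale_cols /=.
  congr (\det _); apply/matrixP => k j; rewrite !mxE /cutoff /flip.
  by rewrite -mulrA mulrCA mulrA.
under eq_bigr do rewrite H0.
have [[-> _]|[-> xy]] := outside_bool y x.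
  by rewrite mulr0 big1// => i _; rewrite mulr0 mul0r !mulr0.
rewrite mulr1 /sign_det vdm_cons sgrM (big_morph _ (@sgrM R) (@sgr1 R)).
under eq_bigr do rewrite sgr_subr_lt//.
rewrite (expand_det_col _ ord0) mulr_sumr; apply: eq_bigr => i _.
rewrite mxE (_ : tnth _ ord0 = y)//.
(* If |y| is at most [t], the cutoff at [y] kills both sides. Otherwise t < |y| < |x_j|: the cutoff
   at [t] holds for all x_j, and the condition that remains on them is the cutoff at |y|. *)
have [ty|yt] := boolP (t < `|y|); last first.
  by rewrite {1 3}/cutoff (negbTE yt) !mulr0 !mul0r mulr0.
rewrite /cofactor addn0 mulr1.
have -> : row' i (col' ord0 (\matrix_(i0, j)
    cutoff t (phi i0) (tnth (tuple_cons (y, x)) j))) =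
    \matrix_(k < n, j < n) phi (bump i k) (tnth x j).
  apply/matrixP => k j; rewrite !mxE tnth_consS /cutoff.
  by rewrite (lt_trans ty (xy j)) mulr1.
by ring.
Qed.

(** The level of the cutoff moves from [t] to |y|, which is why the integral has to be known as a
    function of its level and not only at one value. *)
Lemma sign_int_rec n (phi : nat -> R -> R) t (G := fun y => \sum_(i < n.+1)
    (-1) ^+ i * cutoff t (phi i) y *
      sign_int n (flip (fun j => phi (bump i j))) `|y|) :
  (forall i, mu.-integrable setT (EFin \o phi i)) ->
  mu.-integrable setT (EFin \o G) /\
  sign_int n.+1 phi t = n.+1%:R * \int[mu]_y G y.
Proof.
move=> iphi.
have iflip (i : nat) y j : mu.-integrable setT
    (EFin \o cutoff y (flip (fun j => phi (bump i j)) j)).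
  by apply: integrable_cutoff; exact: integrable_mulsg.
have icut i : mu.-integrable setT (EFin \o cutoff t (phi i)).
  exact: integrable_cutoff.
have iscale (y : R) (i : 'I_n.+1) : (Lam n).-integrable setT (EFin \o
    (fun x => (-1) ^+ i * cutoff t (phi i) y *
      sign_det (fun j => cutoff `|y| (flip (fun j => phi (bump i j)) j)) x)).
  exact: (integrableZl measurableT ((-1) ^+ i * cutoff t (phi i) y)
    (@integrable_sign_det n _ (iflip i `|y|))).
have GE y : \int[Lam n]_x (sign_det (fun i => cutoff t (phi i))
    (tuple_cons (y, x)) * outside y x) = G y.
  under eq_Rintegral do rewrite sign_det_outside.
  rewrite [LHS](Rintegral_sum _ (iscale y)).2; apply: eq_bigr => i _.
  by rewrite RintegralZl//; exact: integrable_sign_det.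
suff [iG ->] : mu.-integrable setT (EFin \o (fun y => \int[Lam n]_x
      (sign_det (fun i => cutoff t (phi i)) (tuple_cons (y, x)) * outside y x))) /\
    sign_int n.+1 phi t = n.+1%:R * \int[mu]_y \int[Lam n]_x
      (sign_det (fun i => cutoff t (phi i)) (tuple_cons (y, x)) * outside y x).
  split; last by congr (_ * _); apply: eq_Rintegral => y _; exact: GE.
  by move: iG; under eq_fun do rewrite GE.
apply: Rintegral_min_first.
- exact: integrable_sign_det.
- by move=> k y x; exact: sign_det_insert.
- move=> y.
  have idet (i : 'I_n.+1) : (Lam n).-integrable setT (EFin \o (fun x =>
      cutoff t (phi i) y * (-1) ^+ i *
      \det (\matrix_(k < n, j < n) cutoff t (phi (bump i k)) (tnth x j)))).
    exact: (integrableZl measurableT (cutoff t (phi i) y * (-1) ^+ i)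
      (integrable_det_tnth (fun k : 'I_n => icut (bump i k)))).
  have := (Rintegral_sum (index_enum 'I_n.+1) idet).1.
  have dE (x : n.-tuple T) : \sum_(i < n.+1) cutoff t (phi i) y * (-1) ^+ i *
      \det (\matrix_(k < n, j < n) cutoff t (phi (bump i k)) (tnth x j)) =
      \det (\matrix_(i < n.+1, j < n.+1)
        cutoff t (phi i) (tnth (tuple_cons (y, x)) j)).
    rewrite (expand_det_col _ ord0); apply: eq_bigr => i _.
    rewrite mxE /cofactor addn0 mulrA; congr (_ * _).
    by congr (\det _); apply/matrixP => k j; rewrite !mxE tnth_consS.
  under eq_fun do rewrite dE.
  move=> idetc; apply: le_integrable (idetc) => //.
    apply/measurable_EFinP/measurable_funM; last first.
      by case/integrableP: idetc => /measurable_EFinP.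
    apply: (measurableT_comp measurable_sgr).
    apply: (measurableT_comp (@measurable_vdm n.+1)).
    exact: (measurableT_comp (@measurable_tuple_cons R n) (measurable_pair1 y)).
  move=> x _; rewrite lee_fin normrM ler_piMl//.
  by rewrite normr_sg; case: (_ != _).
Qed.
End sign_integral.

(** * Families of even and odd functions under the recursion *)

Section parity.
Context (R : realType).
Local Notation T := (measurableTypeR R).
Local Notation mu := (@lebesgue_measure R).
Local Notation Lam := (@lebesgue_tuple R).
Implicit Types a b : nat -> R -> R.

Lemma integrable_comp_opp (f : R -> R) : mu.-integrable setT (EFin \o f) ->
  mu.-integrable setT (EFin \o (fun x => f (- x))).
Proof.
move=> /integrableP[mf foo]; apply/integrableP; split.
  exact: (measurableT_comp mf (@oppr_measurable R _)).
by rewrite (integral_comp_opp (measurableT_comp (@abse_measurable R setT) mf)).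
Qed.

Lemma Rintegral_comp_opp (f : R -> R) : mu.-integrable setT (EFin \o f) ->
  \int[mu]_x f (- x) = \int[mu]_x f x.
Proof.
by move=> /integrableP[mf _]; rewrite /Rintegral -(integral_comp_opp mf).
Qed.

Definition right_part t (g : R -> R) : R -> R := fun x => g x * (t < x)%R%:R.

Lemma integrable_right_part t g : cont_integrable g ->
  mu.-integrable setT (EFin \o right_part t g).
Proof.
move=> [cg ig]; apply: le_integrable (ig) => //.
  apply/measurable_EFinP/measurable_funM.
    exact: continuous_measurable_fun.
  rewrite (_ : (fun x => _) = fun x : R => if t < x then 1 else 0); last first.
    by apply/funext => x; case: (_ < _).
  by apply: measurable_fun_ifT => //; exact: measurable_fun_ltr.
move=> x _; rewrite lee_fin normrM ler_piMr//.
by case: (_ < _); rewrite ?normr1// normr0.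
Qed.

Lemma Rintegral_right_part t g : \int[mu]_x right_part t g x = tail g t.
Proof. by rewrite tail_mkcond. Qed.

Lemma integrable_comp_norm g : cont_integrable g ->
  mu.-integrable setT (EFin \o (fun x => g `|x|)).
Proof.
move=> [cg ig].
have i2 := integrableD measurableT (integrable_norm ig)
  (integrable_norm (integrable_comp_opp ig)).
apply: le_integrable i2 => //.
  apply/measurable_EFinP; apply: (@measurableT_comp _ _ _ _ _ _ g) => //.
  exact: continuous_measurable_fun.
move=> x _ /=; rewrite lee_fin [leRHS]ger0_norm ?addr_ge0//.
have [x0|x0] := leP 0 x; first by rewrite (ger0_norm x0) lerDl.
by rewrite (ltr0_norm x0) lerDr.
Qed.

(** [a] and [b] matter on the half line only: [a i] is extended to an even function and [b i] to an
    odd one. [odd_even] is the shape into which [flip] brings what is left after the removal of an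
    even function. *)
Definition even_odd p a b : nat -> R -> R :=
  fun i x => if (i < p)%N then a i `|x| else Num.sg x * b (i - p)%N `|x|.

Definition odd_even q b a : nat -> R -> R :=
  fun i x => if (i < q)%N then Num.sg x * b i `|x| else a (i - q)%N `|x|.

Lemma integrable_even_odd p a b i : (forall i, cont_integrable (a i)) ->
  (forall i, cont_integrable (b i)) ->
  mu.-integrable setT (EFin \o even_odd p a b i).
Proof.
move=> ca cb; rewrite /even_odd; case: (i < p)%N.
  exact: integrable_comp_norm.
by apply: integrable_mulsg; exact: integrable_comp_norm.
Qed.

Lemma cutoff_even t (g : R -> R) x : 0 <= t ->
  cutoff t (fun x => g `|x|) x = right_part t g x + right_part t g (- x).
Proof.
move=> t0; rewrite /cutoff /right_part.
have [x0|x0] := ltP 0 x.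
  rewrite gtr0_norm// [X in _ + _ * X](_ : _ = 0) ?mulr0 ?addr0//.
  by rewrite ltNge (le_trans _ t0)// oppr_le0 ltW.
rewrite ler0_norm// [X in _ * X + _](_ : _ = 0) ?mulr0 ?add0r//.
by rewrite ltNge (le_trans x0 t0).
Qed.

Lemma cutoff_odd t (g : R -> R) x :
  cutoff t (fun x => Num.sg x * g `|x|) (- x) =
  - cutoff t (fun x => Num.sg x * g `|x|) x.
Proof. by rewrite /cutoff normrN sgrN !mulNr. Qed.

Lemma sign_det_ext n (phi psi : nat -> R -> R) (x : n.-tuple T) :
  (forall (i : 'I_n) x, phi i x = psi i x) -> sign_det phi x = sign_det psi x.
Proof.
move=> pp; congr (_ * \det _); by apply/matrixP => i j; rewrite !mxE.
Qed.

Lemma flip_even_odd n p a b i t : 0 <= t -> (i < p.+1)%N ->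
  sign_int n (flip (fun j => even_odd p.+1 a b (bump i j))) t =
  sign_int n (odd_even p (skip i a) b) t.
Proof.
move=> t0 ip; apply: eq_Rintegral => x _; apply: sign_det_ext => j y.
rewrite /cutoff /flip /even_odd /odd_even /skip.
have [jp|pj] := ltnP j p.
  rewrite (_ : (bump i j < p.+1)%N)// /bump.
  by case: (i <= j)%N; rewrite /= ?add0n ?add1n// ltnS ltnW.
rewrite /bump (leq_trans _ pj)// add1n ltnS ltnNge pj /= subSS.
(* The square of sgn y is 1 except at y = 0, which the cutoff excludes since [t] is nonnegative. *)
have [ty|_] := ltP t `|y|; last by rewrite !mulr0.
rewrite mulrA -expr2 sqr_sg (_ : y != 0) ?mul1r//.
by rewrite -normr_gt0 (le_lt_trans t0).
Qed.

Lemma swap_even_odd p q : exists e : bool, forall a b t,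
  (forall i, cont_integrable (a i)) -> (forall i, cont_integrable (b i)) ->
  sign_int (p + q) (odd_even p b a) t =
  (-1) ^+ e * sign_int (p + q) (even_odd q a b) t.
Proof.
(* Exchange of the two blocks of rows, as an injection of the index set. *)
pose f (i : 'I_(p + q)) : 'I_(p + q) := cast_ord (addnC q p)
  match fintype.split i with inl j => rshift q j | inr k => lshift p k end.
have f_inj : injective f.
  move=> i j /cast_ord_inj H; apply: (can_inj (@splitK p q)); move: H.
  case: (fintype.split i) (fintype.split j) => [u|u] [v|v] /eqP.
  - by rewrite eq_rshift => /eqP ->.
  - by rewrite eq_rlshift.
  - by rewrite eq_lrshift.
  - by rewrite eq_lshift => /eqP ->.
have [e He] := @det_inj_rows R _ f f_inj; exists e => a b t ca cb.
rewrite /sign_int -RintegralZl//; last first.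
  apply: integrable_sign_det => i; apply: integrable_cutoff.
  exact: integrable_even_odd.
apply: eq_Rintegral => x _; rewrite /sign_det mulrCA -He; congr (_ * \det _).
apply/matrixP => i j; rewrite !mxE /cutoff /odd_even /even_odd /f.
case: (split_ordP i) => k ->.
  have -> : nat_of_ord (cast_ord (addnC q p) (rshift q k)) = (q + k)%N by [].
  by rewrite ltnNge leq_addr addKn.
have -> : nat_of_ord (cast_ord (addnC q p) (lshift p k)) = k by [].
have -> : nat_of_ord (rshift p k) = (p + k)%N by [].
by rewrite ltn_ord addKn.
Qed.

Lemma tail_sum (I : Type) (r : seq I) (c : I -> R) (g : I -> R -> R) t :
  0 <= t -> (forall i, cont_integrable (g i)) ->
  \int[mu]_y (\sum_(i <- r) c i * cutoff t (fun x => g i `|x|) y) =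
  2 * \sum_(i <- r) c i * tail (g i) t.
Proof.
move=> t0 cg.
have icut i : mu.-integrable setT
    (EFin \o (fun y => c i * cutoff t (fun x => g i `|x|) y)).
  exact: (integrableZl measurableT (c i)
    (integrable_cutoff t (integrable_comp_norm (cg i)))).
rewrite (Rintegral_sum r icut).2 mulr_sumr; apply: eq_bigr => i _.
have ir := integrable_right_part t (cg i).
rewrite RintegralZl//; last first.
  by apply: integrable_cutoff; exact: integrable_comp_norm.
under eq_Rintegral do rewrite cutoff_even//.
rewrite RintegralD//; last exact: (integrable_comp_opp ir).
rewrite (Rintegral_comp_opp ir) Rintegral_right_part.
by ring.
Qed.

End parity.

Section parity_rec.
Context (R : realType).
Local Notation T := (measurableTypeR R).
Local Notation mu := (@lebesgue_measure R).
Local Notation Lam := (@lebesgue_tuple R).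
Implicit Types a b : nat -> R -> R.

Lemma cutoff_even_odd_opp p a b t i y : cutoff t (even_odd p a b i) (- y) =
  (if (i < p)%N then 1 else -1) * cutoff t (even_odd p a b i) y.
Proof.
rewrite /even_odd; case: (i < p)%N.
  by rewrite mul1r /cutoff normrN.
by rewrite mulN1r; exact: cutoff_odd.
Qed.

(** The inner integral depends on |y| only, so in the integral over [y] the terms with an odd
    function cancel; just the [p.+1] even functions remain, each counted twice. *)
Lemma sign_int_even_odd n p a b (K : R) (D : nat -> R -> R) t : 0 <= t ->
  (p <= n)%N ->
  (forall i, cont_integrable (a i)) -> (forall i, cont_integrable (b i)) ->
  (forall i, cont_bounded (D i)) ->
  (forall i y, (i < p.+1)%N -> 0 <= y ->
    sign_int n (odd_even p (skip i a) b) y = K * D i y) ->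
  sign_int n.+1 (even_odd p.+1 a b) t =
  (2 * n.+1%:R * K) * \sum_(i < p.+1) (-1) ^+ i * tail (fun x => a i x * D i x) t.
Proof.
move=> t0 pn ca cb cD HD.
have [iG ->] := sign_int_rec n t (fun i => integrable_even_odd p.+1 i ca cb).
move: iG; set G := fun y => _ => iG.
have GN := Rintegral_comp_opp iG.
have caD i : cont_integrable (fun x => a i x * D i x) by exact: cont_integrableMr.
(* Symmetrizing in [y] makes the cancellation pointwise: for [i] beyond [p] the two values are
   opposite. *)
have GE y : G y + G (- y) = \sum_(i < p.+1) ((-1) ^+ i * 2 * K) *
    cutoff t (fun x => a i `|x| * D i `|x|) y.
  rewrite [RHS](@big_ord_widen _ _ _ p.+1 n.+1 (fun i => ((-1) ^+ i * 2 * K) *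
    cutoff t (fun x => a i `|x| * D i `|x|) y) pn) [RHS]big_mkcond /G.
  rewrite -[LHS]big_split /=; apply: eq_bigr => i _.
  rewrite normrN cutoff_even_odd_opp; have [ip|pi] := ltnP i p.+1; last by ring.
  rewrite (flip_even_odd n a b (normr_ge0 y) ip) (HD i _ ip (normr_ge0 y)).
  by rewrite /cutoff /even_odd ip; ring.
have -> : \int[mu]_y G y = 2^-1 * \int[mu]_y (G y + G (- y)).
  rewrite (RintegralD measurableT iG (integrable_comp_opp iG)) GN.
  by field.
have E := tail_sum (index_enum 'I_p.+1) (fun i => (-1) ^+ i * 2 * K) t0
  (fun i : 'I_p.+1 => caD i).
have -> : \int[mu]_y (G y + G (- y)) =
    2 * \sum_(i < p.+1) (-1) ^+ i * 2 * K * tail (fun x => a i x * D i x) t.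
  by rewrite -[RHS]E; apply: eq_Rintegral => y _; exact: GE.
rewrite !mulr_sumr; apply: eq_bigr => i _.
by field.
Qed.

(* De Bruijn's formula for beta = 1; the sign is left undetermined, being forced
   in the end by the positivity of the gap probability. *)
Definition ensemble_even m := exists e : bool, forall a b t,
  (forall i, cont_integrable (a i)) -> (forall i, cont_integrable (b i)) ->
  0 <= t -> sign_int (m + m) (even_odd m a b) t =
    (-1) ^+ e * ((m + m)`!%:R * 2 ^+ (m + m)) * det_even m a b t.

Definition ensemble_odd m := exists e : bool, forall a b t,
  (forall i, cont_integrable (a i)) -> (forall i, cont_integrable (b i)) ->
  0 <= t -> sign_int (m.+1 + m) (even_odd m.+1 a b) t =
    (-1) ^+ e * ((m.+1 + m)`!%:R * 2 ^+ (m.+1 + m)) * det_odd m a b t.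

Lemma ensemble_even0 : ensemble_even 0.
Proof.
exists false => a b t _ _ _; rewrite /det_even det_mx00 addn0 fact0 !expr0 !mulr1.
rewrite /sign_int /Rintegral lebesgue_tuple0E /= /sign_det /vdm !det_mx00.
by rewrite sgr1 mulr1.
Qed.

(** Removing one of the [m.+1] even functions and flipping leaves [m] odd and [m] even ones, the
    even case with [a] and [b] exchanged; [sum_tail_det_even] then sums the result. *)
Lemma ensemble_oddP m : ensemble_even m -> ensemble_odd m.
Proof.
move=> [e He]; have [e' He'] := swap_even_odd R m m.
exists (e' (+) e) => a b t ca cb t0.
have cs i j : cont_integrable (skip i a j) by exact: ca.
have HD i y : (i < m.+1)%N -> 0 <= y ->
    sign_int (m + m) (odd_even m (skip i a) b) y =
    ((-1) ^+ e' * ((-1) ^+ e * ((m + m)`!%:R * 2 ^+ (m + m)))) *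
    det_even m b (skip i a) y.
  by move=> _ y0; rewrite He'// He// mulrA.
have cD i : cont_bounded (det_even m b (skip i a)).
  exact: cont_bounded_det_even.
rewrite addSn (sign_int_even_odd t0 (leq_addr m m) ca cb cD HD).
rewrite sum_tail_det_even// signr_addb factS natrM exprS; ring.
Qed.

(** From [m.+1] functions of each parity, removal and flip leave [m] odd and [m.+1] even ones: the
    odd case, with the functions [b] now in the majority. *)
Lemma ensemble_evenS m : ensemble_odd m -> ensemble_even m.+1.
Proof.
move=> [e He]; have [e' He'] := swap_even_odd R m m.+1.
exists (e' (+) e) => a b t ca cb t0.
have cs i j : cont_integrable (skip i a j) by exact: ca.
have HD i y : (i < m.+1)%N -> 0 <= y ->
    sign_int (m + m.+1) (odd_even m (skip i a) b) y =
    ((-1) ^+ e' * ((-1) ^+ e * ((m + m.+1)`!%:R * 2 ^+ (m + m.+1)))) *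
    det_odd m b (skip i a) y.
  by move=> _ y0; rewrite He'// addnC He// mulrA.
have cD i : cont_bounded (det_odd m b (skip i a)).
  exact: cont_bounded_det_odd.
rewrite addSn (sign_int_even_odd t0 (leq_addr _ m) ca cb cD HD).
rewrite sum_tail_det_odd// signr_addb factS natrM exprS; ring.
Qed.

Lemma ensembles m : ensemble_even m /\ ensemble_odd m.
Proof.
elim: m => [|m [_ /ensemble_evenS IH]].
  by have := ensemble_even0; split=> //; exact: ensemble_oddP.
by split=> //; exact: ensemble_oddP.
Qed.
End parity_rec.

(** * Hankel matrices of Pochhammer symbols: determinants and first rows of inverses *)

Section hankel.
Context (R : realFieldType).

Definition rising (x : R) (k : nat) : R := \prod_(l < k) (x + l%:R).

Lemma rising0 x : rising x 0 = 1.
Proof. exact: big_ord0. Qed.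

Lemma risingS x k : rising x k.+1 = rising x k * (x + k%:R).
Proof. by rewrite /rising big_ord_recr. Qed.

Lemma risingD x k i : rising x (k + i) = rising x k * rising (x + k%:R) i.
Proof.
rewrite /rising big_split_ord /=; congr (_ * _).
by apply: eq_bigr => l _; rewrite natrD addrA.
Qed.

Lemma rising_gt0 x k : 0 < x -> 0 < rising x k.
Proof. by move=> x0; apply: prodr_gt0 => l _; rewrite ltr_wpDr. Qed.

Fixpoint fdiff k (f : nat -> R) (j : nat) : R :=
  if k is k'.+1 then fdiff k' f j.+1 - fdiff k' f j else f j.

Lemma fdiffE k f j :
  fdiff k f j = \sum_(i < k.+1) (-1) ^+ (k + i) * 'C(k, i)%:R * f (j + i)%N.
Proof.
elim: k j => [|k IH] j.
  by rewrite big_ord1 /= ?addn0 ?bin0 ?expr0 ?mulr1 ?mul1r.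
rewrite /= !IH [RHS]big_ord_recl [in RHS]big_ord_recr /= bin0 binn !mulr1 addn0.
rewrite big_ord_recr /= binn mulr1 [X in _ - X]big_ord_recl /= bin0 mulr1 addn0.
have -> : \sum_(i < k) (-1) ^+ (k.+1 + bump 0 i) * 'C(k.+1, bump 0 i)%:R *
      f (j + bump 0 i)%N =
    \sum_(i < k) ((-1) ^+ (k + i) * 'C(k, i)%:R * f (j.+1 + i)%N) -
    \sum_(i < k) (-1) ^+ (k + bump 0 i) * 'C(k, bump 0 i)%:R * f (j + bump 0 i)%N.
  rewrite -sumrB; apply: eq_bigr => i _.
  rewrite /bump /= add1n binS natrD addnS addSn !exprS addSnnS.
  by rewrite [(k + i.+1)%N]addnS exprS; ring.
have -> : bump 0 k = k.+1 by rewrite /bump leq0n.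
rewrite [(k.+1 + k.+1)%N]addSn [(k + k.+1)%N]addnS !exprS addn0 addSnnS; ring.
Qed.

(** As a function of y, (y)_i has forward difference i (y + 1)_(i - 1); in particular differences of
    order above [i] vanish, here through the falling factorial. *)
Lemma fdiff_rising k x i j : fdiff k (fun j => rising (x + j%:R) i) j =
  (i ^_ k)%:R * rising (x + j%:R + k%:R) (i - k).
Proof.
elim: k j => [|k IH] j; first by rewrite /= ffactn0 mul1r addr0 subn0.
rewrite /= !IH ffactnSr natrM -mulrBr -mulrA; congr (_ * _).
rewrite subnS -[j.+1%:R]natr1 -[k.+1%:R]natr1.
set y := x + j%:R + k%:R.
have -> : x + (j%:R + 1) + k%:R = y + 1 by rewrite /y; ring.
have -> : x + j%:R + (k%:R + 1) = y + 1 by rewrite /y; ring.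
case: (i - k)%N => [|m]; first by rewrite !rising0 subrr mul0r.
rewrite /= risingS -add1n risingD /rising big_ord1 addr0 mulrC -mulrBl.
by congr (_ * _); rewrite add1n -natr1; ring.
Qed.

Section triangular.
Variable x : R.
Hypothesis x0 : 0 < x.
Let g := rising x.

Let g_neq0 k : g k != 0. Proof. by rewrite gt_eqF// rising_gt0. Qed.

(* [laguerre_mx] is the inverse of the unit lower triangular factor of the
   Hankel matrix [g (i + j)], with [g = rising x]. *)
Definition laguerre (k j : nat) : R :=
  (-1) ^+ (k + j) * 'C(k, j)%:R * (rising x k / rising x j).

Lemma laguerre_sum n k (f : nat -> R) : (k < n)%N ->
  \sum_(j < n) laguerre k j * f j =
  g k * fdiff k (fun j => f j / g j) 0.
Proof.
move=> kn; rewrite fdiffE mulr_sumr.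
rewrite [RHS](@big_ord_widen _ _ _ k.+1 n (fun j => g k * ((-1) ^+ (k + j) *
  'C(k, j)%:R * (f j / g j))) kn) [RHS]big_mkcond /=.
apply: eq_bigr => j _; rewrite ltnS; case: leqP => [jk|kj].
  by rewrite /laguerre /g; field; exact: g_neq0.
by rewrite /laguerre bin_small// mulr0 !mul0r.
Qed.

(** g(j + i) / g(j) = (x + j)_i is a polynomial of degree [i] in [j], and [laguerre_sum] takes its
    [k]-th difference at 0. Its vanishing for i < k makes the product with the Hankel matrix
    triangular. *)
Lemma laguerre_hankel n k i : (k < n)%N ->
  \sum_(j < n) laguerre k j * g (j + i) = (i ^_ k)%:R * g i.
Proof.
move=> kn; rewrite (laguerre_sum (fun j => g (j + i)) kn).
rewrite (_ : (fun j => _) = fun j => rising (x + j%:R) i); last first.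
  by apply/funext => j; rewrite /g risingD mulrAC divff ?mul1r.
rewrite fdiff_rising addr0 mulrCA.
have [ik|ki] := ltnP i k; first by rewrite ffact_small// !mul0r.
by rewrite /g -risingD subnKC.
Qed.

Lemma laguerre_gt k j : (k < j)%N -> laguerre k j = 0.
Proof. by move=> kj; rewrite /laguerre bin_small// mulr0 mul0r. Qed.

Lemma laguerre_diag k : laguerre k k = 1.
Proof.
by rewrite /laguerre binn addnn -signr_odd odd_double expr0 divff// !mulr1.
Qed.

Lemma laguerre_col0 k : laguerre k 0 = (-1) ^+ k * g k.
Proof. by rewrite /laguerre bin0 addn0 rising0 divr1 mulr1. Qed.

(** Every iterated difference of 2^j is 2^j again. Such a column arises for beta = 1 and odd size
    from the moments of e^(-x^2 / 2). *)
Lemma laguerre_geometric n k : (k < n)%N ->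
  \sum_(j < n) laguerre k j * (2 ^+ j * g j) = g k.
Proof.
move=> kn; rewrite (laguerre_sum (fun j => 2 ^+ j * g j) kn).
rewrite (_ : (fun j => _) = fun j => 2 ^+ j); last first.
  by apply/funext => j; rewrite mulfK.
have H m j : fdiff m (fun j => 2 ^+ j) j = 2 ^+ j.
  by elim: m j => //= m IH j; rewrite !IH exprS; ring.
by rewrite H mulr1.
Qed.

Definition laguerre_mx n : 'M[R]_n := \matrix_(k < n, j < n) laguerre k j.

Lemma det_laguerre_mx n : \det (laguerre_mx n) = 1.
Proof.
rewrite det_trig; first by rewrite big1// => k _; rewrite mxE laguerre_diag.
by apply/is_trig_mxP => k j kj; rewrite mxE laguerre_gt.
Qed.

Lemma det_hankel n : \det (\matrix_(i < n, j < n) g (i + j)) =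
  \prod_(k < n) (k`!%:R * g k).
Proof.
transitivity (\det (laguerre_mx n *m (\matrix_(i < n, j < n) g (i + j)))).
  by rewrite det_mulmx det_laguerre_mx mul1r.
rewrite -det_tr det_trig.
  apply: eq_bigr => k _; rewrite !mxE -[k`!]ffactnn -(@laguerre_hankel n)//.
  by apply: eq_bigr => j _; rewrite !mxE.
apply/is_trig_mxP => i k ik; rewrite !mxE.
transitivity (\sum_(j < n) laguerre k j * g (j + i)).
  by apply: eq_bigr => j _; rewrite !mxE.
by rewrite laguerre_hankel// ffact_small// mul0r.
Qed.

Lemma det_hankel_border m : \det (\matrix_(i < m.+1, j < m.+1)
    if (j < m)%N then g (i + j) else 2 ^+ i * g i) =
  (\prod_(k < m) (k`!%:R * g k)) * g m.
Proof.
set M := \matrix_(i, j) _.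
have ME k j : (laguerre_mx m.+1 *m M) k j =
    if (j < m)%N then (j ^_ k)%:R * g j else g k.
  rewrite mxE; under eq_bigr do rewrite !mxE.
  by case: ifP => _; [exact: laguerre_hankel|exact: laguerre_geometric].
transitivity (\det (laguerre_mx m.+1 *m M)).
  by rewrite det_mulmx det_laguerre_mx mul1r.
rewrite -det_tr det_trig.
  rewrite big_ord_recr /= mxE ME ltnn; congr (_ * _).
  by apply: eq_bigr => k _; rewrite mxE ME /= ltn_ord ffactnn.
apply/is_trig_mxP => i k ik; rewrite mxE ME.
have im : (i < m)%N by rewrite (leq_trans ik)// -ltnS.
by rewrite im ffact_small// mul0r.
Qed.

Lemma row_sum_laguerre n (c : nat -> R) (F : nat -> nat -> R) j :
  \sum_(i < n) (\sum_(k < n) c k * laguerre k i) * F i j =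
  \sum_(k < n) c k * \sum_(i < n) laguerre k i * F i j.
Proof.
under eq_bigr do rewrite mulr_suml.
rewrite exchange_big /=; apply: eq_bigr => k _; rewrite mulr_sumr.
by apply: eq_bigr => i _; rewrite mulrA.
Qed.

Lemma sum_sign_bin n i : (i < n)%N ->
  \sum_(k < n) (-1) ^+ k * 'C(i, k)%:R = (i == 0%N)%:R :> R.
Proof.
move=> lin.
transitivity (\sum_(k < i.+1) (-1) ^+ k * 'C(i, k)%:R : R).
  rewrite [RHS](@big_ord_widen _ _ _ i.+1 n (fun k => (-1) ^+ k * 'C(i, k)%:R) lin).
  rewrite [RHS]big_mkcond; apply: eq_bigr => k _; rewrite ltnS.
  by case: leqP => // ik; rewrite bin_small// mulr0.
have := @exprDn R 1 (-1) i.
rewrite subrr expr0n => ->; apply: eq_bigr => k _.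
by rewrite expr1n mul1r mulr_natr.
Qed.

(** Row 0 of the inverse Hankel matrix: the weights turn column [j] into the sum of (-1)^k C(j, k)
    g(j), which is 0 unless j = 0. *)
Definition alt_row n (i : nat) : R :=
  \sum_(k < n) ((-1) ^+ k / k`!%:R) * laguerre k i.

Lemma alt_row_hankel n j : (j < n)%N ->
  \sum_(i < n) alt_row n i * g (i + j) = (j == 0%N)%:R.
Proof.
move=> jn; rewrite (row_sum_laguerre _ (fun k => (-1) ^+ k / k`!%:R)
  (fun i j => g (i + j))).
transitivity (\sum_(k < n) (-1) ^+ k * 'C(j, k)%:R * g j).
  apply: eq_bigr => k _; rewrite laguerre_hankel//.
  rewrite -bin_ffact natrM; field.
  by rewrite pnatr_eq0 -lt0n fact_gt0.
by rewrite -mulr_suml sum_sign_bin//; case: j jn => [|j] jn;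
  rewrite ?mul0r//= /g rising0 mul1r.
Qed.

Lemma alt_row0 n : alt_row n 0 = \sum_(k < n) g k / k`!%:R.
Proof.
apply: eq_bigr => k _; rewrite laguerre_col0 mulrACA -expr2 sqrr_sign.
by rewrite mul1r mulrC.
Qed.

Lemma alt_row_geometric n :
  \sum_(i < n) alt_row n i * (2 ^+ i * g i) =
  \sum_(k < n) (-1) ^+ k * (g k / k`!%:R).
Proof.
rewrite (row_sum_laguerre _ (fun k => (-1) ^+ k / k`!%:R)
  (fun i _ => 2 ^+ i * g i) 0).
by apply: eq_bigr => k _; rewrite laguerre_geometric// mulrAC -mulrA.
Qed.
End triangular.

Lemma rising_half_succ k : rising 2^-1 k.+1 = 2^-1 * rising (3 / 2) k.
Proof.
rewrite -(add1n k) risingD /rising big_ord1 addr0; congr (_ * _).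
by apply: eq_bigr => l _; field.
Qed.

(** At [i = 0] the predecessor is 0 itself; [c 0 = 0] keeps row 0 unchanged. *)
Lemma det_row_shift n (F : nat -> nat -> R) (c : nat -> R) : c 0%N = 0 ->
  \det (\matrix_(i < n, j < n) (F i j - c i * F i.-1 j)) =
  \det (\matrix_(i < n, j < n) F i j).
Proof.
move=> c0.
pose L : 'M[R]_n := \matrix_(i, k)
  ((k == i)%:R - c i * ((k.+1 == i)%N : bool)%:R).
have -> : (\matrix_(i < n, j < n) (F i j - c i * F i.-1 j)) =
    L *m \matrix_(i < n, j < n) F i j.
  apply/matrixP => i j; rewrite !mxE.
  under eq_bigr do rewrite !mxE mulrBl -mulrA.
  rewrite sumrB -mulr_sumr; congr (_ - _).
    rewrite (bigD1 i)//= eqxx mul1r big1 ?addr0// => k /negbTE ->.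
    by rewrite mul0r.
  case: i => -[|i] lin /=; first by rewrite c0 !mul0r.
  rewrite (bigD1 (Ordinal (ltnW lin)))//= eqxx mul1r big1 ?addr0// => k.
  by rewrite eqSS -val_eqE /= => /negbTE ->; rewrite mul0r.
rewrite det_mulmx det_trig.
  rewrite big1 ?mul1r// => i _; rewrite mxE eqxx.
  by rewrite (_ : (_ == _)%N = false) ?mulr0 ?subr0//; apply/negbTE;
    rewrite neq_ltn leqnn orbT.
apply/is_trig_mxP => i k ik; rewrite mxE.
rewrite (_ : (k == i) = false); last by apply/negbTE; rewrite neq_ltn ik orbT.
rewrite (_ : (k.+1 == i)%N = false) ?mulr0 ?subr0//.
by apply/negbTE; rewrite neq_ltn (ltn_trans ik)// orbT.
Qed.

Section quaternionic.
Let g := rising (2^-1 : R).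
Let half0 : 0 < (2^-1 : R). Proof. by rewrite invr_gt0. Qed.

(** By g(k + 1) = g(k) (1/2 + k), the entry is 2 (g(i + j + 1) - 2 i g(i + j)): twice row [i] of the
    shifted Hankel matrix less 2 i times its row [i - 1]. What is left is the Hankel determinant for
    3/2. *)
Lemma det_quaternionic n :
  \det (\matrix_(i < n, j < n) (((j.*2.+1)%:R - (i.*2)%:R) * g (i + j))) =
  \prod_(k < n) (k`!%:R * rising (3 / 2) k).
Proof.
transitivity (\det (2 *: \matrix_(i < n, j < n)
    (g (i + j).+1 - (i.*2)%:R * g (i.-1 + j).+1))).
  congr (\det _); apply/matrixP => i j; rewrite !mxE.
  have gE (k : nat) : g k.+1 = g k * (2^-1 + k%:R) by rewrite /g risingS.
  case: i => -[|i] lin /=.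
    by rewrite add0n gE double0 -[j.*2.+1%:R]natr1 -muln2 natrM; field.
  have -> : (i + j).+1 = (i.+1 + j)%N by [].
  by rewrite gE -[j.*2.+1%:R]natr1 -!muln2 !natrM natrD; field.
rewrite detZ (@det_row_shift n (fun i j => g (i + j).+1) (fun i => i.*2%:R))//.
transitivity (2 ^+ n * \det (2^-1 *: \matrix_(i < n, j < n)
    rising (3 / 2) (i + j))).
  by congr (_ * \det _); apply/matrixP => i j; rewrite !mxE /g rising_half_succ.
by rewrite detZ mulrA -exprMn divff// expr1n mul1r det_hankel.
Qed.

(** The solution of q_k - q_(k+1) = (-1)^k with q_n = 0, as the summation by parts in
    [quat_row_solve] requires. *)
Definition quat_coef n k : R := (-1) ^+ k * (odd (n - k))%:R.

Definition quat_row n (i : nat) : R :=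
  \sum_(k < n) (quat_coef n k / k`!%:R) * laguerre 2^-1 k i.

Lemma quat_row_solve n j : (j < n)%N ->
  \sum_(i < n) quat_row n i * (((j.*2.+1)%:R - (i.*2)%:R) * g (i + j)) =
  (j == 0%N)%:R.
Proof.
move=> jn; rewrite (row_sum_laguerre _ _ (fun k => quat_coef n k / k`!%:R)
  (fun i j => ((j.*2.+1)%:R - (i.*2)%:R) * g (i + j))).
have E k : (k < n)%N -> \sum_(i < n) laguerre 2^-1 k i *
    (((j.*2.+1)%:R - (i.*2)%:R) * g (i + j)) =
    g j * (j.*2.+1)%:R * (k`!%:R * (2 * 'C(j, k)%:R - 'C(j.+1, k)%:R)).
  move=> kn.
  (* Here the recurrence for [g] is used to remove [i] from the coefficient, so that two
     neighbouring Hankel columns appear. *)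
  transitivity (\sum_(i < n) ((4 * j%:R + 2) * (laguerre 2^-1 k i * g (i + j)) -
      2 * (laguerre 2^-1 k i * g (i + j.+1)))).
    apply: eq_bigr => i _; rewrite addnS /g risingS.
    by rewrite -[j.*2.+1%:R]natr1 -!muln2 !natrM natrD; field.
  rewrite sumrB -!mulr_sumr !laguerre_hankel//.
  by rewrite -!bin_ffact !natrM risingS -[j.*2.+1%:R]natr1 -!muln2 natrM /g; field.
transitivity (g j * (j.*2.+1)%:R * \sum_(k < n) quat_coef n k *
    (2 * 'C(j, k)%:R - 'C(j.+1, k)%:R)).
  rewrite mulr_sumr; apply: eq_bigr => k _; rewrite E//; field.
  by rewrite pnatr_eq0 -lt0n fact_gt0.
(* By Pascal's rule, 2 C(j, k) - C(j + 1, k) = C(j, k) - C(j, k - 1); summing by parts moves the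
   difference onto [quat_coef]. *)
have -> : \sum_(k < n) quat_coef n k * (2 * 'C(j, k)%:R - 'C(j.+1, k)%:R) =
    \sum_(k < n) (-1) ^+ k * 'C(j, k)%:R.
  case: n jn {E} => // n jn.
  have dE (k : nat) : (k <= n)%N ->
      quat_coef n.+1 k - quat_coef n.+1 k.+1 = (-1) ^+ k.
    move=> kn; rewrite /quat_coef subSS subSn// exprS /=.
    by case: (odd _); rewrite /=; ring.
  transitivity (\sum_(k < n.+1) (quat_coef n.+1 k * 'C(j, k)%:R -
      quat_coef n.+1 k * (if nat_of_ord k is k'.+1 then 'C(j, k')%:R else 0))).
    apply: eq_bigr => -[[|k] kn] _ /=; first by rewrite !bin0; ring.
    by rewrite binS natrD; ring.
  rewrite sumrB [X in _ - X]big_ord_recl /= mulr0 add0r.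
  under [RHS]eq_bigr => k _ do rewrite -dE ?mulrBl -1?ltnS//.
  rewrite sumrB; congr (_ - _); rewrite [RHS]big_ord_recr /=.
  rewrite (_ : quat_coef n.+1 n.+1 = 0); last by rewrite /quat_coef subnn mulr0.
  by rewrite mul0r addr0.
rewrite sum_sign_bin//; case: j {jn E} => [|j]; last by rewrite mulr0.
by rewrite /g rising0 !mulr1.
Qed.

Lemma quat_row0 n :
  quat_row n 0 = \sum_(k < n) (odd (n - k))%:R * (g k / k`!%:R).
Proof.
apply: eq_bigr => k _; rewrite laguerre_col0 /quat_coef.
rewrite mulrAC mulrACA mulrA -expr2 sqrr_sign mul1r /g.
by rewrite mulrA.
Qed.
End quaternionic.
End hankel.

(** * The confluent Vandermonde determinant *)

Section confluent.
Context (R : idomainType).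

Definition confluent_mx n (x : 'I_n -> R) : 'M[R]_(n + n) :=
  row_mx (\matrix_(k, j) x j ^+ k) (\matrix_(k, j) (x j ^+ k.-1 *+ k)).

(** Take the ordinary Vandermonde matrix at the nodes x_j and x_j + X over the polynomial ring.
    Subtracting the first block of columns makes the second one divisible by X; after cancelling
    X^n, the value at X = 0 is the confluent matrix. *)
Lemma det_confluent n (x : 'I_n -> R) : \det (confluent_mx x) =
  (\prod_(i < n) \prod_(j < n | (i < j)%N) -1) *
  (\prod_(i < n) \prod_(j < n | (i < j)%N) (x j - x i)) ^+ 4.
Proof.
pose c (j : 'I_n) : {poly R} := (x j)%:P.
pose A0 : 'M[{poly R}]_(n + n, n) := \matrix_(k, j) c j ^+ k.
pose A1 : 'M[{poly R}]_(n + n, n) := \matrix_(k, j) (c j + 'X) ^+ k.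
pose D : 'M[{poly R}]_(n + n, n) :=
  \matrix_(k, j) \sum_(l < k) (c j + 'X) ^+ (k.-1 - l) * c j ^+ l.
have A1E : A1 = A0 + 'X *: D.
  apply/matrixP => k j; rewrite !mxE; apply/eqP.
  by rewrite addrC -subr_eq subrXX addrAC subrr add0r.
have VE : row_mx A0 A1 = Vandermonde (n + n) (row_mx (\row_j c j) (\row_j (c j + 'X))).
  apply/matrixP => k j; rewrite [RHS]mxE; case: (split_ordP j) => l ->.
    by rewrite !row_mxEl !mxE.
  by rewrite !row_mxEr !mxE.
have blockE : row_mx A0 A1 = row_mx A0 D *m block_mx 1%:M 1%:M 0 'X%:M.
  by rewrite mul_row_block !mulmx1 mulmx0 addr0 mul_mx_scalar A1E.
pose Q : {poly R} := \prod_(i < n) \prod_(j < n | (i < j)%N) (c j - c i).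
pose N : {poly R} := \prod_(i < n) \prod_(j < n | j != i) (c j + 'X - c i).
have detE : \det (row_mx A0 D) = Q * Q * N.
  apply: (@mulIf _ ('X ^+ n)); first by rewrite expf_neq0// polyX_eq0.
  transitivity (\det (row_mx A0 A1)).
    by rewrite blockE det_mulmx det_ublock det1 mul1r det_scalar.
  rewrite VE det_Vandermonde big_split_ord /=.
  set w := row_mx _ _.
  have wl j : w 0 (lshift n j) = c j by rewrite /w row_mxEl mxE.
  have wr j : w 0 (rshift n j) = c j + 'X by rewrite /w row_mxEr mxE.
  have -> : \prod_(i < n) \prod_(j < n + n | (rshift n i < j)%N)
      (w 0 j - w 0 (rshift n i)) = Q.
    apply: eq_bigr => i _; rewrite big_mkcond big_split_ord /=.
    rewrite big1 ?mul1r; last first.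
      by move=> j _; rewrite ltnNge ltnW// ltn_addr.
    rewrite -big_mkcond; apply: eq_big => j; first by rewrite ltn_add2l.
    by move=> _; rewrite !wr; ring.
  (* The node x_i meets its own shift x_i + X once; these n factors are the X^n to be cancelled. *)
  have -> : \prod_(i < n) \prod_(j < n + n | (i < j)%N) (w 0 j - w 0 (lshift n i)) =
      Q * (N * 'X ^+ n).
    transitivity (\prod_(i < n) ((\prod_(j < n | (i < j)%N) (c j - c i)) *
        ((\prod_(j < n | j != i) (c j + 'X - c i)) * 'X))).
      apply: eq_bigr => i _; rewrite big_mkcond big_split_ord /=.
      congr (_ * _).
        by rewrite -big_mkcond; apply: eq_bigr => j _; rewrite !wl.
      rewrite (bigD1 i)//= ltn_addr// wl wr mulrC; congr (_ * _); last by ring.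
      by apply: eq_bigr => j _; rewrite ltn_addr// wr.
    by rewrite !big_split /= prodr_const card_ord.
  ring.
have /(congr1 (fun p : {poly R} => p.[0])) := detE.
have -> : (\det (row_mx A0 D)).[0] = \det (confluent_mx x).
  rewrite -[LHS]/(horner_eval 0 _) -det_map_mx map_row_mx; congr (\det (row_mx _ _)).
    by apply/matrixP => k j; rewrite !mxE /= /horner_eval horner_exp hornerC.
  apply/matrixP => k j; rewrite !mxE /= /horner_eval horner_sum.
  rewrite (eq_bigr (fun=> x j ^+ k.-1)).
    by rewrite sumr_const card_ord.
  move=> l _; rewrite !hornerE -exprD subnK// -ltnS prednK//.
  exact: leq_ltn_trans (ltn_ord l).
move=> ->; rewrite !hornerM.
have QE : Q.[0] = \prod_(i < n) \prod_(j < n | (i < j)%N) (x j - x i).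
  rewrite horner_prod; apply: eq_bigr => i _; rewrite horner_prod.
  by apply: eq_bigr => j _; rewrite !hornerE.
(* At 0 the product runs over ordered pairs, so each unordered pair gives minus a square. *)
have -> : N.[0] = (\prod_(i < n) \prod_(j < n | (i < j)%N) -1) * Q.[0] ^+ 2.
  rewrite QE horner_prod.
  transitivity (\prod_(i < n) ((\prod_(j < n | (i < j)%N) (x j - x i)) *
      \prod_(j < n | (j < i)%N) (x j - x i))).
    apply: eq_bigr => i _; rewrite horner_prod.
    rewrite (bigID (fun j : 'I_n => (i < j)%N)) /=; congr (_ * _).
      apply: eq_big => [j|j _]; last by rewrite !hornerE.
      by rewrite -val_eqE /= neq_ltn; case: ltngtP.
    apply: eq_big => [j|j _]; last by rewrite !hornerE.
    by rewrite -val_eqE /= neq_ltn; case: ltngtP.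
  rewrite big_split /= expr2 mulrCA; congr (_ * _).
  rewrite [LHS](exchange_big_dep xpredT)//= -big_split /=; apply: eq_bigr => i _.
  rewrite -big_split /=; apply: eq_bigr => j _; ring.
by rewrite -QE; ring.
Qed.
End confluent.

(** * Pfaffian sums and their reduction to a determinant *)

Section pair_sum.
Context (R : numDomainType).
Variable n : nat.

(* For a constant family [P], this is [n`!] times the Pfaffian of [P - P^T]. *)
Definition pair_sum (P : 'I_n -> 'M[R]_(n + n)) : R :=
  \sum_(s : 'S_(n + n)) (-1) ^+ s *
    \prod_(j < n) P j (s (lshift n j)) (s (rshift n j)).

(** Composing with the transposition of the two indices of the pair [j0] changes the sign of each
    permutation but not the product. *)
Lemma pair_sum_symmetric P j0 : (P j0)^T = P j0 -> pair_sum P = 0.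
Proof.
move=> Psym.
pose t := tperm (lshift n j0) (rshift n j0).
have SN : pair_sum P = - pair_sum P.
  rewrite {1}/pair_sum (reindex_inj (mulgI t)) /= -sumrN.
  apply: eq_bigr => s _; rewrite odd_permM odd_tperm eq_lrshift /=.
  rewrite signrN mulNr; congr (- (_ * _)).
  apply: eq_bigr => j _; rewrite !permM /t.
  have [->|jj0] := eqVneq j j0; first by rewrite tpermL tpermR -[in LHS]Psym mxE.
  by rewrite !tpermD// ?eq_lrshift ?eq_rlshift// ?eq_lshift ?eq_rshift eq_sym.
by apply/eqP; rewrite -[_ == 0](mulrn_eq0 _ 2) mulr2n {1}SN addNr.
Qed.

(** Expand P = P' + (P - P') in every factor: any choice that uses the symmetric difference at least
    once contributes 0. *)
Lemma pair_sum_eq_antisym (P P' : 'M[R]_(n + n)) :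
  (P - P')^T = P - P' -> pair_sum (fun=> P) = pair_sum (fun=> P').
Proof.
move=> sym.
transitivity (\sum_(J : {set 'I_n})
    pair_sum (fun j => if j \in J then P' else P - P')).
  rewrite /pair_sum exchange_big /=; apply: eq_bigr => s _.
  rewrite -mulr_sumr; congr (_ * _).
  transitivity (\prod_(j < n) (P' (s (lshift n j)) (s (rshift n j)) +
      (P - P') (s (lshift n j)) (s (rshift n j)))).
    by apply: eq_bigr => j _; rewrite !mxE; ring.
  rewrite bigA_distr; apply: eq_bigr => J _; apply: eq_bigr => j _.
  by case: (j \in J).
rewrite (bigD1 [set: 'I_n]%SET)//= big1 ?addr0.
  by apply: eq_bigr => s _; congr (_ * _); apply: eq_bigr => j _; rewrite inE.
move=> J JT; have /subsetPn[j _ jJ] : ~~ ([set: 'I_n] \subset J)%SET.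
  by rewrite finset.subTset.
by apply: (@pair_sum_symmetric _ j); rewrite (negbTE jJ).
Qed.

(** Modulo symmetric matrices all of the matrix moves to the upper right block Z = X - Y^T.
    Factoring it as U V^T gives a sum over maps f as in Cauchy-Binet, where only permutations
    survive, each contributing det Z. *)
Lemma pair_sum_block (X Y : 'M[R]_n) :
  pair_sum (fun=> block_mx 0 X Y 0) = n`!%:R * \det (X - Y^T).
Proof.
set Z := X - Y^T.
rewrite (@pair_sum_eq_antisym _ (block_mx 0 Z 0 0)); last first.
  rewrite opp_block_mx add_block_mx tr_block_mx !oppr0 !addr0 !trmx0.
  have -> : X - Z = Y^T by rewrite /Z opprB addrC subrK.
  by rewrite trmxK.
pose U : 'M[R]_(n + n, n) := col_mx Z 0.
pose V : 'M[R]_(n + n, n) := col_mx 0 1%:M.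
have PE k l : block_mx 0 Z 0 0 k l = \sum_(s < n) U k s * V l s :> R.
  transitivity ((U *m V^T) k l).
    by rewrite /U /V tr_col_mx mul_col_row !mul0mx trmx0 mulmx0 trmx1 mulmx1.
  by rewrite mxE; apply: eq_bigr => s _; rewrite [V^T _ _]mxE.
transitivity (\sum_(f : {ffun 'I_n -> 'I_n})
    \det (colsub f Z) * \det (colsub f (1%:M : 'M[R]_n))).
  rewrite /pair_sum.
  under eq_bigr => s _ do under eq_bigr => j _ do rewrite PE.
  under eq_bigr do rewrite bigA_distr_bigA /= mulr_sumr.
  rewrite exchange_big /=; apply: eq_bigr => f _.
  rewrite -(@det_ublock _ n n _ 0 _) -det_tr; apply: eq_bigr => s _; congr (_ * _).
  rewrite big_split_ord /= -big_split /=; apply: eq_bigr => j _.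
  congr (_ * _); rewrite [RHS]mxE.
    case: (split_ordP (s (lshift n j))) => k ->; first by rewrite block_mxEul /U col_mxEu [RHS]mxE.
    by rewrite block_mxEdl /U col_mxEd !mxE.
  case: (split_ordP (s (rshift n j))) => k ->; first by rewrite block_mxEur /V col_mxEu !mxE.
  by rewrite block_mxEdr /V col_mxEd !mxE.
transitivity (\sum_(t : 'S_n) \det Z).
  transitivity (\sum_(f : {ffun 'I_n -> 'I_n}) \sum_(t : 'S_n)
      (if f == finfun t then (-1) ^+ t * \det (colsub f Z) else 0)).
    apply: eq_bigr => f _; rewrite -[X in _ * X]det_tr mulr_sumr; apply: eq_bigr => t _.
    have [/forallP tf|/forallPn[j tfj]] := boolP [forall j : 'I_n, t j == f j].
      rewrite (_ : f == _); last first.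
        by apply/eqP/ffunP => j; rewrite ffunE (eqP (tf j)).
      by rewrite big1 ?mulr1 1?mulrC// => j _; rewrite !mxE tf.
    rewrite (bigD1 j)//= !mxE (negbTE tfj) mul0r !mulr0.
    by case: eqP => // ft; move: tfj; rewrite ft ffunE eqxx.
  rewrite exchange_big /=; apply: eq_bigr => t _.
  rewrite -big_mkcond big_pred1_eq.
  have -> : colsub (finfun t) Z = col_perm t Z.
    by apply/matrixP => i j; rewrite !mxE ffunE.
  by rewrite col_permE det_mulmx det_perm odd_permV mulrCA -expr2 sqrr_sign mulr1.
by rewrite sumr_const card_Sn mulr_natl.
Qed.
End pair_sum.

Section interlace.
Context (R : comRingType).

Definition interlace p i : nat := if (i < p)%N then i.*2 else (i - p).*2.+1.

(** The two inequalities say that [p + q] consecutive exponents contain exactly [p] even and [q] odd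
    ones. *)
Lemma det_interlace p q : (q <= p)%N -> (p <= q.+1)%N ->
  exists e : bool, forall G : nat -> 'I_(p + q) -> R,
  \det (\matrix_(i < p + q, j < p + q) G (interlace p i) j) =
  (-1) ^+ e * \det (\matrix_(i < p + q, j < p + q) G i j).
Proof.
move=> qp pq.
have lt_pq (i : 'I_(p + q)) : (interlace p i < p + q)%N.
  rewrite /interlace; case: (ltnP i p) => ip; first by lia.
  by have := ltn_ord i; lia.
pose f i := Ordinal (lt_pq i).
have f_inj : injective f.
  move=> i j /(congr1 val) /=; rewrite /interlace => ij; apply: val_inj => /=.
  by move: ij; case: (ltnP i p) => ip; case: (ltnP j p) => jp; lia.
have [e He] := @det_inj_rows R _ f f_inj.
by exists e => G; rewrite -(He (fun i j => G i j)).
Qed.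
End interlace.

(** * The integral formulas of Andreief and de Bruijn *)

Section product_expansion.
Context (R : realType).
Local Notation T := (measurableTypeR R).
Local Notation mu := (@lebesgue_measure R).
Local Notation Lam := (@lebesgue_tuple R).

Lemma Rintegral_sum_prod n (I : Type) (r : seq I) (c : I -> R)
    (h : I -> 'I_n -> T -> R) :
  (forall i j, mu.-integrable setT (EFin \o h i j)) ->
  (Lam n).-integrable setT
    (EFin \o (fun x => \sum_(i <- r) c i * \prod_j h i j (tnth x j))) /\
  \int[Lam n]_x (\sum_(i <- r) c i * \prod_j h i j (tnth x j)) =
  \sum_(i <- r) c i * \prod_j \int[mu]_y h i j y.
Proof.
move=> ih.
have ip i : (Lam n).-integrable setT
    (EFin \o (fun x => c i * \prod_j h i j (tnth x j))).
  exact: (integrableZl measurableT (c i) (integrable_prod_tnth (ih i))).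
have [ir ->] := Rintegral_sum r ip; split=> //; apply: eq_bigr => i _.
rewrite RintegralZl//; last exact: integrable_prod_tnth.
by rewrite Rintegral_prod_tnth.
Qed.

Lemma andreief n (phi psi : 'I_n -> T -> R) :
  (forall i j, mu.-integrable setT (EFin \o (fun x => phi i x * psi j x))) ->
  let F x := \det (\matrix_(i, j) phi i (tnth x j)) *
             \det (\matrix_(i, j) psi i (tnth x j)) in
  (Lam n).-integrable setT (EFin \o F) /\
  \int[Lam n]_x F x = n`!%:R * \det (\matrix_(i, j) \int[mu]_x (phi i x * psi j x)).
Proof.
move=> iphi F.
have -> : F = fun x => \sum_(p : 'S_n * 'S_n) ((-1) ^+ p.1 * (-1) ^+ p.2) *
    \prod_j (phi (p.1 j) (tnth x j) * psi (p.2 j) (tnth x j)).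
  apply/funext => x; rewrite /F -det_tr -[X in _ * X]det_tr.
  rewrite -(pair_bigA _ (fun s t : 'S_n => ((-1) ^+ s * (-1) ^+ t) *
    \prod_j (phi (s j) (tnth x j) * psi (t j) (tnth x j)))) /=.
  rewrite mulr_suml; apply: eq_bigr => s _; rewrite mulr_sumr.
  apply: eq_bigr => t _; rewrite mulrACA -big_split; congr (_ * _).
  by apply: eq_bigr => j _; rewrite !mxE.
have [|iF ->] := Rintegral_sum_prod (index_enum _)
  (fun p : 'S_n * 'S_n => (-1) ^+ p.1 * (-1) ^+ p.2)
  (h := fun p j y => phi (p.1 j) y * psi (p.2 j) y); first by move=> *; exact: iphi.
split=> //.
rewrite -(pair_bigA _ (fun s t : 'S_n => ((-1) ^+ s * (-1) ^+ t) *
    \prod_j \int[mu]_y (phi (s j) y * psi (t j) y))) /=.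
set G := \matrix_(i, j) _.
transitivity (\sum_(s : 'S_n) \det G); last by rewrite sumr_const card_Sn mulr_natl.
apply: eq_bigr => s _.
transitivity ((-1) ^+ s * \det (row_perm s G)).
  rewrite mulr_sumr; apply: eq_bigr => t _; rewrite -mulrA; congr (_ * (_ * _)).
  by apply: eq_bigr => j _; rewrite !mxE.
by rewrite row_permE det_mulmx det_perm mulrA -expr2 sqrr_sign mul1r.
Qed.

(** The variable x_j occurs in columns [j] and [n + j] only, so each term of the determinant
    integrates to a product over pairs of columns. *)
Lemma Rintegral_pair n (a b : 'I_(n + n) -> T -> R) :
  (forall k l, mu.-integrable setT (EFin \o (fun x => a k x * b l x))) ->
  let F x := \det (row_mx (\matrix_(k, j) a k (tnth x j))
                          (\matrix_(k, j) b k (tnth x j))) in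
  (Lam n).-integrable setT (EFin \o F) /\
  \int[Lam n]_x F x =
  pair_sum (fun=> \matrix_(k, l) \int[mu]_x (a k x * b l x)).
Proof.
move=> iab F.
have -> : F = fun x => \sum_(s : 'S_(n + n)) (-1) ^+ s *
    \prod_j (a (s (lshift n j)) (tnth x j) * b (s (rshift n j)) (tnth x j)).
  apply/funext => x; rewrite /F -det_tr; apply: eq_bigr => s _.
  congr (_ * _); rewrite big_split_ord /= -big_split; apply: eq_bigr => j _.
  by rewrite !(mxE trmx_key) row_mxEl row_mxEr !mxE.
have [|iF ->] := Rintegral_sum_prod (index_enum _) (fun s : 'S_(n + n) => (-1) ^+ s)
  (h := fun s j y => a (s (lshift n j)) y * b (s (rshift n j)) y).
  by move=> *; exact: iab.
split=> //.
apply: eq_bigr => s _; congr (_ * _).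
by apply: eq_bigr => j _; rewrite mxE.
Qed.
End product_expansion.

(** * Gaussian monomials and their moments on the half line *)

Section gaussian_moments.
Context (R : realType).
Local Notation T := (measurableTypeR R).
Local Notation mu := (@lebesgue_measure R).
Implicit Types (c : R) (k : nat).

Definition gmono c k (x : R) : R := x ^+ k * expR (- c * x ^+ 2).

Lemma continuous_gmono c k : continuous (gmono c k).
Proof.
move=> x; apply: cvgM; first exact: exprn_continuous.
apply: (@continuous_comp _ _ _ (fun x : R => - c * x ^+ 2) expR).
  by apply: cvgM; [exact: cvg_cst|exact: exprn_continuous].
exact: continuous_expR.
Qed.

Lemma gmono_bounded c k : 0 < c -> exists2 C, 0 <= C & forall x, `|gmono c k x| <= C.
Proof.
(* The summand 1 serves for |x| at most 1; beyond, |x|^k is at most x^(2 k), and (c x^2)^k / k! is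
   below e^(c x^2). *)
move=> c0; exists (1 + k`!%:R / c ^+ k) => [|x].
  by rewrite addr_ge0// divr_ge0// exprn_ge0// ltW.
have cx0 : 0 <= c * x ^+ 2 by rewrite mulr_ge0// ?sqr_ge0// ltW.
rewrite normrM normrX (ger0_norm (expR_ge0 _)) mulNr expRN.
rewrite ler_pdivrMr ?expR_gt0//.
have e1 : 1 <= expR (c * x ^+ 2) by rewrite -expR0 ler_expR.
have [x1|x1] := leP `|x| 1.
  rewrite (@le_trans _ _ 1)//; first by rewrite exprn_ile1.
  apply: mulr_ege1 => //.
  by rewrite lerDl divr_ge0// exprn_ge0// ltW.
case: k => [|k].
  rewrite expr0; apply: mulr_ege1 => //.
  by rewrite lerDl divr_ge0// exprn_ge0// ltW.
have h := expR_ge1Dxn k cx0.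
have xk : `|x| ^+ k.+1 <= `|x| ^+ (k.+1 * 2).
  by apply: ler_weXn2l; [exact: ltW|rewrite leq_pmulr].
apply: (le_trans xk); rewrite mulrDl mul1r ler_wpDl ?expR_ge0//.
rewrite mulrAC ler_pdivlMr ?exprn_gt0// mulnC exprM real_normK ?num_real//.
rewrite -exprMn mulrC -ler_pdivrMl ?ltr0n ?fact_gt0//.
by apply: le_trans h; rewrite [X in X <= _]mulrC lerDr.
Qed.

Lemma gauss_total c : 0 < c -> mu.-integrable setT (EFin \o gmono c 0) /\
  (\int[mu]_x (gmono c 0 x)%:E = (Num.sqrt (pi / c))%:E)%E.
Proof.
(* The normal law of variance 1 / (2 c) has exponent - c x^2, and its total mass 1 gives the
   integral. *)
move=> c0; pose s : R := Num.sqrt (c^-1 / 2).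
have s0 : s != 0 by rewrite gt_eqF// sqrtr_gt0 divr_gt0// invr_gt0.
have s2 : s ^+ 2 = c^-1 / 2 by rewrite sqr_sqrtr// ltW// divr_gt0// invr_gt0.
pose K : R := Num.sqrt (pi / c).
have K0 : 0 < K by rewrite sqrtr_gt0 divr_gt0// pi_gt0.
have PK : normal_peak s = K^-1.
  rewrite /normal_peak s2 /K; congr (_ ^-1); congr (Num.sqrt _).
  by field; rewrite gt_eqF.
have E x : gmono c 0 x = K * normal_pdf 0 s x.
  rewrite normal_pdfE// PK mulrA divff ?gt_eqF// mul1r /normal_fun /gmono.
  rewrite expr0 mul1r subr0 s2; congr expR.
  by field; rewrite gt_eqF.
have -> : EFin \o gmono c 0 = (fun x => K%:E * (normal_pdf 0 s x)%:E)%E.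
  by apply/funext => x; rewrite /= E.
split; first exact: (integrableZl measurableT K (integrable_normal_pdf 0 s)).
under eq_integral do rewrite E EFinM.
rewrite integralZl//; last exact: integrable_normal_pdf.
by rewrite integral_normal_pdf mule1.
Qed.

(** One half of the Gaussian bounds the power, the other half remains for integrability. *)
Lemma gmono_split c k x : gmono c k x = gmono (c / 2) k x * gmono (c / 2) 0 x.
Proof.
rewrite /gmono expr0 mul1r -mulrA -expRD; congr (_ * expR _).
by field.
Qed.

Lemma cont_integrable_gmono c k : 0 < c -> cont_integrable (gmono c k).
Proof.
move=> c0; split; first exact: continuous_gmono.
have c2 : 0 < c / 2 by rewrite divr_gt0.
have [C C0 HC] := gmono_bounded k c2.
have iC : mu.-integrable setT (EFin \o (fun x => C * gmono (c / 2) 0 x)).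
  exact: (integrableZl measurableT C (gauss_total c2).1).
apply: le_integrable iC => //.
  apply/measurable_EFinP; apply: continuous_measurable_fun.
  exact: continuous_gmono.
move=> x _; rewrite lee_fin gmono_split [X in X <= _]normrM [X in _ <= X]normrM ler_wpM2r//.
by rewrite (le_trans (HC x))// ler_norm.
Qed.

Lemma is_derive_expn k x : is_derive x (1 : R) (fun y => y ^+ k) (k%:R * x ^+ k.-1).
Proof.
elim: k => [|k IH].
  under eq_fun do rewrite expr0; rewrite mul0r; exact: is_derive_cst.
under eq_fun do rewrite exprS.
apply: (is_derive_eq (is_deriveM (is_derive_id x 1) IH)).
rewrite /GRing.scale /= mulr1; case: k {IH} => [|k] /=.
  by rewrite mul0r mulr0 add0r mul1r.
by rewrite -[k.+2%:R]natr1 exprS; ring.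
Qed.

Lemma is_derive_gauss c x : is_derive x (1 : R) (fun x => expR (- c * x ^+ 2))
  (- (2 * c * x) * expR (- c * x ^+ 2)).
Proof.
have d2 : is_derive x (1 : R) (fun y => - c * y ^+ 2) (- (2 * c * x)).
  apply: (is_derive_eq (is_deriveM (is_derive_cst (- c) x 1) (is_derive_expn 2 x))).
  by rewrite scaler0 addr0 /GRing.scale /= expr1; ring.
have de := @is_derive1_comp R expR (fun y => - c * y ^+ 2) x _ _
  (is_derive_expR (- c * x ^+ 2)) d2.
by apply: (is_derive_eq de); rewrite mulrC.
Qed.

Lemma is_derive_gmonoS c k x : is_derive x (1 : R) (gmono c k.+1)
  (k.+1%:R * gmono c k x - 2 * c * gmono c k.+2 x).
Proof.
apply: (is_derive_eq (is_deriveM (is_derive_expn k.+1 x) (is_derive_gauss c x))).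
by rewrite /GRing.scale /= /gmono !exprS; ring.
Qed.

Lemma is_derive_gmono0 c x : is_derive x (1 : R) (gmono c 0)
  (- (2 * c * gmono c 1 x)).
Proof.
rewrite (_ : gmono c 0 = fun x => expR (- c * x ^+ 2)); last first.
  by apply/funext => y; rewrite /gmono expr0 mul1r.
apply: (is_derive_eq (is_derive_gauss c x)).
by rewrite /gmono expr1; ring.
Qed.

Lemma cvg_gmono c k : 0 < c -> gmono c k x @[x --> +oo] --> (0 : R).
Proof.
move=> c0; have [C C0 HC] := gmono_bounded k.+1 c0.
apply/cvgr0Pnorm_le => e e0; near=> x.
have x0 : 0 < x by near: x; exact: nbhs_pinfty_gt.
have := HC x; rewrite /gmono exprS -mulrA normrM (gtr0_norm x0) => H.
rewrite -(ler_pM2l x0) (le_trans H)// -ler_pdivrMr//.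
Unshelve. all: by end_near. Qed.

Lemma tail_gmonoSS c k t : 0 < c ->
  2 * c * tail (gmono c k.+2) t = k.+1%:R * tail (gmono c k) t + gmono c k.+1 t.
Proof.
move=> c0; move: t; apply: (eq_derive_cvg0
  (f := fun t => - (2 * c * gmono c k.+2 t))).
- move=> t; have dt := is_derive_tail t (cont_integrable_gmono k.+2 c0).
  apply: (is_derive_eq (is_deriveM (is_derive_cst (2 * c) t 1) dt)).
  by rewrite scaler0 addr0 /GRing.scale /= mulrN.
- move=> t; have dt := is_derive_tail t (cont_integrable_gmono k c0).
  apply: (is_derive_eq (is_deriveD (is_deriveM (is_derive_cst (k.+1%:R : R) t (1 : R)) dt)
    (is_derive_gmonoS c k t))).
  by rewrite scaler0 addr0 /GRing.scale /=; ring.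
- rewrite -[X in _ --> X](mulr0 (2 * c)); apply: cvgM; first exact: cvg_cst.
  exact/cvg_tail/cont_integrable_gmono.
- rewrite -[X in _ --> X](addr0 (0 : R)); apply: cvgD; last exact: cvg_gmono.
  rewrite -[X in _ --> X](mulr0 (k.+1%:R : R)); apply: cvgM; first exact: cvg_cst.
  exact/cvg_tail/cont_integrable_gmono.
Qed.

Lemma tail_gmono1 c t : 0 < c -> 2 * c * tail (gmono c 1) t = gmono c 0 t.
Proof.
move=> c0; move: t; apply: (eq_derive_cvg0
  (f := fun t => - (2 * c * gmono c 1 t))).
- move=> t; have dt := is_derive_tail t (cont_integrable_gmono 1 c0).
  apply: (is_derive_eq (is_deriveM (is_derive_cst (2 * c) t 1) dt)).
  by rewrite scaler0 addr0 /GRing.scale /= mulrN.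
- exact: is_derive_gmono0.
- rewrite -[X in _ --> X](mulr0 (2 * c)); apply: cvgM; first exact: cvg_cst.
  exact/cvg_tail/cont_integrable_gmono.
- exact: cvg_gmono.
Qed.

Definition moment c k := tail (gmono c k) 0.

Lemma moment0 c : 0 < c -> moment c 0 = Num.sqrt (pi / c) / 2.
Proof.
move=> c0; have [ig Eg] := gauss_total c0.
have H : (\int[mu]_x (gmono c 0 x)%:E =
    2%:E * \int[mu]_(x in `[0%R, +oo[) (gmono c 0 x)%:E)%E.
  rewrite ge0_symfun_integralT//=.
  - by rewrite (_ : [set x | _] = `[0, +oo[%classic)//;
      apply/seteqP; split => x/=; rewrite in_itv/= andbT.
  - by move=> x; rewrite /gmono expr0 mul1r expR_ge0.
  - exact: continuous_gmono.
  - by move=> x; rewrite /gmono /= !expr0 sqrrN.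
rewrite /moment /tail Rintegral_itv_obnd_cbnd; last exact: integrableS ig.
have /(congr1 fine) := H; rewrite Eg fineM//; last first.
  by apply: integrable_fin_num => //; apply: integrableS ig.
by move=> /= ->; rewrite mulrC mulKf.
Qed.

Lemma moment_even c k : 0 < c ->
  moment c k.*2 = Num.sqrt (pi / c) / 2 * (rising 2^-1 k / c ^+ k).
Proof.
move=> c0; have cN0 : c != 0 by rewrite gt_eqF.
elim: k => [|k IH]; first by rewrite moment0// rising0 expr0 divr1 mulr1.
have := tail_gmonoSS k.*2 0 c0; rewrite -/(moment _ _) -/(moment _ _) IH.
rewrite /gmono expr0n mul0r addr0 risingS exprS doubleS => E.
apply: (@mulfI _ (2 * c)); first by rewrite mulf_neq0.
rewrite E -[k.*2.+1%:R]natr1 -muln2 natrM; field.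
by rewrite expf_neq0.
Qed.

Lemma moment_odd c k : 0 < c ->
  moment c k.*2.+1 = k`!%:R / (2 * c ^+ k.+1).
Proof.
move=> c0; have cN0 : c != 0 by rewrite gt_eqF.
elim: k => [|k IH].
  have := tail_gmono1 0 c0; rewrite -/(moment _ _) => E.
  apply: (@mulfI _ (2 * c)); first by rewrite mulf_neq0.
  rewrite double0 fact0 E /gmono expr0 mul1r (expr0n _ 2) /= mulr0 expR0 expr1.
  by field.
have := tail_gmonoSS k.*2.+1 0 c0; rewrite -/(moment _ _) -/(moment _ _) IH.
rewrite /gmono expr0n mul0r addr0 doubleS => E.
apply: (@mulfI _ (2 * c)); first by rewrite mulf_neq0.
rewrite E factS natrM !exprS -[k.*2.+2%:R]natr1 -[k.*2.+1%:R]natr1 -[k.+1%:R]natr1.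
rewrite -muln2 natrM; field.
by rewrite expf_neq0.
Qed.
End gaussian_moments.

(** * The Gamma function at half-integers as a Gaussian moment *)

Section gamma_half.
Context (R : realType).
Local Notation T := (measurableTypeR R).
Local Notation mu := (@lebesgue_measure R).

(** The substitution s = t^2, carried out by comparing t -> tail G (t^2) with 2 tail h: same
    derivative, same limit 0 at +oo. *)
Lemma Gamma_half k : Gamma (1 + k.+1%:R / 2 : R) = 2 * moment 1 k.+2.
Proof.
pose G (s : R) := Num.sqrt s ^+ k.+1 * expR (- s).
(* The derivatives must agree on the whole line, and sqrt(t^2) is |t|; on the positive axis [h] is
   the integrand of the moment. *)
pose h (x : R) := x * (`|x| ^+ k.+1 * expR (- x ^+ 2)).
have c2 : 0 < (1 / 2 : R) by [].
have [C C0 HC] := gmono_bounded k.+1 c2.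
have GE s : 0 <= s -> G s = gmono (1 / 2) k.+1 (Num.sqrt s) * expR (- (1 / 2) * s).
  move=> s0; rewrite /G /gmono -mulrA -expRD sqr_sqrtr//; congr (_ * expR _).
  by field.
have G0 s : s <= 0 -> G s = 0.
  by move=> s0; rewrite /G ler0_sqrtr// expr0n mul0r.
have cG : continuous G.
  move=> s; apply: cvgM; last first.
    by apply: (@continuous_comp _ _ _ -%R expR); [exact: opp_continuous|exact: continuous_expR].
  apply: (@continuous_comp _ _ _ Num.sqrt (fun x => x ^+ k.+1)).
    exact: sqrt_continuous.
  exact: exprn_continuous.
have iG : cont_integrable G.
  split=> //.
  have iexp : mu.-integrable setT
      (EFin \o (fun x => (2 * C) * exponential_pdf (1 / 2) x)).
    exact: (integrableZl measurableT (2 * C) (integrable_exponential_pdf c2)).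
  apply: le_integrable iexp => //.
    by apply/measurable_EFinP; exact: continuous_measurable_fun.
  move=> s _; rewrite lee_fin [leRHS]ger0_norm; last first.
    by rewrite !mulr_ge0// exponential_pdf_ge0.
  have [s0|s0] := leP 0 s; last first.
    rewrite (G0 _ (ltW s0)) normr0; apply: mulr_ge0; first exact: mulr_ge0.
    by apply: exponential_pdf_ge0.
  rewrite GE// normrM (ger0_norm (expR_ge0 _)) exponential_pdfE//.
  rewrite (_ : 2 * C * _ = C * expR (- (1 / 2) * s)); last first.
    by field.
  by rewrite ler_wpM2r// expR_ge0.
have ih : cont_integrable h.
  have [cg ig] := cont_integrable_gmono k.+2 (ltr01 : 0 < (1 : R)).
  have ch : continuous h.
    have cn : continuous (fun x : R => `|x| ^+ k.+1).
      move=> x; apply: (@continuous_comp _ _ _ (fun y : R => `|y|) (fun x : R => x ^+ k.+1)).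
        exact: (@norm_continuous _ R).
      exact: exprn_continuous.
    have ce : continuous (fun x : R => expR (- x ^+ 2)).
      move=> x; apply: (@continuous_comp _ _ _ (fun x : R => - x ^+ 2) expR).
        by apply: cvgN; exact: exprn_continuous.
      exact: continuous_expR.
    move=> x; apply: cvgM; first exact: cvg_id.
    by apply: cvgM; [exact: cn|exact: ce].
  split=> //; apply: le_integrable ig => //.
    by apply/measurable_EFinP; exact: continuous_measurable_fun.
  move=> x _; rewrite lee_fin (_ : `|h x| = `|gmono 1 k.+2 x|)// /h /gmono mulN1r.
  by rewrite [in RHS]exprS -[in RHS]mulrA !normrM !normrX normr_id.
have -> : Gamma (1 + k.+1%:R / 2) = tail G 0.
  rewrite /Gamma /tail; apply: eq_Rintegral => t.
  rewrite inE/= in_itv/= andbT => t0.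
  rewrite addrAC subrr add0r /G; congr (_ * _).
  by rewrite mulrC powRrM powR12_sqrt ?ltW// powR_mulrn// sqrtr_ge0.
have -> : moment 1 k.+2 = tail h 0.
  rewrite /moment /tail; apply: eq_Rintegral => t.
  rewrite inE/= in_itv/= andbT => t0.
  by rewrite /gmono /h (gtr0_norm t0) exprS mulN1r mulrA.
have tE : (fun t => tail G (t ^+ 2)) =1 (fun t => 2 * tail h t).
  apply: (eq_derive_cvg0 (f := fun t => - (2 * h t))).
  - move=> t.
    have de := @is_derive1_comp R (tail G) (fun y => y ^+ 2) t _ _
      (is_derive_tail (t ^+ 2) iG) (is_derive_expn 2 t).
    apply: (is_derive_eq de); rewrite /G sqrtr_sqr /h expr1; ring.
  - move=> t; apply: (is_derive_eq (is_deriveM (is_derive_cst (2 : R) t (1 : R))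
      (is_derive_tail t ih))).
    by rewrite scaler0 addr0 /GRing.scale /= mulrN.
  - have : (tail G \o (fun t : R => t ^+ 2)) x @[x --> +oo] --> (0 : R).
      apply: (cvg_comp _ _ _ (cvg_tail iG)).
      apply/cvgryPge => A; near=> x.
      have x1 : 1 <= x by near: x; apply: nbhs_pinfty_ge; exact: num_real.
      have xA : A <= x by near: x; apply: nbhs_pinfty_ge; exact: num_real.
      by rewrite expr2 (le_trans xA)// ler_peMr// (le_trans ler01).
    by [].
  - rewrite -[X in _ --> X](mulr0 (2 : R)); apply: cvgM; first exact: cvg_cst.
    exact: cvg_tail.
by have := tE 0; rewrite expr0n.
Unshelve. all: by end_near. Qed.
End gamma_half.

(** * Wallis bounds and the growth of the slopes *)

Section central_binomial.
Context (R : realType).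
Local Notation T := (measurableTypeR R).
Local Notation mu := (@lebesgue_measure R).
Implicit Types (k n N : nat).

(** The normalized central binomial coefficient C(2 k, k) / 4^k. *)
Definition cbin k : R := rising 2^-1 k / k`!%:R.

Lemma cbin0 : cbin 0 = 1.
Proof. by rewrite /cbin rising0 fact0 divr1. Qed.

Lemma cbin_gt0 k : 0 < cbin k.
Proof. by rewrite divr_gt0 ?rising_gt0 ?invr_gt0// ltr0n fact_gt0. Qed.

Lemma cbinS k : k.+1%:R * cbin k.+1 = (2^-1 + k%:R) * cbin k.
Proof.
rewrite /cbin risingS factS natrM; field.
by rewrite !(addrC 1) natr1 !pnatr_eq0 -lt0n fact_gt0.
Qed.

Lemma cbin_decr k : cbin k.+1 <= cbin k.
Proof.
have k0 : 0 < k.+1%:R :> R by rewrite ltr0n.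
rewrite -(ler_pM2l k0) cbinS ler_pM2r ?cbin_gt0//.
by rewrite -[k.+1%:R]natr1 (addrC 2^-1) lerD2l invf_le1// ler1n.
Qed.

Definition cbin_sum N := \sum_(k < N) cbin k.

Lemma cbin_sumE N : cbin_sum N = 2 * N%:R * cbin N.
Proof.
rewrite /cbin_sum; elim: N => [|N IH]; first by rewrite big_ord0 mulr0 mul0r.
by rewrite big_ord_recr /= IH -[in RHS]mulrA cbinS; field.
Qed.

Lemma moment_gt0 k : 0 < moment 1 k :> R.
Proof.
rewrite -(odd_double_half k); case: (odd k); rewrite /= ?add1n ?add0n.
  by rewrite moment_odd// expr1n mulr1 divr_gt0// ltr0n fact_gt0.
rewrite moment_even// expr1n !divr1 mulr_gt0 ?rising_gt0 ?invr_gt0//.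
by rewrite divr_gt0// sqrtr_gt0 pi_gt0.
Qed.

(* Integrate [x ^ k (x - c)^2 e^(-x^2) >= 0]. *)
Lemma moment_log_convex k :
  moment 1 k.+1 ^+ 2 <= moment 1 k * moment 1 k.+2 :> R.
Proof.
have M0 := moment_gt0 k; pose c := moment 1 k.+1 / moment 1 k : R.
have ig j (e : R) : mu.-integrable `]0, +oo[ (EFin \o (fun x => e * gmono 1 j x)).
  have [_ ij] := cont_integrable_gmono j (ltr01 : 0 < (1 : R)).
  apply: (integrableS measurableT) => //.
  exact: (integrableZl measurableT e ij).
have h : 0 <= \int[mu]_(x in `]0, +oo[)
    ((1 * gmono 1 k.+2 x + (- (2 * c)) * gmono 1 k.+1 x) + c ^+ 2 * gmono 1 k x).
  apply: Rintegral_ge0 => x /=; rewrite in_itv/= andbT => x0.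
  rewrite (_ : _ + _ = (x - c) ^+ 2 * (x ^+ k * expR (- 1 * x ^+ 2))).
    by rewrite mulr_ge0 ?sqr_ge0// mulr_ge0 ?expR_ge0// exprn_ge0// ltW.
  by rewrite /gmono !(exprS _ k.+1) !(exprS _ k); ring.
have ij j (e : R) : \int[mu]_(x in `]0, +oo[) (e * gmono 1 j x) = e * moment 1 j.
  rewrite RintegralZl//.
  have [_ ij] := cont_integrable_gmono j (ltr01 : 0 < (1 : R)).
  exact: integrableS ij.
rewrite RintegralD// in h; last first.
  apply: (@eq_integrable _ _ _ mu _ (measurable_itv _)
    (fun x => (1 * gmono 1 k.+2 x)%:E + (- (2 * c) * gmono 1 k.+1 x)%:E)%E) => //.
  by apply: integrableD => //; exact: ig.
rewrite RintegralD// !ij in h.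
rewrite -subr_ge0.
rewrite (_ : _ - _ = moment 1 k *
  (1 * moment 1 k.+2 + - (2 * c) * moment 1 k.+1 + c ^+ 2 * moment 1 k)).
  by rewrite mulr_ge0// ltW.
by rewrite /c; field; rewrite gt_eqF.
Qed.

(** Log-convexity around an odd moment, which is a plain factorial, bounds the even moments on
    either side from below; [cbin_upper] centers it at an even moment instead. *)
Lemma cbin_lower N : (pi * (N%:R + 2^-1))^-1 <= cbin N ^+ 2.
Proof.
have := moment_log_convex N.*2.
rewrite -doubleS !moment_even// moment_odd// !expr1n !divr1 mulr1 risingS.
have -> : Num.sqrt pi / 2 * rising 2^-1 N *
    (Num.sqrt pi / 2 * (rising 2^-1 N * (2^-1 + N%:R))) =
  Num.sqrt pi ^+ 2 * (cbin N * N`!%:R) ^+ 2 * (2^-1 + N%:R) / 4 :> R.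
  by rewrite /cbin; field; rewrite pnatr_eq0 -lt0n fact_gt0.
rewrite sqr_sqrtr ?pi_ge0//.
have f0 : 0 < N`!%:R ^+ 2 / 4 :> R by rewrite divr_gt0// exprn_gt0// ltr0n fact_gt0.
have p0 : 0 < pi * (N%:R + 2^-1) :> R by rewrite mulr_gt0 ?pi_gt0// ltr_wpDl ?invr_gt0.
move=> h; rewrite -[leLHS]mul1r ler_pdivrMr// -(ler_pM2l f0).
by move: h; congr (_ <= _); field.
Qed.

Lemma cbin_upper N : (0 < N)%N -> cbin N ^+ 2 <= (pi * N%:R)^-1.
Proof.
case: N => // N _; have := moment_log_convex N.*2.+1.
rewrite -!doubleS moment_even// !moment_odd// !expr1n !divr1 !mulr1.
have -> : (Num.sqrt pi / 2 * rising 2^-1 N.+1) ^+ 2 =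
  Num.sqrt pi ^+ 2 * (cbin N.+1 * N.+1`!%:R) ^+ 2 / 4 :> R.
  by rewrite /cbin; field; rewrite pnatr_eq0 -lt0n fact_gt0.
rewrite sqr_sqrtr ?pi_ge0//.
have n0 : N.+1%:R != 0 :> R by rewrite pnatr_eq0.
have f0 : 0 < N.+1`!%:R ^+ 2 / 4 :> R by rewrite divr_gt0// exprn_gt0// ltr0n fact_gt0.
have p0 : 0 < pi * N.+1%:R :> R by rewrite mulr_gt0 ?pi_gt0.
move=> h; rewrite -[leRHS]mul1r ler_pdivlMr// -(ler_pM2l f0).
rewrite -(ler_pM2l (_ : 0 < N.+1%:R^-1)) ?invr_gt0//.
by move: h; rewrite factS natrM; congr (_ <= _); field.
Qed.

(** The square is 4 N^2 [cbin N ^+ 2], and the Wallis bounds place it between 4 N^2 / (pi (N + 1/2))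
    and 4 N / pi. These differ by less than 2 / pi, and pi is at least 2. *)
Lemma cbin_sum_sqr N : `|cbin_sum N ^+ 2 - 4 / pi * N%:R| <= 1.
Proof.
case: N => [|N]; first by rewrite /cbin_sum big_ord0 mulr0 expr0n subr0 normr0.
have p0 : 0 < pi :> R := pi_gt0 R; have p2 : 2 <= pi :> R := pi_ge2 R.
have n0 : 0 < N.+1%:R :> R by [].
have L := cbin_lower N.+1; have U := cbin_upper (ltn0Sn N).
rewrite cbin_sumE exprMn.
move: (pi : R) (cbin _ ^+ 2) N.+1%:R p0 p2 n0 L U => P a x p0 p2 x0 L U.
move: L U; have xh : 0 < x + 2^-1 by rewrite addr_gt0// invr_gt0.
have f0 : 0 < (2 * x) ^+ 2 by rewrite exprn_gt0// mulr_gt0.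
rewrite -(ler_pM2l f0) => L; rewrite -(ler_pM2l f0) => U.
have pN : P != 0 by rewrite gt_eqF.
rewrite ler_norml; apply/andP; split; last first.
  rewrite lerBlDr (le_trans U)//.
  have -> : (2 * x) ^+ 2 * (P * x)^-1 = 4 / P * x.
    by field; rewrite pN gt_eqF.
  by rewrite lerDr.
rewrite lerBrDr (le_trans _ L)// -subr_ge0.
have -> : (2 * x) ^+ 2 * (P * (x + 2^-1))^-1 - (-1 + 4 / P * x) =
   1 - 2 / P * (x / (x + 2^-1)) :> R.
  by field; rewrite pN/= gt_eqF//; lra.
rewrite subr_ge0 mulr_ile1//.
- by rewrite divr_ge0// ltW.
- by rewrite divr_ge0// ltW.
- by rewrite ler_pdivrMr// mul1r.
- by rewrite ler_pdivrMr// mul1r lerDl invr_ge0.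
Qed.

Lemma alternating_bound n (a : nat -> R) : (forall k, 0 <= a k) ->
  (forall k, a k.+1 <= a k) -> 0 <= \sum_(k < n) (-1) ^+ k * a k <= a 0%N.
Proof.
elim: n a => [|n IH] a a0 ad; first by rewrite big_ord0 lexx a0.
have /andP[l u] := IH (fun k => a k.+1) (fun k => a0 k.+1) (fun k => ad k.+1).
rewrite big_ord_recl /= mul1r.
have -> : \sum_(i < n) (-1) ^+ bump 0 i * a (bump 0 i) =
    - \sum_(i < n) (-1) ^+ i * a i.+1.
  rewrite -sumrN; apply: eq_bigr => i _.
  by rewrite /bump /= add1n exprS mulN1r mulNr.
by rewrite subr_ge0 (le_trans u)//= lerBlDr lerDl.
Qed.

Definition cbin_alt n := \sum_(k < n) (-1) ^+ k * cbin k.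

Lemma cbin_alt_bound n : 0 <= cbin_alt n <= 1.
Proof.
by rewrite -cbin0; apply: alternating_bound => k; [exact/ltW/cbin_gt0|exact: cbin_decr].
Qed.

(** Twice the indicator of n - k odd is 1 - (-1)^(n - k). *)
Lemma cbin_sum_odd n : 2 * \sum_(k < n) (odd (n - k))%:R * cbin k =
  cbin_sum n - (-1) ^+ n * cbin_alt n.
Proof.
rewrite mulr_sumr /cbin_sum /cbin_alt mulr_sumr -sumrB; apply: eq_bigr => k _.
rewrite -signr_odd -(signr_odd _ k) oddB; last exact: ltnW.
by case: (odd n); case: (odd k); rewrite /=; ring.
Qed.

Lemma bounded_div_cvg0 (u d : nat -> R) C : (forall n, `|u n| <= C) ->
  d n @[n --> \oo] --> +oo -> u n / d n @[n --> \oo] --> (0 : R).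
Proof.
move=> uC doo; apply/cvgr0Pnorm_le => e e0.
have C0 : 0 <= C by rewrite (le_trans (normr_ge0 (u 0%N))).
have := doo; move=> /cvgryPge /(_ (C / e + 1)); apply: filterS => n dn.
have d0 : 0 < d n by rewrite (lt_le_trans _ dn)// ltr_wpDl// divr_ge0// ltW.
rewrite normrM normfV (gtr0_norm d0) ler_pdivrMr// (le_trans (uC n))//.
by rewrite -ler_pdivrMl// mulrC (le_trans _ dn)// lerDl.
Qed.

Lemma cvg_natr : (n%:R : R) @[n --> \oo] --> +oo.
Proof. exact: cvgr_idn. Qed.

Lemma cvg_sqrt_natr : (Num.sqrt n%:R : R) @[n --> \oo] --> +oo.
Proof.
apply/cvgryPge => A; have := cvg_natr => /cvgryPge /(_ (A ^+ 2)).
apply: filterS => n; rewrite -ler_sqrt// sqrtr_sqr; apply: le_trans.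
exact: ler_norm.
Qed.

Lemma cvg_cbin_sum (h : nat -> nat) (r : R) : 0 <= r ->
  (forall n, `|(h n)%:R - r * n%:R| <= 1) ->
  cbin_sum (h n) / Num.sqrt n%:R @[n --> \oo] --> 2 * Num.sqrt (r / pi).
Proof.
move=> r0 hr; have p0 : 0 < pi :> R := pi_gt0 R.
have s0 N : 0 <= cbin_sum N by apply: sumr_ge0 => k _; exact/ltW/cbin_gt0.
have L : cbin_sum (h n) ^+ 2 / n%:R @[n --> \oo] --> 4 * (r / pi).
  have D : (cbin_sum (h n) ^+ 2 - 4 / pi * (r * n%:R)) / n%:R @[n --> \oo] --> (0 : R).
    apply: (bounded_div_cvg0 (C := 1 + 4 / pi)) cvg_natr => n.
    rewrite (_ : _ - _ = (cbin_sum (h n) ^+ 2 - 4 / pi * (h n)%:R) +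
      4 / pi * ((h n)%:R - r * n%:R)); last by ring.
    rewrite (le_trans (ler_normD _ _))// lerD ?cbin_sum_sqr// normrM gtr0_norm ?divr_gt0//.
    by rewrite -[leRHS]mulr1 ler_pM2l ?divr_gt0.
  have D' : 4 * (r / pi) + (cbin_sum (h n) ^+ 2 - 4 / pi * (r * n%:R)) / n%:R
      @[n --> \oo] --> 4 * (r / pi).
    by rewrite -[X in _ --> X]addr0; apply: cvgD => //; exact: cvg_cst.
  apply: cvg_trans D'.
  apply: near_eq_cvg; near=> n.
  have n0 : (n%:R : R) != 0 by rewrite pnatr_eq0 -lt0n; near: n; exact: nbhs_infty_gt.
  have pN : (pi : R) != 0 by rewrite gt_eqF.
  by move: (pi : R) (n%:R : R) pN n0 => P x PN xN; field; rewrite PN xN.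
have -> : 2 * Num.sqrt (r / pi) = Num.sqrt (4 * (r / pi)).
  rewrite [RHS]sqrtrM// (_ : 4 = 2 ^+ 2); last by ring.
  by rewrite sqrtr_sqr ger0_norm.
have L' : Num.sqrt (cbin_sum (h n) ^+ 2 / n%:R) @[n --> \oo] -->
    Num.sqrt (4 * (r / pi)).
  by apply: continuous_cvg L; exact: sqrt_continuous.
apply: cvg_trans L'.
apply: near_eq_cvg; near=> n.
by rewrite sqrtrM ?sqr_ge0// sqrtr_sqr ger0_norm// sqrtrV.
Unshelve. all: by end_near. Qed.
End central_binomial.

(** * The normalization constants against the closed forms of the determinants *)

Section mehta.
Context (R : realType).
Implicit Types n m k : nat.
Local Notation gc := (gaussian_constant R).
Local Notation g := (rising (2^-1 : R)).

Lemma gaussian_constant0 beta : gc beta 0 = 1.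
Proof.
by rewrite /gaussian_constant big_geq// !mul0r oppr0 addr0 !powRr0 !mulr1.
Qed.

(** Each quotient of Gamma values is a quotient of Gaussian moments, explicit according to
    parity. *)
Lemma gaussian_constantS beta n : (0 < beta)%N -> gc beta n.+1 =
  gc beta n * ((Num.sqrt (2 * pi))^-1 *
    (beta%:R `^ (n%:R * (beta%:R / 2)) * Num.sqrt beta%:R) *
    (moment 1 beta.+1 / moment 1 (n.+1 * beta).+1)).
Proof.
move=> b0; have bN : beta%:R != 0 :> R by rewrite pnatr_eq0 -lt0n.
have pN : 2 * pi != 0 :> R by rewrite gt_eqF// mulr_gt0// pi_gt0.
have -> : moment 1 beta.+1 / moment 1 (n.+1 * beta).+1 =
    Gamma (1 + beta%:R / 2) / Gamma (1 + n.+1%:R * beta%:R / 2) :> R.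
  rewrite -(natrM _ n.+1 beta).
  have [b ->] : exists b, beta = b.+1 by exists beta.-1; rewrite prednK.
  have -> : (n.+1 * b.+1)%N = (n.+1 * b.+1).-1.+1 by rewrite mulnS.
  by rewrite !Gamma_half -mulf_div divff ?mul1r.
rewrite /gaussian_constant big_nat_recr//=.
have -> : - (n.+1%:R / 2) = - (n%:R / 2) + - 2^-1 :> R.
  by rewrite -natr1; field.
rewrite powRD ?pN ?implybT// (powRN _ 2^-1) powR12_sqrt ?mulr_ge0 ?pi_ge0//.
have -> : n.+1%:R * (n.+1%:R - 1) * beta%:R / 4 + n.+1%:R / 2 =
   (n%:R * (n%:R - 1) * beta%:R / 4 + n%:R / 2) + (n%:R * (beta%:R / 2) + 2^-1) :> R.
  by rewrite -natr1; field.
rewrite (@powRD _ _ (_ + n%:R / 2)) ?bN ?implybT//.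
rewrite (@powRD _ _ (n%:R * _)) ?bN ?implybT// powR12_sqrt//.
ring.
Qed.

Lemma fact_double m : (m.*2)`!%:R = 4 ^+ m * m`!%:R * g m :> R.
Proof.
elim: m => [|m IH]; first by rewrite rising0 !mulr1.
rewrite doubleS !factS !natrM IH risingS exprS -[m.*2.+2%:R]natr1.
by rewrite -[m.*2.+1%:R]natr1 -[m.+1%:R]natr1 -muln2 natrM; field.
Qed.

Lemma sqrtpi_neq0 : Num.sqrt pi != 0 :> R.
Proof. by rewrite gt_eqF// sqrtr_gt0 pi_gt0. Qed.

Lemma sqrt2pi : Num.sqrt (2 * pi) = Num.sqrt 2 * Num.sqrt pi :> R.
Proof. exact: sqrtrM. Qed.

Lemma sqrt2_neq0 : Num.sqrt 2 != 0 :> R.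
Proof. by rewrite gt_eqF// sqrtr_gt0. Qed.

Let g_neq0 k : g k != 0. Proof. by rewrite gt_eqF// rising_gt0 ?invr_gt0. Qed.
Let f_neq0 k : k`!%:R != 0 :> R. Proof. by rewrite pnatr_eq0 -lt0n fact_gt0. Qed.

Lemma gaussian_constant1S n : gc 1 n.+1 =
  gc 1 n / (4 * Num.sqrt 2 * moment 1 n.+2).
Proof.
rewrite gaussian_constantS// powR1 mul1r sqrtr1 mulr1 muln1; congr (_ * _).
rewrite (@moment_even R 1 1)// expr1n !divr1 risingS rising0.
have M0 := lt0r_neq0 (moment_gt0 R n.+2).
by rewrite sqrt2pi; field; rewrite M0 sqrt2_neq0 sqrtpi_neq0.
Qed.

Lemma gaussian_constant2S n : gc 2 n.+1 =
  gc 2 n * (2 ^+ n / (Num.sqrt pi * n.+1`!%:R)).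
Proof.
rewrite gaussian_constantS// divff// mulr1 powR_mulrn//; congr (_ * _).
rewrite muln2 (@moment_odd R 1 1)// moment_odd// !expr1n sqrt2pi (_ : 1`! = 1%N)//; field.
by rewrite f_neq0 sqrt2_neq0 sqrtpi_neq0.
Qed.

Lemma gaussian_constant4S n : gc 4 n.+1 =
  gc 4 n * (4 * 16 ^+ n / (Num.sqrt (2 * pi) * n.+1.*2`!%:R)).
Proof.
rewrite gaussian_constantS//; congr (_ * _).
have -> : n%:R * (4%:R / 2) = (n * 2)%:R :> R by rewrite natrM; field.
rewrite powR_mulrn// mulnC exprM.
have -> : 4%:R ^+ 2 = 16 :> R by ring.
have -> : Num.sqrt 4%:R = 2 :> R.
  by rewrite (_ : 4%:R = 2 ^+ 2); [rewrite sqrtr_sqr ger0_norm|ring].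
have -> : (n.+1 * 4)%N = n.+1.*2.*2 by rewrite -!muln2 -mulnA.
rewrite (@moment_odd R 1 2)// moment_odd// !expr1n sqrt2pi (_ : 2`! = 2%N)//; field.
by rewrite f_neq0 sqrt2_neq0 sqrtpi_neq0.
Qed.

(* The matrix size is [e + m.*2], with [e] equal to 0 or 1. *)
Definition mehta1 m e : R :=
  (e + m.*2)`!%:R * 2 ^+ (e + m.*2) * (Num.sqrt pi / 2) ^+ m *
  (\prod_(k < m) (k`!%:R * g k)) * (Num.sqrt (2 * pi) / 2 * g m) ^+ e.

Lemma mehta1E m : gc 1 m.*2 * mehta1 m 0 = 1 /\ gc 1 m.*2.+1 * mehta1 m 1 = 1.
Proof.
have S n : gc 1 n.*2 * mehta1 n 0 = 1 -> gc 1 n.*2.+1 * mehta1 n 1 = 1.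
  move=> <-; rewrite gaussian_constant1S -doubleS moment_even// expr1n !divr1.
  rewrite /mehta1 add0n add1n factS natrM exprS expr1 expr0 mulr1 risingS sqrt2pi.
  rewrite -[n.*2.+1%:R]natr1 -muln2 natrM.
  have h : 2^-1 + n%:R != 0 :> R by rewrite gt_eqF// ltr_wpDr// invr_gt0.
  field; rewrite g_neq0 sqrt2_neq0 sqrtpi_neq0/= andbT.
  by apply: contraNneq h => h; apply/eqP; lra.
suff E : gc 1 m.*2 * mehta1 m 0 = 1 by split=> //; exact: S.
elim: m => [|m IH].
  by rewrite gaussian_constant0 /mehta1 big_ord0 !mulr1.
rewrite -(S _ IH) doubleS gaussian_constant1S -!doubleS moment_odd// expr1n.
rewrite /mehta1 add0n add1n doubleS factS natrM !(exprS _ m.*2.+1) expr1 expr0 mulr1.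
rewrite big_ord_recr /= exprS sqrt2pi factS natrM.
rewrite -[m.*2.+2%:R]natr1 -[m.*2.+1%:R]natr1 -[m.+1%:R]natr1 -muln2 natrM.
have h : m%:R + 1 != 0 :> R by rewrite natr1.
have q2 : Num.sqrt 2 ^+ 2 = 2 :> R by rewrite sqr_sqrtr.
(* [field] treats the root as an atom; writing one occurrence as 2 / sqrt 2 balances its powers on
   the two sides. *)
have e : Num.sqrt 2 = 2 / Num.sqrt 2 :> R.
  by apply: (mulIf sqrt2_neq0); rewrite divfK ?sqrt2_neq0// -expr2 q2.
rewrite [Num.sqrt 2 in RHS]e (exprS (Num.sqrt pi / 2)); field.
by rewrite h f_neq0 sqrt2_neq0.
Qed.

(** n! times the Hankel determinants of the even and odd monomials for the weight e^(-x^2). *)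
Definition mehta2 p q : R := (p + q)`!%:R *
  (Num.sqrt pi ^+ p * \prod_(k < p) (k`!%:R * g k)) *
  (Num.sqrt pi ^+ q * \prod_(k < q) (k`!%:R * g k.+1)).

Lemma mehta2E m : gc 2 m.*2 * mehta2 m m = 1 /\ gc 2 m.*2.+1 * mehta2 m.+1 m = 1.
Proof.
have S n : gc 2 n.*2 * mehta2 n n = 1 -> gc 2 n.*2.+1 * mehta2 n.+1 n = 1.
  move=> <-; rewrite gaussian_constant2S /mehta2 addSn addnn !factS natrM.
  rewrite big_ord_recr /= exprS fact_double.
  have -> : 2 ^+ n.*2 = 4 ^+ n :> R by rewrite -mul2n exprM; congr (_ ^+ _); ring.
  have p4 : 4 ^+ n != 0 :> R by rewrite expf_neq0// pnatr_eq0.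
  by field; rewrite g_neq0 f_neq0 p4 sqrtpi_neq0 (addrC 1) natr1 pnatr_eq0.
suff E : gc 2 m.*2 * mehta2 m m = 1 by split=> //; exact: S.
elim: m => [|m IH].
  by rewrite gaussian_constant0 /mehta2 !big_ord0 !mulr1.
rewrite -(S _ IH) doubleS gaussian_constant2S /mehta2 addnS addSn addnn !factS !natrM.
rewrite [\prod_(i < m.+1) (_ * g i.+1)]big_ord_recr /= !exprS fact_double risingS.
have -> : 2 ^+ m.*2 = 4 ^+ m :> R by rewrite -mul2n exprM; congr (_ ^+ _); ring.
rewrite -[m.*2.+2%:R]natr1 -[m.*2.+1%:R]natr1 -muln2 natrM.
have p4 : 4 ^+ m != 0 :> R by rewrite expf_neq0// pnatr_eq0.
have c1 : m%:R * 2 + 1 != 0 :> R by rewrite -natrM natr1 pnatr_eq0.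
have c2 : m%:R * 2 + 1 + 1 != 0 :> R by rewrite -natrM !natr1 pnatr_eq0.
by field; rewrite g_neq0 f_neq0 p4 c1 c2 sqrtpi_neq0.
Qed.

(** n! times the quaternionic determinant for e^(-2 x^2); the powers of 2 come from rescaling rows
    and columns. *)
Definition mehta4 n : R := n`!%:R * (Num.sqrt (pi / 2) ^+ n *
  ((\prod_(i < n) 2 ^- i) ^+ 2 * \prod_(k < n) (k`!%:R * rising (3 / 2) k))).

Lemma mehta4E n : gc 4 n * mehta4 n = 1.
Proof.
elim: n => [|n IH]; first by rewrite gaussian_constant0 /mehta4 !big_ord0 fact0 expr0 expr1n !mulr1.
rewrite -IH gaussian_constant4S /mehta4 !big_ord_recr /= exprMn !(exprS _ n) factS natrM.
rewrite fact_double factS natrM (exprS 4).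
rewrite rising_half_succ.
have -> : 16 ^+ n = (2 ^+ n) ^+ 4 :> R by rewrite -exprM mulnC exprM; congr (_ ^+ _); ring.
have -> : 4 ^+ n = (2 ^+ n) ^+ 2 :> R by rewrite -exprM mulnC exprM; congr (_ ^+ _); ring.
have -> : Num.sqrt (2 * pi) = 2 * Num.sqrt (pi / 2) :> R.
  rewrite (_ : 2 * pi = 2 ^+ 2 * (pi / 2)); last by field.
  by rewrite sqrtrM ?sqr_ge0// sqrtr_sqr ger0_norm.
have p2 : 2 ^+ n != 0 :> R by rewrite expf_neq0// pnatr_eq0.
have s2 : Num.sqrt (pi / 2) != 0 :> R by rewrite gt_eqF// sqrtr_gt0 divr_gt0// pi_gt0.
have r0 : rising (3 / 2) n != 0 :> R by rewrite gt_eqF// rising_gt0.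
have n0 : n.+1%:R != 0 :> R by rewrite pnatr_eq0.
move: n.+1%:R n0 => x x0.
by field; rewrite r0 f_neq0 s2 p2 x0.
Qed.
End mehta.

(** * The gap probability as an integral over the whole space *)

Section gap.
Context (R : realType).
Local Notation T := (measurableTypeR R).
Local Notation mu := (@lebesgue_measure R).
Local Notation Lam := (@lebesgue_tuple R).

Lemma Gamma_ge0 (x : R) : 0 <= Gamma x.
Proof.
by apply: Rintegral_ge0 => t _; rewrite mulr_ge0 ?powR_ge0 ?expR_ge0.
Qed.

Lemma gap_probability_ge0 beta n (eps : R) : 0 <= gap_probability beta n eps.
Proof.
apply: Rintegral_ge0 => x _; rewrite /gaussian_density mulr_ge0//.
  rewrite mulr_ge0 ?expR_ge0// /gaussian_constant !mulr_ge0 ?powR_ge0//.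
  by apply: prodr_ge0 => j _; rewrite divr_ge0 ?Gamma_ge0.
by apply: prodr_ge0 => k _; apply: prodr_ge0 => j _; rewrite exprn_ge0.
Qed.

Lemma prod_cutoff n eps c (x : n.-tuple T) :
  \prod_j cutoff eps (gmono c 0) (tnth x j) =
  expR (- c * \sum_j tnth x j ^+ 2) *
  (`[< forall i, (`]-oo, - eps[ `|` `]eps, +oo[)%classic (tnth x i) >] : bool)%:R.
Proof.
have -> : expR (- c * \sum_j tnth x j ^+ 2) = \prod_j gmono c 0 (tnth x j).
  rewrite mulr_sumr expR_sum; apply: eq_bigr => j _.
  by rewrite /gmono expr0 mul1r.
rewrite /cutoff big_split /=; congr (_ * _).
have E (y : T) : (`]-oo, - eps[ `|` `]eps, +oo[)%classic y <-> eps < `|y|.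
  rewrite /= !in_itv /= andbT ltr_normr orbC ltrNr.
  by split=> [[->|->]//|/orP[->|->]]; rewrite ?orbT//; [left|right].
case: asboolP => [h|h].
  by rewrite big1// => j _; have /E -> := h j.
have [j /negP hj] : exists j, ~ (eps < `|tnth x j|).
  by apply/existsNP => H; apply: h => i; apply/E.
by rewrite (bigD1 j)//= (negbTE hj) mul0r.
Qed.

Lemma gap_probabilityE beta n eps (F : n.-tuple T -> R) :
  (forall x, (\prod_j cutoff eps (gmono (beta%:R / 2) 0) (tnth x j)) *
    `|vdm x| ^+ beta = F x) ->
  (Lam n).-integrable setT (EFin \o F) ->
  gap_probability beta n eps = gaussian_constant R beta n * \int[Lam n]_x F x.
Proof.
move=> FE iF; rewrite /gap_probability Rintegral_mkcond -RintegralZl//.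
apply: eq_Rintegral => x _; rewrite -FE prod_cutoff /patch /gaussian_density.
move: (gaussian_constant R beta n) => K; case: asboolP => h.
  rewrite mem_set//= mulr1 -mulrA; congr (_ * (_ * _)).
  rewrite vdmE (exchange_big_dep xpredT)//= normr_prod -prodrXl.
  by apply: eq_bigr => j _; rewrite normr_prod -prodrXl.
by rewrite memNset// mulr0 mul0r mulr0.
Qed.

Lemma Rintegral_cutoff_gmono c k t : 0 < c -> 0 <= t ->
  mu.-integrable setT (EFin \o cutoff t (gmono c k)) /\
  \int[mu]_x cutoff t (gmono c k) x =
    if odd k then 0 else 2 * tail (gmono c k) t.
Proof.
move=> c0 t0; have ck := cont_integrable_gmono k c0.
have ik := integrable_cutoff t ck.2; split=> //.
case: ifPn => ok.
  have E : \int[mu]_x cutoff t (gmono c k) (- x) =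
      -1 * \int[mu]_x cutoff t (gmono c k) x.
    rewrite -RintegralZl//; apply: eq_Rintegral => x _.
    rewrite /cutoff normrN /gmono sqrrN exprNn -signr_odd ok expr1.
    by rewrite !mulrA.
  by have := Rintegral_comp_opp ik; rewrite E => h; lra.
have := tail_sum (index_enum 'I_1) (fun=> 1) t0 (fun=> ck).
rewrite big_ord1 mul1r => <-; apply: eq_Rintegral => x _.
rewrite big_ord1 mul1r /cutoff /gmono real_normK ?num_real//.
by rewrite -(odd_double_half k) (negbTE ok) add0n -mul2n !exprM real_normK ?num_real.
Qed.

Lemma vdm_interlace p q : (q <= p)%N -> (p <= q.+1)%N ->
  exists e : bool, forall (x : (p + q).-tuple T),
  vdm x = (-1) ^+ e *
    \det (\matrix_(i < p + q, j < p + q) tnth x j ^+ interlace p i).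
Proof.
move=> qp pq; have [e He] := @det_interlace R p q qp pq.
exists e => x; rewrite (He (fun i j => tnth x j ^+ i)) mulrA -expr2 sqrr_sign.
by rewrite mul1r.
Qed.
End gap.

(** * From a determinant formula to the slope at 0 *)

Section slope.
Context (R : realType).

Definition gap_slope beta n (v : R) :=
  (forall eps : R, 0 < eps -> derivable (gap_probability beta n) eps 1) /\
  derive1 (gap_probability beta n) eps @[eps --> (0 : R)^'+] --> v.

(* With [M] and [M'] the matrices of [f] and [df]: if [r *m M 0] is row [i0] of
   [M' 0], its only nonzero row, then [(det M)' 0 = r i0 * det (M 0)]. *)
Lemma gap_slope_det beta n N (i0 : 'I_N) (kappa : R) (f df : 'I_N -> 'I_N -> R -> R)
    (r : 'I_N -> R) :
  (forall eps, 0 <= eps -> gap_probability beta n eps =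
     kappa * \det (\matrix_(i, j) f i j eps)) ->
  (forall i j eps, is_derive eps (1 : R) (f i j) (df i j eps)) ->
  (forall i j, continuous (df i j)) ->
  `|kappa * \det (\matrix_(i, j) f i j 0)| = 1 ->
  (forall i j, i != i0 -> df i j 0 = 0) ->
  (forall j, \sum_i r i * f i j 0 = df i0 j 0) ->
  gap_slope beta n (r i0).
Proof.
move=> gapE fdf cdf norm1 df0 rf.
pose G eps := kappa * \det (\matrix_(i, j) f i j eps).
pose dG eps := kappa * \sum_k \det (\matrix_(i, j)
  if i == k then df i j eps else f i j eps).
have Gd eps : is_derive eps (1 : R) G (dG eps).
  have := is_deriveM (is_derive_cst (kappa : R) eps (1 : R))
    (is_derive_det (fun i j => fdf i j eps)).
  by move/is_derive_eq; apply; rewrite scaler0 addr0.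
(* The formula holds for nonnegative eps only, but its right-hand side is differentiable on the
   whole line: derivatives transfer at positive points, and the limit comes from continuity at 0. *)
have near_gap (eps : R) : 0 < eps ->
    \forall x \near eps, G x = gap_probability beta n x.
  by move=> e0; near=> x; rewrite gapE//; apply: ltW; near: x; exact: lt_nbhsr.
have gapd (eps : R) : 0 < eps ->
    is_derive eps (1 : R) (gap_probability beta n) (dG eps).
  by move=> e0; apply: near_eq_is_derive (Gd eps); exact: near_gap.
split=> [eps e0|]; first by have := gapd _ e0; case.
have det0 : kappa * \det (\matrix_(i, j) f i j 0) = 1.
  by rewrite -norm1 ger0_norm// -gapE// gap_probability_ge0.
have -> : r i0 = dG 0.
  rewrite /dG (bigD1 i0)//= [X in _ * (_ + X)]big1 => [|k ki0]; last first.
    rewrite (expand_det_row _ k) big1// => j _.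
    by rewrite mxE eqxx df0// mul0r.
  rewrite addr0.
  rewrite -[LHS]mulr1 -det0 mulrCA; congr (_ * _).
  rewrite [RHS](expand_det_row _ i0).
  pose F : 'M[R]_N := \matrix_(i, j) f i j 0.
  have cofE j : cofactor (\matrix_(i, j) if i == i0 then df i j 0 else f i j 0) i0 j =
      (\adj F) j i0.
    rewrite mxE /cofactor; congr (_ * \det _); apply/matrixP => i l.
    by rewrite !mxE eq_sym (negbTE (neq_lift _ _)).
  under eq_bigr => j _ do rewrite cofE mxE eqxx -rf mulr_suml.
  rewrite exchange_big /=; transitivity (\sum_i r i * (F *m \adj F) i i0).
    rewrite (bigD1 i0)//= big1 ?addr0 => [|i /negbTE ii0].
      by rewrite mul_mx_adj mxE eqxx.
    by rewrite mul_mx_adj mxE ii0 mulr0.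
  apply: eq_bigr => i _; rewrite mxE mulr_sumr; apply: eq_bigr => j _.
  by rewrite [F i j]mxE mulrA.
have cf i j : f i j x @[x --> 0] --> f i j 0.
  by apply/differentiable_continuous/derivable1_diffP; have [] := fdf i j 0.
have cdG : dG x @[x --> 0] --> dG 0.
  apply: cvgM; first exact: cvg_cst.
  have cdet k : \det (\matrix_(i, j) if i == k then df i j x else f i j x)
      @[x --> 0] --> \det (\matrix_(i, j) if i == k then df i j 0 else f i j 0).
    apply: (cvg_det (f := fun i j x => if i == k then df i j x else f i j x)).
    by move=> i j; case: ifP => _; [exact: cdf|exact: cf].
  elim: (index_enum _) => [|k s IH].
    by rewrite big_nil; under eq_fun do rewrite big_nil; exact: cvg_cst.
  by rewrite big_cons; under eq_fun do rewrite big_cons; exact: cvgD.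
apply: cvg_trans (cvg_at_right_filter cdG); apply: near_eq_cvg; near=> eps.
rewrite derive1E; apply/esym.
have e0 : 0 < eps by near: eps; exact: nbhs_right_gt.
have := gapd _ e0; case; by move=> _ ->.
Unshelve. all: by end_near. Qed.
End slope.

Section gaussian_entries.
Context (R : realType).
Implicit Types (c t : R) (k : nat).

Lemma cutoff_gmonoE t c k x :
  cutoff t (gmono c k) x = x ^+ k * cutoff t (gmono c 0) x.
Proof. by rewrite /cutoff /gmono expr0 mul1r !mulrA. Qed.

Lemma is_derive_tail_gmono (a : R) c k t : 0 < c ->
  is_derive t (1 : R) (fun t => a * tail (gmono c k) t) (- (a * gmono c k t)).
Proof.
move=> c0; have dt := is_derive_tail t (cont_integrable_gmono k c0).
apply: (is_derive_eq (is_deriveM (is_derive_cst a t (1 : R)) dt)).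
by rewrite scaler0 addr0 /GRing.scale /= mulrN.
Qed.

Lemma continuous_scaled_gmono (a : R) c k :
  continuous (fun t => - (a * gmono c k t) : R).
Proof.
move=> t; apply: cvgN; apply: cvgM; first exact: cvg_cst.
exact: continuous_gmono.
Qed.

Lemma gmono0E c k : gmono c k 0 = (k == 0%N)%:R :> R.
Proof. by rewrite /gmono !expr0n /= mulr0 expR0 mulr1; case: k. Qed.
End gaussian_entries.

Lemma interlace_lshift p q (i : 'I_p) : interlace p (lshift q i) = i.*2.
Proof. by rewrite /interlace /= ltn_ord. Qed.

Lemma interlace_rshift p q (i : 'I_q) : interlace p (rshift p i) = i.*2.+1.
Proof. by rewrite /interlace /= ltnNge leq_addr addKn. Qed.

(** * The case beta = 2 *)

Section unitary_ensemble.
Context (R : realType).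
Variables p q : nat.
Hypotheses (qp : (q <= p)%N) (pq : (p <= q.+1)%N) (p_gt0 : (0 < p)%N).
Local Notation n := (p + q)%N.
Local Notation e := (interlace p).
Local Notation g := (rising (2^-1 : R)).

Let f (i j : 'I_n) (t : R) : R :=
  if odd (e i + e j) then 0 else 2 * tail (gmono 1 (e i + e j)) t.

Let gap2E eps : 0 <= eps ->
  gap_probability 2 n eps =
    gaussian_constant R 2 n * n`!%:R * \det (\matrix_(i, j) f i j eps).
Proof.
move=> eps0.
pose phi (i : 'I_n) (y : R) : R := y ^+ e i.
pose psi (i : 'I_n) : R -> R := cutoff eps (gmono 1 (e i)).
have phipsi i j : (fun x => phi i x * psi j x) = cutoff eps (gmono 1 (e i + e j)).
  apply/funext => x; rewrite /phi /psi cutoff_gmonoE [RHS]cutoff_gmonoE.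
  by rewrite exprD mulrA.
have I i j := Rintegral_cutoff_gmono (e i + e j) (ltr01 : 0 < (1 : R)) eps0.
have [|iF EF] := andreief (phi := phi) (psi := psi).
  by move=> i j; rewrite phipsi; exact: (I i j).1.
rewrite (gap_probabilityE _ iF) => [|x].
  rewrite EF mulrA; congr (_ * \det _); apply/matrixP => i j; rewrite !mxE.
  by rewrite phipsi (I i j).2.
have [s ->] := vdm_interlace R qp pq.
have -> : \det (\matrix_(i, j) psi i (tnth x j)) =
    \prod_j cutoff eps (gmono 1 0) (tnth x j) *
    \det (\matrix_(i < n, j < n) tnth x j ^+ e i).
  rewrite -det_scale_cols; congr (\det _); apply/matrixP => i j; rewrite !mxE.
  exact: cutoff_gmonoE.
rewrite real_normK ?num_real// exprMn sqrr_sign mul1r divff// expr2 /phi.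
by rewrite mulrA mulrC.
Qed.

Let det0 : \det (\matrix_(i < n, j < n) f i j 0) =
  (Num.sqrt pi ^+ p * \prod_(k < p) (k`!%:R * g k)) *
  (Num.sqrt pi ^+ q * \prod_(k < q) (k`!%:R * g k.+1)).
Proof.
have two k : 2 * moment 1 k.*2 = Num.sqrt pi * g k :> R.
  by rewrite moment_even// expr1n !divr1; field.
have -> : (\matrix_(i < n, j < n) f i j 0) = block_mx
    (Num.sqrt pi *: \matrix_(i < p, j < p) g (i + j)) 0 0
    (Num.sqrt pi *: \matrix_(i < q, j < q) g (i + j).+1).
  apply/matrixP => i j; rewrite mxE /f -/(moment _ _).
  case: (split_ordP i) => a ->; case: (split_ordP j) => b ->;
    rewrite ?block_mxEul ?block_mxEur ?block_mxEdl ?block_mxEdr !mxE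
      ?interlace_lshift ?interlace_rshift.
  - by rewrite -doubleD odd_double two.
  - by rewrite addnS -doubleD /= odd_double.
  - by rewrite addSn -doubleD /= odd_double.
  - by rewrite addnS addSn -doubleD -doubleS odd_double two.
rewrite det_ublock !detZ det_hankel ?invr_gt0//; congr (_ * (_ * _)).
transitivity (\det (2^-1 *: \matrix_(i < q, j < q) (rising (3 / 2) (i + j) : R))).
  by congr (\det _); apply/matrixP => i j; rewrite !mxE rising_half_succ.
rewrite detZ det_hankel ?divr_gt0// -[X in _ ^+ X]card_ord -prodr_const -big_split.
by apply: eq_bigr => k _; rewrite /= rising_half_succ mulrCA.
Qed.

Lemma gap_slope2 : gaussian_constant R 2 n * mehta2 R p q = 1 ->
  gap_slope 2 n (- (2 / Num.sqrt pi * cbin_sum R p)).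
Proof.
move=> mehta; have n0 : (0 < n)%N by rewrite addn_gt0 p_gt0.
pose i0 : 'I_n := Ordinal n0.
have ei0 : e i0 = 0%N by rewrite /interlace /= p_gt0.
(* The even block of M(0) is sqrt pi times the Hankel matrix, and row 0 of M'(0) is -2 in column 0
   and zero elsewhere; the odd block is not involved. *)
pose r (i : 'I_n) : R :=
  if (i < p)%N then - (2 / Num.sqrt pi) * alt_row 2^-1 p i else 0.
have -> : - (2 / Num.sqrt pi * cbin_sum R p) = r i0.
  by rewrite /r /= p_gt0 alt_row0 mulNr.
pose df (i j : 'I_n) (t : R) : R :=
  if odd (e i + e j) then 0 else - (2 * gmono 1 (e i + e j) t).
apply: (gap_slope_det (df := df) gap2E).
- move=> i j t; rewrite /f /df; case: ifP => _; first exact: is_derive_cst.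
  exact: is_derive_tail_gmono.
- move=> i j; rewrite /df; case: (odd _); last exact: continuous_scaled_gmono.
  by move=> t; exact: cvg_cst.
- rewrite det0 -mulrA (mulrA n`!%:R) -/(mehta2 R p q) mehta normr1//.
- move=> i j ii0; rewrite /df gmono0E.
  have -> : (e i + e j == 0)%N = false; last by rewrite mulr0 oppr0 if_same.
  apply/negbTE; rewrite addn_eq0 negb_and; apply/orP; left.
  apply: contraNneq ii0; rewrite /interlace; case: ifP => // _ h.
  by apply/eqP/val_inj => /=; move: h; case: (nat_of_ord i).
- move=> j; rewrite big_split_ord /= [X in _ + X]big1 ?addr0; last first.
    by move=> i _; rewrite /r /= ltnNge leq_addr mul0r.
  rewrite /df /f; case: (split_ordP j) => b ->.
  + rewrite ei0 interlace_lshift add0n odd_double gmono0E.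
    transitivity (- 2 * \sum_(i < p) alt_row 2^-1 p i * g (i + b)).
      rewrite mulr_sumr; apply: eq_bigr => i _.
      rewrite interlace_lshift -doubleD odd_double /r /= ltn_ord.
      rewrite -/(moment _ _) moment_even// expr1n !divr1.
      by field; exact: sqrtpi_neq0.
    rewrite alt_row_hankel ?invr_gt0// mulNr; congr (- (_ * _%:R)).
    by case: (nat_of_ord b).
  + rewrite ei0 interlace_rshift add0n oddS odd_double.
    rewrite big1// => i _; rewrite interlace_lshift addnS -doubleD /=.
    by rewrite odd_double mulr0.
Qed.
End unitary_ensemble.

(** * The case beta = 4 *)

Section symplectic_ensemble.
Context (R : realType).
Local Notation T := (measurableTypeR R).
Variable n : nat.
Local Notation e := (interlace n).
Local Notation g := (rising (2^-1 : R)).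

Let confluent_interlace : exists2 s : R, `|s| = 1 & forall (x : n.-tuple T) c,
  (\prod_j c (tnth x j)) * `|vdm x| ^+ 4 = s * \det (row_mx
    (\matrix_(k < n + n, j < n) (tnth x j ^+ e k * c (tnth x j)))
    (\matrix_(k < n + n, j < n) ((e k)%:R * tnth x j ^+ (e k).-1))).
Proof.
have [d Hd] := @det_interlace R n n (leqnn n) (leqnSn n).
pose S : R := \prod_(i < n) \prod_(j < n | (i < j)%N) -1.
have S1 : `|S| = 1.
  by rewrite normr_prod big1// => i _; rewrite normr_prod big1// => j _; rewrite normrN1.
exists (S * (-1) ^+ d) => [|x c]; first by rewrite normrM S1 mul1r normr_sign.
pose G k (j : 'I_(n + n)) : R := match fintype.split j with
  | inl l => tnth x l ^+ k | inr l => tnth x l ^+ k.-1 *+ k end.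
pose C (j : 'I_(n + n)) : R := match fintype.split j with
  | inl l => c (tnth x l) | inr l => 1 end.
have -> : row_mx
    (\matrix_(k < n + n, j < n) (tnth x j ^+ e k * c (tnth x j)))
    (\matrix_(k < n + n, j < n) ((e k)%:R * tnth x j ^+ (e k).-1)) =
    \matrix_(k, j) (G (e k) j * C j).
  apply/matrixP => k j; rewrite !mxE /G /C.
  by case: fintype.split => l; rewrite !mxE// mulr1 mulr_natl.
rewrite det_scale_cols (Hd G).
have -> : \prod_j C j = \prod_j c (tnth x j).
  rewrite big_split_ord /= [X in _ * X]big1 ?mulr1 => [|j _]; last first.
    by rewrite /C (unsplitK (inr j)).
  by apply: eq_bigr => j _; rewrite /C (unsplitK (inl j)).
have -> : \det (\matrix_(i, j) G i j) = S * vdm x ^+ 4.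
  rewrite vdmE -det_confluent; congr (\det _).
  by apply/matrixP => k j; rewrite !mxE /G; case: fintype.split => l; rewrite !mxE.
have SS : S * S = 1 by rewrite -expr2 -[S ^+ 2]real_normK ?num_real// S1 expr1n.
have dd : (-1) ^+ d * (-1) ^+ d = 1 :> R by rewrite -expr2 sqrr_sign.
rewrite (exprM _ 2 2) real_normK ?num_real// -exprM.
rewrite (_ : S * _ * _ = (S * S) * ((-1) ^+ d * (-1) ^+ d) *
  (\prod_j c (tnth x j) * vdm x ^+ 4)); last by ring.
by rewrite SS dd !mul1r.
Qed.

(** The pairing of x^(2 i) with the derivative of x^(2 j + 1), less that of x^(2 j + 1) with the
    derivative of x^(2 i). *)
Let f (i j : 'I_n) (t : R) : R :=
  ((j.*2.+1)%:R - (i.*2)%:R) * 2 * tail (gmono 2 (i + j).*2) t.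

Let gap4E : exists2 s : R, `|s| = 1 & forall eps, 0 <= eps ->
  gap_probability 4 n eps =
    gaussian_constant R 4 n * s * n`!%:R * \det (\matrix_(i, j) f i j eps).
Proof.
have [s s1 Hs] := confluent_interlace; exists s => // eps eps0.
pose a (k : 'I_(n + n)) : R -> R := cutoff eps (gmono 2 (e k)).
pose b (k : 'I_(n + n)) (y : R) : R := (e k)%:R * y ^+ (e k).-1.
have ab k l : (fun x => a k x * b l x) =
    (fun x => (e l)%:R * cutoff eps (gmono 2 (e k + (e l).-1)) x).
  apply/funext => x; rewrite /a /b cutoff_gmonoE [in RHS]cutoff_gmonoE exprD.
  ring.
have I k := Rintegral_cutoff_gmono k (ltr0n R 2 : 0 < (2 : R)) eps0.
have [|iF EF] := Rintegral_pair (a := a) (b := b).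
  move=> k l; rewrite ab.
  exact: (integrableZl measurableT (e l)%:R (I (e k + (e l).-1)%N).1).
have isF := integrableZl measurableT s iF.
rewrite (gap_probabilityE _ isF) => [|x]; last first.
  rewrite /= (_ : 4%:R / 2 = 2 :> R); last by field.
  rewrite Hs; congr (_ * \det (row_mx _ _)); apply/matrixP => k j; rewrite !mxE//.
  by rewrite /a [RHS]cutoff_gmonoE.
rewrite RintegralZl// EF.
have -> : (\matrix_(k, l) \int[@lebesgue_measure R]_x (a k x * b l x)) =
    block_mx 0 (\matrix_(i, j) ((j.*2.+1)%:R * (2 * tail (gmono 2 (i + j).*2) eps)))
      (\matrix_(i, j) ((j.*2)%:R * (2 * tail (gmono 2 (i + j).*2) eps))) 0.
  apply/matrixP => k l; rewrite mxE ab RintegralZl//; last exact: (I _).1.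
  rewrite (I _).2; case: (split_ordP k) => i ->; case: (split_ordP l) => j ->;
    rewrite ?block_mxEul ?block_mxEur ?block_mxEdl ?block_mxEdr !mxE
      ?interlace_lshift ?interlace_rshift.
  (* Even against even pairs to an odd integrand; for [j = 0], where the predecessor of the exponent
     is truncated, the coefficient is 0. *)
  - by case: (nat_of_ord j) => [|m]; rewrite ?mul0r// doubleS /= addnS -doubleD
      oddS odd_double mulr0.
  - by rewrite -doubleD odd_double.
  - case: (nat_of_ord j) => [|m]; rewrite ?mul0r// doubleS /= addSn addnS -doubleD.
    by rewrite oddS odd_double addnS doubleS.
  - by rewrite addSn -doubleD oddS odd_double mulr0.
rewrite pair_sum_block !mulrA; congr (_ * \det _).
by apply/matrixP => i j; rewrite !mxE /f (addnC j); ring.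
Qed.

Let moment_f (i j : 'I_n) : f i j 0 = Num.sqrt (pi / 2) *
  (((j.*2.+1)%:R - (i.*2)%:R) * g (i + j)) * 2 ^- i * 2 ^- j.
Proof.
rewrite /f -/(moment _ _) moment_even// exprD; field.
by rewrite !expf_neq0.
Qed.

Let det0 : n`!%:R * \det (\matrix_(i < n, j < n) f i j 0) = mehta4 R n.
Proof.
rewrite /mehta4 -det_quaternionic; congr (_ * _).
transitivity (\det (\matrix_(i < n, j < n) ((Num.sqrt (pi / 2) *
    (((j.*2.+1)%:R - (i.*2)%:R) * g (i + j)) * 2 ^- i) * 2 ^- j))).
  by congr (\det _); apply/matrixP => i j; rewrite !mxE moment_f.
rewrite det_scale_cols -det_tr.
transitivity (\prod_(j < n) 2 ^- j * \det (\matrix_(j < n, i < n) ((Num.sqrt (pi / 2) *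
    (((j.*2.+1)%:R - (i.*2)%:R) * g (i + j))) * 2 ^- i))).
  by congr (_ * \det _); apply/matrixP => i j; rewrite !mxE.
rewrite det_scale_cols mulrA -expr2 mulrCA; congr (_ * _).
rewrite -detZ -det_tr; congr (\det _).
by apply/matrixP => i j; rewrite !mxE.
Qed.

Lemma gap_slope4 : (0 < n)%N -> gap_slope 4 n
  (- (2 / Num.sqrt (pi / 2) * \sum_(k < n) (odd (n - k))%:R * cbin R k)).
Proof.
move=> n0; pose i0 : 'I_n := Ordinal n0.
have s0 : Num.sqrt (pi / 2) != 0 :> R.
  by rewrite gt_eqF// sqrtr_gt0 divr_gt0// pi_gt0.
(* The factor 2^i undoes the row scaling 2^-i of the moments of e^(-2 x^2). *)
pose r (i : 'I_n) : R := - (2 / Num.sqrt (pi / 2)) * (2 ^+ i * quat_row R n i).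
have -> : - (2 / Num.sqrt (pi / 2) * \sum_(k < n) (odd (n - k))%:R * cbin R k) = r i0.
  by rewrite /r /= expr0 mul1r quat_row0 mulNr.
pose df (i j : 'I_n) (t : R) : R :=
  - (((j.*2.+1)%:R - (i.*2)%:R) * 2 * gmono 2 (i + j).*2 t).
have [s s1 gapE] := gap4E.
apply: (gap_slope_det (df := df) gapE).
- by move=> i j t; exact: is_derive_tail_gmono.
- by move=> i j; exact: continuous_scaled_gmono.
- by rewrite -mulrA det0 (mulrC _ s) -mulrA mehta4E mulr1.
- move=> i j ii0; rewrite /df gmono0E (_ : (_ == 0)%N = false) ?mulr0 ?oppr0//.
  apply/negbTE; rewrite double_eq0 addn_eq0 negb_and; apply/orP; left.
  by apply: contraNneq ii0 => h; apply/eqP/val_inj.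
- move=> j.
  transitivity (- 2 * (2 ^- j * \sum_(i < n) quat_row R n i *
      (((j.*2.+1)%:R - (i.*2)%:R) * g (i + j)))).
    rewrite mulr_sumr mulr_sumr; apply: eq_bigr => i _; rewrite moment_f /r; field.
    by rewrite s0 !expf_neq0.
  rewrite quat_row_solve// /df gmono0E double_eq0 /= add0n.
  case: (nat_of_ord j) => [|m]; last by rewrite /= !mulr0 oppr0.
  by rewrite expr0 invr1 double0 eqxx; ring.
Qed.
End symplectic_ensemble.

(** * The case beta = 1 *)

Section orthogonal_ensemble.
Context (R : realType).
Local Notation T := (measurableTypeR R).
Local Notation g := (rising (2^-1 : R)).

Let half0 : 0 < (1 / 2 : R). Proof. by []. Qed.
Let a i : R -> R := gmono (1 / 2) i.*2.
Let b i : R -> R := gmono (1 / 2) i.*2.+1.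
Let ca i : cont_integrable (a i). Proof. exact: cont_integrable_gmono. Qed.
Let cb i : cont_integrable (b i). Proof. exact: cont_integrable_gmono. Qed.

Let even_odd_gmono p i x : even_odd p a b i x = gmono (1 / 2) (interlace p i) x.
Proof.
rewrite /even_odd /interlace /a /b /gmono; case: ifP => _.
  by rewrite -mul2n !exprM real_normK ?num_real.
rewrite mulrA real_normK ?num_real//; congr (_ * _).
by rewrite exprS mulrA -numEsg [RHS]exprS -mul2n !exprM real_normK ?num_real.
Qed.

Lemma gap_probability1E p q : (q <= p)%N -> (p <= q.+1)%N ->
  exists d : bool, forall eps : R, gap_probability 1 (p + q) eps =
    gaussian_constant R 1 (p + q) * ((-1) ^+ d * sign_int (p + q) (even_odd p a b) eps).
Proof.
move=> qp pq; have [d Hd] := vdm_interlace R qp pq; exists d => eps.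
have iF := @integrable_sign_det R (p + q) _
  (fun i => integrable_cutoff eps (integrable_even_odd p i ca cb)).
have isF := integrableZl measurableT ((-1) ^+ d) iF.
rewrite (gap_probabilityE _ isF) => [|x]; first by rewrite RintegralZl.
rewrite expr1 normrEsg {2}Hd /sign_det /= mulrCA [RHS]mulrCA; congr (_ * _).
rewrite mulrCA; congr (_ * _); rewrite -det_scale_cols; congr (\det _).
apply/matrixP => i j; rewrite !mxE.
rewrite [RHS](_ : _ = cutoff eps (gmono (1 / 2) (interlace p i)) (tnth x j)).
  by rewrite [RHS]cutoff_gmonoE.
by rewrite /cutoff even_odd_gmono.
Qed.

(** Entries after the iterated tails are eliminated: two factors e^(-x^2 / 2) merge into e^(-x^2),
    while the border of the odd case keeps a single one. *)
Let h m (i j : nat) (t : R) : R :=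
  if (j < m)%N then tail (gmono 1 (i + j).*2) t else tail (gmono (1 / 2) i.*2) t.

Let double_half : 2 * (1 / 2) = 1 :> R. Proof. by field. Qed.

Let a_tail_b0 i x : a i x * tail (b 0) x = gmono 1 i.*2 x.
Proof.
have := tail_gmono1 x half0; rewrite double_half (mul1r (tail _ _)) => ->.
rewrite /a /gmono expr0 (mul1r (expR _)) -mulrA -expRD; congr (_ * expR _).
by field.
Qed.

Let a_tail_bS i k x : a i x * tail (b k.+1) x =
  k.+1.*2%:R * (a i x * tail (b k) x) + gmono 1 (i + k.+1).*2 x.
Proof.
have := tail_gmonoSS k.*2.+1 x half0; rewrite double_half (mul1r (tail _ _)).
rewrite -doubleS /b doubleS => ->; rewrite mulrDr mulrCA; congr (_ + _).
rewrite /a /gmono doubleD exprD mulrACA -expRD; congr (_ * expR _).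
by field.
Qed.

Let ab_integrable i k : cont_integrable (fun x => a i x * tail (b k) x).
Proof. by apply: cont_integrableMr => //; exact: cont_bounded_tail. Qed.

(** Integration by parts gives tail(b_(k+1)) = 2 (k + 1) tail(b_k) + x^(2 k + 2) e^(-x^2 / 2), so
    subtracting from each column a multiple of the preceding one leaves single tails. The
    coefficients vanish from [m] on to spare the border. *)
Let det_shift m n t : \det (\matrix_(i < n, j < n)
    if (j < m)%N then tail (fun x => a i x * tail (b j) x) t else tail (a i) t) =
  \det (\matrix_(i < n, j < n) h m i j t).
Proof.
pose F (j i : nat) := if (j < m)%N then tail (fun x => a i x * tail (b j) x) t
                      else tail (a i) t.
pose c j : R := if (j < m)%N then j.*2%:R else 0.
have c0 : c 0%N = 0 by rewrite /c; case: ifP.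
transitivity (\det (\matrix_(j < n, i < n) F j i)).
  by rewrite -det_tr; congr (\det _); apply/matrixP => i j; rewrite !mxE.
rewrite -(det_row_shift n F c0) -det_tr; congr (\det _); apply/matrixP => i j.
rewrite !mxE /F /c /h; case: (ltnP j m) => jm; last by rewrite mul0r subr0.
case: {j}(nat_of_ord j) jm => [|k] km /=.
  rewrite double0 mul0r subr0 addn0; congr (tail _ t).
  by apply/funext => x; exact: a_tail_b0.
rewrite (ltnW km); apply/eqP; rewrite subr_eq addrC -subr_eq0; apply/eqP.
have itv (f : R -> R) : cont_integrable f ->
    (@lebesgue_measure R).-integrable `]t, +oo[ (EFin \o f).
  by move=> [_ i_f]; exact: integrableS i_f.
have i1 := itv _ (ab_integrable i k).
have i2 := itv _ (cont_integrable_gmono (i + k.+1).*2 (ltr01 : 0 < (1 : R))).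
rewrite {1}/tail; under eq_Rintegral do rewrite a_tail_bS.
have i1Z : (@lebesgue_measure R).-integrable `]t, +oo[
    (EFin \o (fun x => k.+1.*2%:R * (a i x * tail (b k) x))).
  have mt : measurable (`]t, +oo[%classic : set T) by [].
  exact: (integrableZl mt (k.+1.*2%:R : R) i1).
rewrite RintegralD//.
by rewrite RintegralZl// -!/(tail _ _) subrr.
Qed.

Let h0 m i j : h m i j 0 = if (j < m)%N then Num.sqrt pi / 2 * g (i + j)
  else Num.sqrt (2 * pi) / 2 * (2 ^+ i * g i).
Proof.
rewrite /h; case: ifP => _.
  by rewrite -/(moment _ _) moment_even// expr1n !divr1.
rewrite -/(moment _ _) moment_even//.
have -> : pi / (1 / 2) = 2 * pi :> R by field.
by rewrite div1r exprVn invrK (mulrC (g i)).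
Qed.

Let dh m (i j : nat) (t : R) : R :=
  if (j < m)%N then - gmono 1 (i + j).*2 t else - gmono (1 / 2) i.*2 t.

Let is_derive_h m i j t : is_derive t (1 : R) (h m i j) (dh m i j t).
Proof.
rewrite /h /dh; case: (j < m)%N; apply: is_derive_tail;
  exact: cont_integrable_gmono.
Qed.

Let continuous_dh m i j : continuous (dh m i j).
Proof.
rewrite /dh; case: (j < m)%N => t; apply: cvgN; exact: continuous_gmono.
Qed.

Let dh_row m i j : (0 < i)%N -> dh m i j 0 = 0.
Proof.
move=> i0; rewrite /dh !gmono0E !double_eq0 addn_eq0.
by rewrite (gtn_eqF i0) /= oppr0 if_same.
Qed.

Let dh_row0 m j : dh m 0 j 0 = if (j < m)%N then - (j == 0%N)%:R else - 1.
Proof. by rewrite /dh !gmono0E double_eq0. Qed.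

Lemma gap_slope1_even m : (0 < m)%N ->
  gap_slope 1 m.*2 (- (2 / Num.sqrt pi * cbin_sum R m)).
Proof.
move=> m0; pose i0 : 'I_m := Ordinal m0; rewrite -addnn.
have [d Hd] := gap_probability1E (leqnn m) (leqnSn m).
have [[e He] _] := ensembles R m.
pose r (i : 'I_m) : R := - (2 / Num.sqrt pi) * alt_row 2^-1 m i.
have -> : - (2 / Num.sqrt pi * cbin_sum R m) = r i0 by rewrite /r /= alt_row0 mulNr.
pose kappa : R := (-1) ^+ d * (-1) ^+ e *
  (gaussian_constant R 1 (m + m) * ((m + m)`!%:R * 2 ^+ (m + m))).
apply: (gap_slope_det (kappa := kappa) (f := h m) (df := dh m)).
- move=> eps eps0; rewrite Hd He// /det_even /kappa.
  rewrite (_ : \det _ = \det (\matrix_(i < m, j < m) h m i j eps)); first by ring.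
  rewrite -det_shift; congr (\det _); apply/matrixP => i j.
  by rewrite !mxE ltn_ord.
- by move=> i j t; exact: is_derive_h.
- by move=> i j; exact: continuous_dh.
- have -> : \det (\matrix_(i < m, j < m) h m i j 0) =
      (Num.sqrt pi / 2) ^+ m * \prod_(k < m) (k`!%:R * g k).
    rewrite -det_hankel ?invr_gt0// -detZ; congr (\det _).
    by apply/matrixP => i j; rewrite !mxE h0 ltn_ord.
  have [mehta _] := mehta1E R m.
  rewrite (_ : kappa * _ =
    (-1) ^+ d * (-1) ^+ e * (gaussian_constant R 1 m.*2 * mehta1 R m 0)).
    by rewrite mehta mulr1 normrM !normr_sign mulr1.
  by rewrite /kappa /mehta1 addnn add0n expr0; ring.
- move=> i j ii0; apply: dh_row; rewrite lt0n.
  by apply: contraNneq ii0 => hi; apply/eqP/val_inj.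
- move=> j; rewrite dh_row0 ltn_ord.
  transitivity (- 1 * \sum_(i < m) alt_row 2^-1 m i * g (i + j)).
    rewrite mulr_sumr; apply: eq_bigr => i _; rewrite h0 ltn_ord /r.
    by field; exact: sqrtpi_neq0.
  by rewrite alt_row_hankel ?invr_gt0// mulN1r.
Qed.

Lemma gap_slope1_odd m : gap_slope 1 m.*2.+1 (- (2 / Num.sqrt pi * cbin_sum R m) +
  (-1) ^+ m * ((Num.sqrt 2 * cbin_alt R m - 1) * (2 / Num.sqrt (2 * pi)))).
Proof.
have -> : m.*2.+1 = (m.+1 + m)%N by rewrite addSn addnn.
have [d Hd] := gap_probability1E (leqnSn m) (leqnn m.+1).
have [_ [e He]] := ensembles R m.
have g0 : g m != 0 by rewrite gt_eqF// rising_gt0 ?invr_gt0.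
(* The last Laguerre row annihilates the [m] Hankel columns, so adding a multiple of it is free
   there; [c] is the multiple that makes the border column come out as -1. *)
pose c : R := (Num.sqrt 2 * cbin_alt R m - 1) * (2 / Num.sqrt (2 * pi)) / g m.
pose r (i : 'I_m.+1) : R := - (2 / Num.sqrt pi) * alt_row 2^-1 m i +
  c * laguerre 2^-1 m i.
have -> : - (2 / Num.sqrt pi * cbin_sum R m) +
  (-1) ^+ m * ((Num.sqrt 2 * cbin_alt R m - 1) * (2 / Num.sqrt (2 * pi))) = r ord0.
  rewrite /r /= alt_row0 mulNr laguerre_col0; congr (_ + _).
  by rewrite /c [RHS]mulrCA divfK.
pose kappa : R := (-1) ^+ d * (-1) ^+ e *
  (gaussian_constant R 1 (m.+1 + m) * ((m.+1 + m)`!%:R * 2 ^+ (m.+1 + m))).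
apply: (gap_slope_det (kappa := kappa) (f := h m) (df := dh m)).
- move=> eps eps0; rewrite Hd He// /det_odd /kappa det_shift; ring.
- by move=> i j t; exact: is_derive_h.
- by move=> i j; exact: continuous_dh.
- have -> : \det (\matrix_(i < m.+1, j < m.+1) h m i j 0) =
      (Num.sqrt pi / 2) ^+ m * (\prod_(k < m) (k`!%:R * g k)) *
      (Num.sqrt (2 * pi) / 2 * g m).
    transitivity (\det (\matrix_(i < m.+1, j < m.+1)
      ((if (j < m)%N then g (i + j) else 2 ^+ i * g i) *
       (if (j < m)%N then Num.sqrt pi / 2 else Num.sqrt (2 * pi) / 2)))).
      congr (\det _); apply/matrixP => i j; rewrite !mxE h0.
      by case: ifP => _; rewrite mulrC.
    rewrite (det_scale_cols (fun i j : 'I_m.+1 => if (j < m)%N then g (i + j) else 2 ^+ i * g i)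
      (fun j => if (j < m)%N then _ else _)).
    rewrite det_hankel_border ?invr_gt0// big_ord_recr /= ltnn.
    under eq_bigr do rewrite ltn_ord.
    by rewrite prodr_const card_ord; ring.
  have [_ mehta] := mehta1E R m.
  rewrite (_ : kappa * _ =
    (-1) ^+ d * (-1) ^+ e * (gaussian_constant R 1 m.*2.+1 * mehta1 R m 1)).
    by rewrite mehta mulr1 normrM !normr_sign mulr1.
  by rewrite /kappa /mehta1 addSn addnn add1n expr1; ring.
- move=> i j ii0; apply: dh_row; rewrite lt0n.
  by apply: contraNneq ii0 => hi; apply/eqP/val_inj.
- move=> j; rewrite dh_row0.
  have alt_last : alt_row (2^-1 : R) m m = 0.
    by rewrite /alt_row big1// => k _; rewrite laguerre_gt ?mulr0.
  under eq_bigr do rewrite h0.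
  case: ifPn => jm.
    transitivity (- 1 * (\sum_(i < m.+1) alt_row 2^-1 m i * g (i + j)) +
        c * (Num.sqrt pi / 2) * (\sum_(i < m.+1) laguerre 2^-1 m i * g (i + j))).
      rewrite !mulr_sumr -big_split; apply: eq_bigr => i _; rewrite /r /=.
      by field; exact: sqrtpi_neq0.
    rewrite laguerre_hankel ?invr_gt0// ffact_small// mul0r mulr0 addr0.
    by rewrite big_ord_recr /= alt_last mul0r addr0 alt_row_hankel ?invr_gt0// mulN1r.
  transitivity (- Num.sqrt 2 * (\sum_(i < m.+1) alt_row 2^-1 m i * (2 ^+ i * g i)) +
      c * (Num.sqrt (2 * pi) / 2) * (\sum_(i < m.+1) laguerre 2^-1 m i * (2 ^+ i * g i))).
    rewrite !mulr_sumr -big_split; apply: eq_bigr => i _; rewrite /r /= sqrt2pi.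
    by field; exact: sqrtpi_neq0.
  rewrite laguerre_geometric ?invr_gt0// big_ord_recr /= alt_last mul0r addr0.
  rewrite alt_row_geometric ?invr_gt0// -/(cbin_alt R m) /c sqrt2pi.
  by field; rewrite g0 sqrt2_neq0 sqrtpi_neq0.
Qed.
End orthogonal_ensemble.

(** * Asymptotics of the slopes *)

Section asymptotics.
Context (R : realType).
Implicit Types n : nat.

Lemma gap_slope_lim beta n (v : R) : gap_slope beta n v ->
  cvg (derive1 (gap_probability beta n) eps @[eps --> (0 : R)^'+]) /\
  gap_probability_slope R beta n = v.
Proof.
move=> [_ lv]; split; first by apply/cvg_ex; exists v.
exact: (cvg_lim (@norm_hausdorff R R) lv).
Qed.

(** [rho] is the density of terms in the sum relative to [n], [B] a bounded correction; the last
    hypothesis says that prefactor and density combine to the common constant. *)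
Lemma cvg_slope_ratio (S : nat -> R) (h : nat -> nat) (B : nat -> R) (A rho C : R) :
  0 <= rho -> (forall n, `|(h n)%:R - rho * n%:R| <= 1) ->
  (forall n, `|B n| <= C) ->
  (forall n, (0 < n)%N -> S n = - (A * cbin_sum R (h n) + B n)) ->
  A * (2 * Num.sqrt (rho / pi)) = 2 * Num.sqrt 2 / pi ->
  S n / (- (2 * Num.sqrt 2 / pi) * Num.sqrt n%:R) @[n --> \oo] --> (1 : R).
Proof.
move=> rho0 hrho BC SE AE; pose K : R := 2 * Num.sqrt 2 / pi.
have K0 : K != 0 by rewrite gt_eqF// divr_gt0 ?pi_gt0// mulr_gt0// sqrtr_gt0.
have L : (A * (cbin_sum R (h n) / Num.sqrt n%:R) + B n / Num.sqrt n%:R) / K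
    @[n --> \oo] --> (1 : R).
  rewrite [X in _ --> X](_ : 1 = (A * (2 * Num.sqrt (rho / pi)) + 0) / K); last first.
    by rewrite addr0 AE divff.
  apply: cvgM; last exact: cvg_cst.
  apply: cvgD; last exact: (bounded_div_cvg0 BC (@cvg_sqrt_natr R)).
  by apply: cvgM; [exact: cvg_cst|exact: cvg_cbin_sum].
apply: cvg_trans L; apply: near_eq_cvg; near=> n.
have n0 : (0 < n)%N by near: n; exact: nbhs_infty_gt.
have s0 : Num.sqrt n%:R != 0 :> R by rewrite gt_eqF// sqrtr_gt0 ltr0n.
rewrite SE// -/K; field.
by rewrite s0 K0.
Unshelve. all: by end_near. Qed.

Let sqrt2E : Num.sqrt 2 = 2 / Num.sqrt 2 :> R.
Proof.
by apply: (mulIf (sqrt2_neq0 R)); rewrite divfK ?sqrt2_neq0// -expr2 sqr_sqrtr.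
Qed.

Let piE : pi = Num.sqrt pi ^+ 2 :> R.
Proof. by rewrite sqr_sqrtr ?pi_ge0. Qed.

Let half_density : 2 / Num.sqrt pi * (2 * Num.sqrt (2^-1 / pi)) =
  2 * Num.sqrt 2 / pi :> R.
Proof.
rewrite sqrtrM ?invr_ge0// !sqrtrV ?pi_ge0// [in RHS]piE [Num.sqrt 2 in RHS]sqrt2E.
by field; rewrite sqrt2_neq0 sqrtpi_neq0.
Qed.

Let half_close n : `|n./2%:R - 2^-1 * n%:R| <= 1 :> R.
Proof.
rewrite -{2}(odd_double_half n) natrD -muln2 natrM.
by case: (odd n) => /=; rewrite ler_norml; apply/andP; split; lra.
Qed.

Lemma gap_slopes beta : beta \in [:: 1; 2; 4]%N ->
  exists2 S : nat -> R, forall n, (0 < n)%N -> gap_slope beta n (S n) &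
  S n / (- (2 * Num.sqrt 2 / pi) * Num.sqrt n%:R) @[n --> \oo] --> (1 : R).
Proof.
rewrite !inE => /or3P[] /eqP ->.
- pose b m : R := (-1) ^+ m * ((Num.sqrt 2 * cbin_alt R m - 1) * (2 / Num.sqrt (2 * pi))).
  (* For odd [n] the border contributes a term with alternating sign, bounded since [cbin_alt] lies
     between 0 and 1. *)
  pose B n : R := if odd n then - b n./2 else 0.
  exists (fun n => - (2 / Num.sqrt pi * cbin_sum R n./2 + B n)) => [n n0|].
    rewrite -[X in gap_slope 1 X](odd_double_half n) /B opprD.
    case: (boolP (odd n)) => on.
      by rewrite opprK add1n; exact: gap_slope1_odd.
    rewrite oppr0 addr0; apply: gap_slope1_even.
    by case: n n0 on => [|[]].
  apply: (cvg_slope_ratio (h := half) (B := B) (A := 2 / Num.sqrt pi)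
    (rho := 2^-1) (C := (Num.sqrt 2 + 1) * (2 / Num.sqrt (2 * pi)))) => //.
  have C0 : 0 <= 2 / Num.sqrt (2 * pi) :> R by rewrite divr_ge0.
  move=> n; rewrite /B; case: (odd n); last first.
    by rewrite normr0 mulr_ge0// addr_ge0.
  have /andP[y0 y1] := cbin_alt_bound R n./2.
  rewrite normrN /b normrM normr_sign mul1r normrM.
  rewrite (ger0_norm C0) ler_wpM2r// (le_trans (ler_normB _ _))// normr1 lerD2r.
  by rewrite normrM !ger0_norm// ler_piMr.
- exists (fun n => - (2 / Num.sqrt pi * cbin_sum R (uphalf n))) => [n n0|].
    have nE : n = (uphalf n + n./2)%N.
      by rewrite uphalf_half -addnA addnn odd_double_half.
    rewrite [X in gap_slope 2 X]nE; apply: gap_slope2.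
    + by rewrite uphalf_half leq_addl.
    + by rewrite uphalf_half; case: (odd n); rewrite ?add1n// add0n leqnSn.
    + by rewrite uphalf_half; case: n n0 {nE} => [|[|n]] //= _; rewrite addnS.
    + have [me mo] := mehta2E R n./2.
      rewrite uphalf_half; case: (odd n) => /=.
        by rewrite add1n addSn addnn.
      by rewrite add0n addnn.
  apply: (cvg_slope_ratio (h := uphalf) (B := fun=> 0) (A := 2 / Num.sqrt pi)
    (rho := 2^-1) (C := 0)) => // [n|n|n _].
  + rewrite uphalf_half natrD -{3}(odd_double_half n) natrD -muln2 natrM.
    by case: (odd n) => /=; rewrite ler_norml; apply/andP; split; lra.
  + by rewrite normr0.
  + by rewrite addr0.
- pose A : R := (Num.sqrt (pi / 2))^-1.
  exists (fun n => - (2 / Num.sqrt (pi / 2) *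
      \sum_(k < n) (odd (n - k))%:R * cbin R k)) => [n|].
    exact: gap_slope4.
  have A0 : 0 <= A by rewrite invr_ge0.
  (* The sum over odd n - k is half of the full sum up to a bounded term, so the prefactor 2 /
     sqrt(pi / 2) is halved and the density is 1. *)
  apply: (cvg_slope_ratio (h := id) (B := fun n => - (A * ((-1) ^+ n * cbin_alt R n)))
    (A := A) (rho := 1) (C := A)) => // [n|n|n n0|].
  + by rewrite mul1r subrr normr0.
  + rewrite normrN normrM (ger0_norm A0) normrM normr_sign mul1r ler_piMr//.
    by have /andP[y0 y1] := cbin_alt_bound R n; rewrite ger0_norm.
  + by rewrite -mulrBr -cbin_sum_odd /A; ring.
  + rewrite /A div1r sqrtrM ?pi_ge0// !sqrtrV ?pi_ge0// [in RHS]piE.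
    by field; rewrite sqrt2_neq0 sqrtpi_neq0.
Qed.
End asymptotics.

Unset Implicit Arguments.
Set Strict Implicit.

Theorem corollary10 (R : realType) (beta : nat)
    (hbeta : beta \in [:: 1; 2; 4]%N) :
  [/\ forall (n : nat) (eps : R), (0 < n)%N -> 0 < eps ->
        derivable (gap_probability beta n) eps 1,
      forall n : nat, (0 < n)%N ->
        cvg (derive1 (gap_probability beta n) eps @[eps --> (0 : R)^'+])
    & gap_probability_slope R beta n /
        (- (2 * Num.sqrt 2 / pi) * Num.sqrt n%:R)
      @[n --> \oo] --> (1 : R)].
Proof.
have [S slopeS cvgS] := @gap_slopes R beta hbeta; split.
- by move=> n eps n0; have [+ _] := slopeS n n0; apply.
- by move=> n n0; have [] := gap_slope_lim (slopeS n n0).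
apply: cvg_trans cvgS; apply: near_eq_cvg; near=> n.
have n0 : (0 < n)%N by near: n; exact: nbhs_infty_gt.
by have [_ ->] := gap_slope_lim (slopeS n n0).
Unshelve. all: by end_near. Qed.
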